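(* Let $a,b,c,c'\in\mathbb{C}$ with $\Re(c)>\Re(b)>0$, $a,c'\notin\mathbb{Z}_{\le0}$, let $\delta\in(0,\frac{\pi}{2})$ be fixed and let $\mathbb{S}=\{y\in\mathbb{C}:|\arg y|\le\frac{\pi}{2}-\delta\}$. Fix a real number $x<0$. Then, as $y\to\infty$ with $y\in\mathbb{S}$, $$\Psi_1[a,b;c,c';x,y]\sim\frac{\Gamma(c)\Gamma(c')}{\Gamma(a)\Gamma(c-b)}(-x)^{-b}y^{a-b-c'}\mathrm{e}^{y}.$$
   Context: All arguments and complex powers take principal values; $f\sim g$ means $f/g\to1$. The Humbert function $\Psi_1$ is defined for $c,c'\notin\mathbb{Z}_{\le 0}$ by $$\Psi_1[a,b;c,c';x,y]=\sum_{m,n=0}^{\infty}\frac{(a)_{m+n}(b)_m}{(c)_m(c')_n}\frac{x^m}{m!}\frac{y^n}{n!}\quad(|x|<1,\ |y|<\infty),$$ where $(\cdot)_n$ is the Pochhammer symbol, and is continued analytically to $\{x\ne1,\ |\arg(1-x)|<\pi,\ |y|<\infty\}$ by the absolutely convergent series $\Psi_1[a,b;c,c';x,y]=\sum_{n=0}^{\infty}\frac{(a)_n}{(c')_n}\,{}_2F_1[a+n,b;c;x]\frac{y^n}{n!}$, with ${}_2F_1$ the principal branch of the Gauss hypergeometric function. *)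

(* Defs.v *)
(* Stdlib real numbers with Coquelicot's complex numbers. *)
From Stdlib Require Import Reals Factorial.
From Coquelicot Require Import Coquelicot.

Local Open Scope C_scope.

Definition Cexp (z : C) : C :=
  ((exp (Re z) * cos (Im z))%R, (exp (Re z) * sin (Im z))%R).

(* Values in (-PI, PI]; the value at 0 is meaningless. *)
Definition Carg (z : C) : R :=
  if Rle_dec 0 (Im z) then acos (Re z / Cmod z) else (- acos (Re z / Cmod z))%R.

Definition Clog (z : C) : C := (ln (Cmod z), Carg z).

Definition Cpower (z s : C) : C := Cexp (s * Clog z).

(* [iota P] is the unique element satisfying [P], if there is one. *)
Definition CLim (u : nat -> C) : C :=
  iota (fun l : C_CompleteNormedModule => filterlim u eventually (locally l)).

Definition CSeries (u : nat -> C) : C :=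
  iota (fun l : C_CompleteNormedModule => is_series u l).

Fixpoint poch (a : C) (n : nat) : C :=
  match n with
  | O => RtoC 1
  | S k => poch a k * (a + RtoC (INR k))
  end.

(* Euler's limit, valid for every z outside {0, -1, -2, ...}. *)
Definition CGamma (z : C) : C :=
  CLim (fun n =>
    RtoC (INR (fact n)) * Cpower (RtoC (INR n)) z / poch z (S n)).

Definition nonpos_int (z : C) : Prop := exists k : nat, z = RtoC (- INR k).

Definition analytic_on (U : C -> Prop) (f : C -> C) : Prop :=
  forall z0 : C, U z0 ->
  exists (u : nat -> C) (r : R), (0 < r)%R /\
    forall z : C, (Cmod (z - z0) < r)%R -> is_pseries u (z - z0) (f z).

(* The plane cut along [1, +oo). *)
Definition slit_plane (z : C) : Prop :=
  z <> RtoC 1 /\ (Rabs (Carg (RtoC 1 - z)) < PI)%R.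

Definition hyp2F1_coef (a b c : C) (m : nat) : C :=
  poch a m * poch b m / (poch c m * RtoC (INR (fact m))).

Definition is_hyp2F1 (a b c : C) (F : C -> C) : Prop :=
  (forall z : C, (Cmod z < 1)%R -> is_pseries (hyp2F1_coef a b c) z (F z)) /\
  analytic_on slit_plane F.

(* Principal branch: the slit plane is connected, so all [F] as above agree
   on it; the value outside the slit plane is meaningless. *)
Definition hyp2F1 (a b c z : C) : C :=
  iota (fun w : C_CompleteNormedModule =>
    exists F : C -> C, is_hyp2F1 a b c F /\ F z = w).

(* The series giving the continuation of Psi_1 to x in the slit plane. For
   |x| < 1, expanding [hyp2F1] and using (a)_{m+n} = (a)_n (a+n)_m turns it
   into the defining double series. *)
Definition Psi1 (a b c c' x y : C) : C :=
  CSeries (fun n =>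
    poch a n / poch c' n * hyp2F1 (a + RtoC (INR n)) b c x
      * (y ^ n / RtoC (INR (fact n)))).

Definition Csector (delta : R) (y : C) : Prop :=
  (Rabs (Carg y) <= PI / 2 - delta)%R.

(* Neighbourhoods of complex infinity. *)
Definition C_infty (P : C -> Prop) : Prop :=
  exists M : R, forall y : C, (M < Cmod y)%R -> P y.

Global Instance C_infty_filter : Filter C_infty.
Proof.
constructor.
- now exists 0%R.
- intros P Q [M HM] [N HN]; exists (Rmax M N); intros y Hy; split.
  + apply HM; apply Rle_lt_trans with (2 := Hy), Rmax_l.
  + apply HN; apply Rle_lt_trans with (2 := Hy), Rmax_r.
- intros P Q HPQ [M HM]; exists M; intros y Hy; apply HPQ, HM, Hy.
Qed.

Definition asymp_equiv (F : (C -> Prop) -> Prop) (f g : C -> C) : Prop :=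
  filterlim (fun y => f y / g y) F (locally (RtoC 1)).

(* Main.v *)
(** Write [d = c - b], [w = x / (x - 1)] (so [0 < w < 1]) and [s = a - b - c'].

    The coefficients of Psi_1 are [A_n = (a)_n / (c')_n * 2F1 (a + n, b; c; x)]. By Pfaff's
    transformation the 2F1 factor is, up to explicit factors, an average over the negative
    binomial law with parameters [n + 1] and [w], which concentrates around [n w / (1 - w)];
    with Euler's limit for Gamma this gives [A_n ~ K n^s], and since the Poisson law of
    parameter [y] concentrates at [y], [exp (- y) Psi_1 ~ K y^s] for real [y -> +oo].

    To reach complex [y], the Taylor coefficients of [E (y) = exp (- y) Psi_1] at a real point
    are Poisson averages of the finite differences of [A_n]. These differences are explicit
    (Leibniz rule and contiguity relations), and their k-th one is [O (k! k^D n^(s-k))], so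
    [E (r z) / r^s], as a power series in [z - 1], is dominated on every disc [|z - 1| <= q < 1]
    uniformly in [r]. Convergence for real [z] therefore forces convergence to [K z^s] on these
    discs, and they exhaust the right half-plane up to scaling.

    The principal branch of 2F1 is [Lambda (t |-> (1 - z t)^(-a))], where [Lambda] is the
    functional with moments [(b)_k / (c)_k]. Instead of Euler's integral, [Lambda] is the limit
    of the expectations under the beta-binomial laws of [j / N]. *)
Require Import Defs.
From Stdlib Require Import Reals Lra Lia Factorial Compare_dec Classical.
From Coquelicot Require Import Coquelicot.

Local Open Scope C_scope.
Local Open Scope R_scope.

(** * Absolutely convergent complex series and dominated limits *)

(** For complex y the moduli of the Poisson weights add up to exp (|y| - Re y), so averaging
    arguments do not survive off the real axis; the sector has to be reached through power series
    alone. This is why the coefficients are carried with all their differences in closed form: A_n ~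
    K n^s by itself says nothing about the differences of A_n. Their bound is kept with the factor
    n!/(n + k)! instead of n^(-k), because this factor turns the Poisson weight at n into exactly
    y^(-k) times the weight at n + k. Pfaff's transformation serves positivity: for x < 0 the powers
    x^m alternate in sign, whereas w^m gives a probability law. Averages are controlled in mean
    square because two sequences are averaged at once, one read at n + j and one at j, and a product
    of mean-square limits needs only the total mass one. The parameters are complex, so the weights
    defining Lambda are complex too; they are dominated by the probability law with parameters Re b
    and Re (c - b). Finally, uniqueness of the continuation is needed only at the given x < 0, so an
    identity theorem along a real segment suffices. *)

Fixpoint csum (u : nat -> C) (n : nat) : C :=
  match n with O => 0%C | S k => (csum u k + u k)%C end.

Fixpoint rsum (u : nat -> R) (n : nat) : R :=
  match n with O => 0 | S k => rsum u k + u k end.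

Lemma rsum_S (u : nat -> R) n : rsum u (S n) = rsum u n + u n.
Proof. reflexivity. Qed.

Lemma csum_S (u : nat -> C) n : csum u (S n) = (csum u n + u n)%C.
Proof. reflexivity. Qed.

Definition abssum (u : nat -> C) : Prop := ex_series (fun n => Cmod (u n)).

(** A total sum, so that it can be rewritten freely under [abssum]; [CSeries_Cser] links it to the
    [iota]-based [CSeries]. *)
Definition Cser (u : nat -> C) : C :=
  (Series (fun n => Re (u n)), Series (fun n => Im (u n))).

Lemma C_eq (x y : C) : Re x = Re y -> Im x = Im y -> x = y.
Proof. destruct x, y; simpl; intros; subst; auto. Qed.

Lemma im_le_Cmod (c : C) : Rabs (Im c) <= Cmod c.
Proof. eapply Rle_trans; [apply Rmax_r | apply Rmax_Cmod]. Qed.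

Lemma Cmod_triangle_sub (x y : C) : Cmod (x - y) <= Cmod x + Cmod y.
Proof. eapply Rle_trans; [apply Cmod_triangle | rewrite Cmod_opp; lra]. Qed.

Lemma Cmod_sub_comm (x y : C) : Cmod (x - y) = Cmod (y - x).
Proof. rewrite <- Cmod_opp; f_equal; ring. Qed.

Lemma Cmod_triangle_rev (x y : C) : Cmod x - Cmod y <= Cmod (x - y).
Proof.
  generalize (Cmod_triangle (x - y) y); replace (x - y + y)%C with x by ring; lra.
Qed.

Lemma csum_ext (u v : nat -> C) n :
  (forall k, (k < n)%nat -> u k = v k) -> csum u n = csum v n.
Proof.
  induction n as [|n IH]; intros H; simpl; auto.
  rewrite IH, H; auto; intros; apply H; lia.
Qed.

Lemma csum_plus (u v : nat -> C) n :
  csum (fun k => u k + v k)%C n = (csum u n + csum v n)%C.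
Proof. induction n as [|n IH]; simpl; [|rewrite IH]; ring. Qed.

Lemma csum_scal (c : C) (u : nat -> C) n :
  csum (fun k => c * u k)%C n = (c * csum u n)%C.
Proof. induction n as [|n IH]; simpl; [|rewrite IH]; ring. Qed.

Lemma csum_minus (u v : nat -> C) n :
  csum (fun k => u k - v k)%C n = (csum u n - csum v n)%C.
Proof. induction n as [|n IH]; simpl; [|rewrite IH]; ring. Qed.

Lemma csum_S_l (u : nat -> C) n :
  csum u (S n) = (u O + csum (fun k => u (S k)) n)%C.
Proof.
  induction n as [|n IH]; [simpl; ring|].
  change (csum u (S (S n))) with (csum u (S n) + u (S n))%C.
  rewrite IH; simpl; ring.
Qed.

Lemma csum_rev (u : nat -> C) n :
  csum (fun k => u (n - S k)%nat) n = csum u n.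
Proof.
  induction n as [|n IH]; auto.
  rewrite csum_S_l. simpl csum at 2. rewrite <- IH, Nat.sub_succ, Nat.sub_0_r.
  simpl. ring.
Qed.

Lemma rsum_le (u v : nat -> R) n :
  (forall k, (k < n)%nat -> u k <= v k) -> rsum u n <= rsum v n.
Proof.
  induction n as [|n IH]; intros H; simpl; [lra|].
  apply Rplus_le_compat; auto.
Qed.

Lemma rsum_scal (c : R) (u : nat -> R) n :
  rsum (fun k => c * u k) n = c * rsum u n.
Proof. induction n as [|n IH]; simpl; [|rewrite IH]; ring. Qed.

Lemma rsum_const (c : R) n : rsum (fun _ => c) n = INR n * c.
Proof. induction n as [|n IH]; [simpl|rewrite S_INR; simpl; rewrite IH]; ring. Qed.

Lemma csum_norm (u : nat -> C) n : Cmod (csum u n) <= rsum (fun k => Cmod (u k)) n.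
Proof.
  induction n as [|n IH]; simpl; [rewrite Cmod_0; lra|].
  eapply Rle_trans; [apply Cmod_triangle | lra].
Qed.

Lemma csum_RtoC (u : nat -> R) n : csum (fun k => RtoC (u k)) n = RtoC (rsum u n).
Proof. induction n as [|n IH]; simpl; auto. rewrite IH, RtoC_plus; auto. Qed.

Lemma rsum_sum_n (u : nat -> R) n : rsum u (S n) = sum_n u n.
Proof.
  induction n as [|n IH]; [simpl; rewrite sum_O; ring|].
  rewrite sum_Sn, <- IH; reflexivity.
Qed.

Lemma csum_sum_n (u : nat -> C) n : csum u (S n) = sum_n (u : nat -> C_NormedModule) n.
Proof.
  induction n as [|n IH]; [simpl; rewrite sum_O; ring|].
  rewrite sum_Sn, <- IH; reflexivity.
Qed.

Lemma ex_series_le_R (a b : nat -> R) :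
  (forall n, 0 <= a n <= b n) -> ex_series b -> ex_series a.
Proof.
  intros H Hb; apply (ex_series_le (V := R_CompleteNormedModule) a b); auto.
  intros n; unfold norm; simpl; unfold abs; simpl; rewrite Rabs_pos_eq; apply H.
Qed.

Lemma ex_series_bounded (a : nat -> R) M :
  (forall n, 0 <= a n) -> (forall n, rsum a n <= M) -> ex_series a.
Proof.
  intros Ha HM.
  destruct (ex_finite_lim_seq_incr (sum_n a) M) as [l Hl].
  - intros n; rewrite sum_Sn; unfold plus; simpl; specialize (Ha (S n)); lra.
  - intros n; rewrite <- rsum_sum_n; auto.
  - exists l; exact Hl.
Qed.

Lemma is_series_lim (a : nat -> R) l :
  is_series a l -> is_lim_seq (rsum a) l.
Proof.
  intros H; apply is_lim_seq_incr_1.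
  apply is_lim_seq_ext with (sum_n a); [|exact H].
  intros n; rewrite rsum_sum_n; reflexivity.
Qed.

Lemma rsum_le_Series (a : nat -> R) n :
  (forall n, 0 <= a n) -> ex_series a -> rsum a n <= Series a.
Proof.
  intros Ha [l Hl]. rewrite (is_series_unique _ _ Hl).
  apply is_series_lim in Hl.
  apply (is_lim_seq_incr_compare _ _ Hl).
  intros k; simpl; specialize (Ha k); lra.
Qed.

Lemma Series_pos (a : nat -> R) : (forall n, 0 <= a n) -> ex_series a -> 0 <= Series a.
Proof. intros Ha H; apply (rsum_le_Series a 0 Ha H). Qed.

Lemma term_le_Series (a : nat -> R) n :
  (forall n, 0 <= a n) -> ex_series a -> a n <= Series a.
Proof.
  intros Ha H; eapply Rle_trans; [|apply (rsum_le_Series a (S n)); auto].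
  simpl. enough (0 <= rsum a n) by lra.
  clear - Ha; induction n as [|n IH]; simpl; [lra|specialize (Ha n); lra].
Qed.

Lemma Series_split (a : nat -> R) n :
  ex_series a -> Series a = rsum a n + Series (fun k => a (n + k)%nat).
Proof.
  intros H; induction n as [|n IH]; [simpl; rewrite Rplus_0_l; reflexivity|].
  rewrite IH; simpl; rewrite (Series_incr_1 (fun k => a (n + k)%nat)).
  - rewrite Nat.add_0_r.
    rewrite (Series_ext (fun k => a (n + S k)%nat) (fun k => a (S (n + k)))); [ring|].
    intros k; f_equal; lia.
  - apply (ex_series_incr_n a n); auto.
Qed.

Lemma Series_tail_small (a : nat -> R) :
  (forall n, 0 <= a n) -> ex_series a -> forall e, 0 < e ->
  exists N, Series (fun k => a (N + k)%nat) < e.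
Proof.
  intros Ha Hex e He. destruct Hex as [l Hl].
  assert (Hex : ex_series a) by (exists l; auto).
  assert (H := is_series_lim _ _ Hl).
  apply is_lim_seq_spec in H. destruct (H (mkposreal e He)) as [N HN].
  exists N. specialize (HN N (le_n N)); simpl in HN.
  assert (E := Series_split a N Hex).
  rewrite (is_series_unique _ _ Hl) in E.
  apply Rabs_def2 in HN; lra.
Qed.

Lemma ex_series_scal_R (c : R) (a : nat -> R) : ex_series a -> ex_series (fun n => c * a n).
Proof. exact (ex_series_scal (V := R_NormedModule) c a). Qed.

Lemma abssum_le (u : nat -> C) (v : nat -> R) :
  (forall n, Cmod (u n) <= v n) -> ex_series v -> abssum u.
Proof.
  intros H Hv; apply ex_series_le_R with v; auto.
  intros n; split; auto using Cmod_ge_0.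
Qed.

Lemma abssum_Re (u : nat -> C) : abssum u -> ex_series (fun n => Re (u n)).
Proof.
  intros H; apply (ex_series_le (V := R_CompleteNormedModule) (fun n => Re (u n)) (fun n => Cmod (u n))); auto.
  intros n; apply re_le_Cmod.
Qed.

Lemma abssum_Im (u : nat -> C) : abssum u -> ex_series (fun n => Im (u n)).
Proof.
  intros H; apply (ex_series_le (V := R_CompleteNormedModule) (fun n => Im (u n)) (fun n => Cmod (u n))); auto.
  intros n; apply im_le_Cmod.
Qed.

Lemma abssum_ext (u v : nat -> C) : (forall n, u n = v n) -> abssum u -> abssum v.
Proof. intros H; apply ex_series_ext; intros; rewrite H; auto. Qed.

Lemma Cser_ext (u v : nat -> C) : (forall n, u n = v n) -> Cser u = Cser v.
Proof. intros H; unfold Cser; f_equal; apply Series_ext; intros; rewrite H; auto. Qed.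

Lemma abssum_plus (u v : nat -> C) :
  abssum u -> abssum v -> abssum (fun n => u n + v n)%C.
Proof.
  intros Hu Hv; apply abssum_le with (fun n => Cmod (u n) + Cmod (v n)).
  - intros; apply Cmod_triangle.
  - exact (ex_series_plus _ _ Hu Hv).
Qed.

Lemma abssum_scal (c : C) (u : nat -> C) : abssum u -> abssum (fun n => c * u n)%C.
Proof.
  intros Hu; apply abssum_le with (fun n => Cmod c * Cmod (u n)).
  - intros; rewrite Cmod_mult; lra.
  - exact (ex_series_scal (Cmod c) _ Hu).
Qed.

Lemma abssum_minus (u v : nat -> C) :
  abssum u -> abssum v -> abssum (fun n => u n - v n)%C.
Proof.
  intros Hu Hv; apply abssum_le with (fun n => Cmod (u n) + Cmod (v n)).
  - intros; apply Cmod_triangle_sub.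
  - exact (ex_series_plus _ _ Hu Hv).
Qed.

Lemma abssum_shift (u : nat -> C) n : abssum u -> abssum (fun k => u (n + k)%nat).
Proof. intros H; exact (proj1 (ex_series_incr_n _ n) H). Qed.

Lemma abssum_RtoC (a : nat -> R) :
  (forall n, 0 <= a n) -> ex_series a -> abssum (fun n => RtoC (a n)).
Proof.
  intros Ha H; apply abssum_le with a; auto.
  intros; rewrite Cmod_R, Rabs_pos_eq; auto; lra.
Qed.

Lemma Cser_RtoC (a : nat -> R) : Cser (fun n => RtoC (a n)) = RtoC (Series a).
Proof.
  unfold Cser, RtoC; f_equal; simpl.
  rewrite (Series_ext (fun _ => 0) (fun _ => 0 * 0)) by (intros; ring).
  rewrite Series_scal_l; ring.
Qed.

Lemma Cser_plus (u v : nat -> C) :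
  abssum u -> abssum v -> Cser (fun n => u n + v n)%C = (Cser u + Cser v)%C.
Proof.
  intros Hu Hv; apply C_eq; simpl; apply Series_plus;
    auto using abssum_Re, abssum_Im.
Qed.

Lemma Cser_minus (u v : nat -> C) :
  abssum u -> abssum v -> Cser (fun n => u n - v n)%C = (Cser u - Cser v)%C.
Proof.
  intros Hu Hv; apply C_eq; simpl.
  - rewrite <- Series_opp, <- Series_plus; auto using abssum_Re.
    apply (ex_series_opp (fun n => Re (v n))); apply abssum_Re; auto.
  - rewrite <- Series_opp, <- Series_plus; auto using abssum_Im.
    apply (ex_series_opp (fun n => Im (v n))); apply abssum_Im; auto.
Qed.

Lemma Cser_scal (c : C) (u : nat -> C) :
  abssum u -> Cser (fun n => c * u n)%C = (c * Cser u)%C.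
Proof.
  intros Hu; assert (H1 := abssum_Re _ Hu); assert (H2 := abssum_Im _ Hu).
  apply C_eq; simpl.
  - rewrite Series_minus, !Series_scal_l; auto;
      apply ex_series_scal_R; auto.
  - rewrite Series_plus, !Series_scal_l; auto;
      apply ex_series_scal_R; auto.
Qed.

(** Componentwise bounds would lose a constant. Multiplying by the conjugate of the sum z makes
    |z|^2 the real series of Re (conj z u_n), whose terms are at most |z| |u_n|. *)
Lemma Cser_norm (u : nat -> C) :
  abssum u -> Cmod (Cser u) <= Series (fun n => Cmod (u n)).
Proof.
  intros Hu. set (z := Cser u).
  destruct (Req_dec (Cmod z) 0) as [E|E].
  { rewrite E; apply Series_pos; auto; intros; apply Cmod_ge_0. }
  assert (Hz : 0 < Cmod z) by (generalize (Cmod_ge_0 z); lra).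
  apply Rmult_le_reg_l with (Cmod z); auto.
  replace (Cmod z * Cmod z) with (Re (Cconj z * z)%C).
  2: { replace (Cmod z * Cmod z) with (Cmod z ^ 2) by ring.
       rewrite Cmod2_alt. simpl. ring. }
  unfold z at 2; rewrite <- Cser_scal by auto.
  rewrite <- Series_scal_l.
  eapply Rle_trans; [apply Rle_abs|].
  eapply Rle_trans; [apply (Series_Rabs (fun n => Re (Cconj z * u n)%C))|].
  - apply ex_series_le_R with (fun n => Cmod z * Cmod (u n)).
    + intros n; split; [apply Rabs_pos|].
      eapply Rle_trans; [apply re_le_Cmod|rewrite Cmod_mult, Cmod_conj; lra].
    + exact (ex_series_scal (Cmod z) _ Hu).
  - apply Series_le; [|exact (ex_series_scal (Cmod z) _ Hu)].
    intros n; split; [apply Rabs_pos|].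
    eapply Rle_trans; [apply re_le_Cmod|rewrite Cmod_mult, Cmod_conj; lra].
Qed.

Lemma Cser_split (u : nat -> C) n :
  abssum u -> Cser u = (csum u n + Cser (fun k => u (n + k)%nat))%C.
Proof.
  intros Hu; apply C_eq; simpl.
  - rewrite (Series_split _ n) by (apply abssum_Re; auto); f_equal.
    clear; induction n as [|n IH]; simpl; auto; rewrite IH; auto.
  - rewrite (Series_split _ n) by (apply abssum_Im; auto); f_equal.
    clear; induction n as [|n IH]; simpl; auto; rewrite IH; auto.
Qed.

Lemma Cser_S (u : nat -> C) :
  abssum u -> Cser u = (u O + Cser (fun k => u (S k)))%C.
Proof. intros Hu; rewrite (Cser_split u 1 Hu); simpl; ring. Qed.

Lemma Cser_finite_supp (u : nat -> C) n :
  (forall k, (n <= k)%nat -> u k = 0%C) -> abssum u /\ Cser u = csum u n.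
Proof.
  intros H. assert (Hs : abssum u).
  { apply (ex_series_incr_n _ n). apply ex_series_ext with (fun _ => 0).
    - intros k; rewrite H, Cmod_0 by lia; auto.
    - exists 0. apply is_series_Reals.
      intros e He; exists O; intros m _; unfold Rdist.
      replace (sum_f_R0 (fun _ => 0) m) with 0; [rewrite Rminus_0_r, Rabs_R0; auto|].
      symmetry; apply sum_eq_R0; auto. }
  split; auto. rewrite (Cser_split u n Hs).
  rewrite (Cser_ext _ (fun _ => RtoC (0 * 0)%R)) by (intros; rewrite H by lia; f_equal; ring).
  rewrite Cser_RtoC, Series_scal_l, Rmult_0_l; ring.
Qed.

(** One-sided: it expresses convergence to 0 for functions that are eventually non-negative, such as
    moduli, variances and inverses of means. *)
Definition small {T} (F : (T -> Prop) -> Prop) (g : T -> R) : Prop :=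
  forall e, 0 < e -> F (fun r => g r < e).

Definition Clim {T} (F : (T -> Prop) -> Prop) (f : T -> C) (l : C) : Prop :=
  small F (fun r => Cmod (f r - l)).

(** * Limits along a filter and Tannery's theorem *)

Section Limits.

Context {T : Type} (F : (T -> Prop) -> Prop) {FF : Filter F}.

Lemma small_le (f g : T -> R) : F (fun r => f r <= g r) -> small F g -> small F f.
Proof.
  intros H Hg e He; specialize (Hg e He).
  generalize (filter_and _ _ H Hg); apply filter_imp; intros r []; lra.
Qed.

Lemma small_plus (f g : T -> R) : small F f -> small F g -> small F (fun r => f r + g r).
Proof.
  intros Hf Hg e He.
  assert (H1 := Hf (e / 2) ltac:(lra)); assert (H2 := Hg (e / 2) ltac:(lra)).
  generalize (filter_and _ _ H1 H2); apply filter_imp; intros r []; lra.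
Qed.

Lemma small_scal (c : R) (f : T -> R) :
  0 <= c -> small F f -> small F (fun r => c * f r).
Proof.
  intros Hc Hf e He.
  assert (H1 := Hf (e / (c + 1)) ltac:(apply Rdiv_lt_0_compat; lra)).
  revert H1; apply filter_imp; intros r H.
  apply Rle_lt_trans with (c * (e / (c + 1))).
  - apply Rmult_le_compat_l; lra.
  - apply Rmult_lt_reg_r with (c + 1); [lra|]. field_simplify; [nra|lra].
Qed.

Lemma small_0 : small F (fun _ => 0).
Proof. intros e He; apply filter_forall; auto. Qed.

Lemma small_rsum (g : T -> nat -> R) n :
  (forall k, (k < n)%nat -> small F (fun r => g r k)) -> small F (fun r => rsum (g r) n).
Proof.
  induction n as [|n IH]; intros H; simpl; [apply small_0|].
  apply small_plus; auto.
Qed.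

Lemma Clim_ext (f g : T -> C) (l : C) : (forall r, f r = g r) -> Clim F f l -> Clim F g l.
Proof. intros E H e He; generalize (H e He); apply filter_imp; intros; rewrite <- E; auto. Qed.

Lemma Clim_ext_loc (f g : T -> C) (l : C) : F (fun r => f r = g r) -> Clim F f l -> Clim F g l.
Proof.
  intros E H e He; generalize (filter_and _ _ E (H e He)); apply filter_imp.
  intros r [H1 H2]; rewrite <- H1; auto.
Qed.

Lemma Clim_const l : Clim F (fun _ => l) l.
Proof.
  intros e He; apply filter_forall; intros; replace (l - l)%C with (RtoC 0) by ring.
  rewrite Cmod_0; auto.
Qed.

Lemma Clim_close (f g : T -> C) (l : C) :
  small F (fun r => Cmod (f r - g r)) -> Clim F g l -> Clim F f l.
Proof.
  intros H Hg; apply small_le with (2 := small_plus _ _ H Hg).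
  apply filter_forall; intros r.
  replace (f r - l)%C with ((f r - g r) + (g r - l))%C by ring; apply Cmod_triangle.
Qed.

Lemma Clim_plus (f g : T -> C) (l m : C) :
  Clim F f l -> Clim F g m -> Clim F (fun r => f r + g r)%C (l + m)%C.
Proof.
  intros Hf Hg; apply small_le with (2 := small_plus _ _ Hf Hg).
  apply filter_forall; intros r.
  replace (f r + g r - (l + m))%C with ((f r - l) + (g r - m))%C by ring.
  apply Cmod_triangle.
Qed.

Lemma Clim_bound (f : T -> C) (l : C) : Clim F f l -> F (fun r => Cmod (f r) <= Cmod l + 1).
Proof.
  intros H; generalize (H 1 ltac:(lra)); apply filter_imp; intros r Hr.
  generalize (Cmod_triangle_rev (f r) l); lra.
Qed.

Lemma Clim_mult (f g : T -> C) (l m : C) :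
  Clim F f l -> Clim F g m -> Clim F (fun r => f r * g r)%C (l * m)%C.
Proof.
  intros Hf Hg.
  apply small_le with (fun r => (Cmod l + 1) * Cmod (g r - m) + Cmod m * Cmod (f r - l)).
  - generalize (Clim_bound _ _ Hf); apply filter_imp; intros r Hr.
    replace (f r * g r - l * m)%C with (f r * (g r - m) + m * (f r - l))%C by ring.
    eapply Rle_trans; [apply Cmod_triangle|]. rewrite !Cmod_mult.
    generalize (Cmod_ge_0 (g r - m)); nra.
  - apply small_plus; apply small_scal; auto; generalize (Cmod_ge_0 l) (Cmod_ge_0 m); lra.
Qed.

Lemma Clim_scal (c : C) (f : T -> C) (l : C) : Clim F f l -> Clim F (fun r => c * f r)%C (c * l)%C.
Proof. intros H; apply Clim_mult; auto; apply Clim_const. Qed.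

Lemma Clim_away (f : T -> C) (l : C) :
  l <> 0%C -> Clim F f l -> F (fun r => Cmod l / 2 < Cmod (f r)).
Proof.
  intros Hl H. assert (Hp : 0 < Cmod l) by (apply (proj1 (Cmod_gt_0 l)); auto).
  generalize (H (Cmod l / 2) ltac:(lra)); apply filter_imp; intros r Hr.
  rewrite Cmod_sub_comm in Hr. generalize (Cmod_triangle_rev l (f r)); lra.
Qed.

Lemma Clim_inv (f : T -> C) (l : C) : l <> 0%C -> Clim F f l -> Clim F (fun r => / f r)%C (/ l)%C.
Proof.
  intros Hl H. assert (Hp : 0 < Cmod l) by (apply (proj1 (Cmod_gt_0 l)); auto).
  apply small_le with (fun r => 2 / (Cmod l * Cmod l) * Cmod (f r - l)).
  - generalize (Clim_away _ _ Hl H); apply filter_imp; intros r Hr.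
    assert (Hf : f r <> 0%C) by (apply (proj2 (Cmod_gt_0 (f r))); lra).
    replace (/ f r - / l)%C with (- (f r - l) * / (f r * l))%C by (field; auto).
    rewrite Cmod_mult, Cmod_opp, Cmod_inv, Cmod_mult by (apply Cmult_neq_0; auto).
    rewrite Rmult_comm. apply Rmult_le_compat_r; [apply Cmod_ge_0|].
    replace (2 / (Cmod l * Cmod l)) with (/ (Cmod l / 2 * Cmod l)) by (field; lra).
    apply Rinv_le_contravar; [nra|]. apply Rmult_le_compat_r; lra.
  - apply small_scal; auto. apply Rlt_le, Rdiv_lt_0_compat; nra.
Qed.

(** The tail of the majorant is made smaller than e/2 beyond some N; the N remaining terms are
    finitely many small functions. *)
Lemma tannery (g : T -> nat -> R) (M : nat -> R) :
  (forall k, 0 <= M k) -> ex_series M -> F (fun r => forall k, 0 <= g r k <= M k) ->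
  (forall k, small F (fun r => g r k)) -> small F (fun r => Series (g r)).
Proof.
  intros HM0 HM Hdom Hlim e He.
  destruct (Series_tail_small M HM0 HM (e / 2) ltac:(lra)) as [N HN].
  assert (H := small_rsum g N (fun k _ => Hlim k) (e / 2) ltac:(lra)).
  generalize (filter_and _ _ Hdom H); apply filter_imp; intros r [H1 H2].
  assert (Hex : ex_series (g r)) by (apply ex_series_le_R with M; auto).
  rewrite (Series_split (g r) N Hex).
  enough (Series (fun k => g r (N + k)%nat) <= Series (fun k => M (N + k)%nat)) by lra.
  apply Series_le; [intros; apply H1 | apply (ex_series_incr_n M N); auto].
Qed.

Lemma Clim_Cser (u : T -> nat -> C) (v : nat -> C) (M : nat -> R) :
  ex_series M -> F (fun r => forall k, Cmod (u r k) <= M k) ->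
  (forall k, Cmod (v k) <= M k) ->
  (forall k, Clim F (fun r => u r k) (v k)) ->
  Clim F (fun r => Cser (u r)) (Cser v).
Proof.
  intros HM Hu Hv Hlim.
  assert (HM0 : forall k, 0 <= M k) by (intros k; eapply Rle_trans; [apply Cmod_ge_0|auto]).
  assert (HM2 : ex_series (fun k => 2 * M k)) by exact (ex_series_scal 2 _ HM).
  assert (Hb : F (fun r => forall k, 0 <= Cmod (u r k - v k) <= 2 * M k)).
  { revert Hu; apply filter_imp; intros r Hr k; split; [apply Cmod_ge_0|].
    eapply Rle_trans; [apply Cmod_triangle_sub|]. specialize (Hr k); specialize (Hv k); lra. }
  apply small_le with (fun r => Series (fun k => Cmod (u r k - v k))).
  - revert Hu; apply filter_imp; intros r Hr.
    assert (Hs1 : abssum (u r)) by (apply abssum_le with M; auto).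
    assert (Hs2 : abssum v) by (apply abssum_le with M; auto).
    rewrite <- Cser_minus by auto. apply Cser_norm, abssum_minus; auto.
  - apply tannery with (fun k => 2 * M k); auto.
    + intros k; specialize (HM0 k); lra.
Qed.

End Limits.

Lemma Clim_unique {T} (F : (T -> Prop) -> Prop) {FF : ProperFilter F} (f : T -> C) (l m : C) :
  Clim F f l -> Clim F f m -> l = m.
Proof.
  intros Hl Hm. destruct (Ceq_dec l m) as [E|E]; auto. exfalso.
  assert (Hp : 0 < Cmod (l - m)).
  { apply (proj1 (Cmod_gt_0 (l - m))); intros H; apply E.
    replace l with (l - m + m)%C by ring; rewrite H; ring. }
  assert (H := filter_and (F := F) _ _ (Hl (Cmod (l - m) / 2) ltac:(lra)) (Hm (Cmod (l - m) / 2) ltac:(lra))).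
  apply filter_ex in H; destruct H as [r [H1 H2]].
  rewrite Cmod_sub_comm in H1.
  generalize (Cmod_triangle (l - f r) (f r - m)).
  replace (l - f r + (f r - m))%C with (l - m)%C by ring; lra.
Qed.

Lemma Clim_locally {T} (F : (T -> Prop) -> Prop) {FF : Filter F} (f : T -> C) (l : C) :
  Clim F f l <-> filterlim f F (locally l).
Proof.
  split; intros H.
  - apply (filterlim_locally (U := C_UniformSpace)); intros eps.
    generalize (H eps (cond_pos eps)); apply filter_imp; intros r Hr.
    apply C_NormedModule_mixin_compat1; exact Hr.
  - intros e He.
    assert (Hs : 0 < sqrt 2) by (apply sqrt_lt_R0; lra).
    (* Balls of [C_UniformSpace] are squares; the one of half-side e / sqrt 2 fits into the disc of
       radius e. *)
    assert (Hd : 0 < e / sqrt 2) by (apply Rdiv_lt_0_compat; auto).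
    apply (filterlim_locally (U := C_UniformSpace)) with (eps := mkposreal _ Hd) in H.
    revert H; apply filter_imp; intros r Hr.
    apply C_NormedModule_mixin_compat2 in Hr; simpl in Hr.
    replace (sqrt 2 * (e / sqrt 2)) with e in Hr by (field; lra). exact Hr.
Qed.

Lemma abssum_lim (u : nat -> C) : abssum u -> Clim eventually (csum u) (Cser u).
Proof.
  intros Hu e He.
  destruct (Series_tail_small (fun n => Cmod (u n))) with (e := e) as [N HN]; auto.
  { intros; apply Cmod_ge_0. }
  exists N; intros n Hn.
  rewrite Cmod_sub_comm, (Cser_split u n Hu).
  replace (csum u n + Cser (fun k => u (n + k)%nat) - csum u n)%C
    with (Cser (fun k => u (n + k)%nat)) by ring.
  eapply Rle_lt_trans; [apply Cser_norm, abssum_shift; auto|].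
  eapply Rle_lt_trans; [|exact HN].
  assert (HexN : ex_series (fun k => Cmod (u (N + k)%nat))) by exact (abssum_shift u N Hu).
  rewrite (Series_split (fun k => Cmod (u (N + k)%nat)) (n - N)) by auto.
  rewrite (Series_ext (fun k => Cmod (u (N + (n - N + k))%nat)) (fun k => Cmod (u (n + k)%nat))).
  2: intros; do 2 f_equal; lia.
  enough (0 <= rsum (fun k => Cmod (u (N + k)%nat)) (n - N)) by lra.
  clear; induction (n - N)%nat as [|m IH]; simpl; [lra|].
  generalize (Cmod_ge_0 (u (N + m)%nat)); lra.
Qed.

Lemma is_series_Cser (u : nat -> C) : abssum u -> is_series (V := C_NormedModule) u (Cser u).
Proof.
  intros Hu. apply abssum_lim in Hu.
  unfold is_series. apply (Clim_locally eventually).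
  intros e He. destruct (Hu e He) as [N HN]. exists N; intros n Hn.
  rewrite <- csum_sum_n. apply HN; lia.
Qed.

Lemma is_series_Clim (u : nat -> C) (l : C) :
  is_series (V := C_NormedModule) u l -> Clim eventually (csum u) l.
Proof.
  intros H. unfold is_series in H. apply (Clim_locally eventually) in H.
  intros e He. destruct (H e He) as [N HN]. exists (S N); intros n Hn.
  destruct n as [|n]; [lia|]. rewrite csum_sum_n. apply HN; lia.
Qed.

Lemma is_series_Cser_unique (u : nat -> C) (l : C) :
  abssum u -> is_series (V := C_NormedModule) u l -> l = Cser u.
Proof.
  intros Hu H. apply (Clim_unique eventually (csum u)); auto using abssum_lim, is_series_Clim.
Qed.

Lemma CSeries_Cser (u : nat -> C) : abssum u -> CSeries u = Cser u.
Proof.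
  intros Hu; unfold CSeries.
  apply (iota_unique (V := C_CompleteNormedModule)).
  - intros y Hy; apply is_series_Cser_unique; auto.
  - apply is_series_Cser; auto.
Qed.

Lemma CLim_Clim (u : nat -> C) (l : C) : Clim eventually u l -> CLim u = l.
Proof.
  intros Hu; unfold CLim.
  apply (iota_unique (V := C_CompleteNormedModule)).
  - intros y Hy. apply (Clim_unique eventually u); auto.
    apply (Clim_locally eventually); exact Hy.
  - apply (Clim_locally eventually); exact Hu.
Qed.

(** * Interchange of summations and Cauchy products *)

Section Fubini.

Variable u : nat -> nat -> C.
Hypothesis Hrow : forall i, abssum (u i).
Hypothesis Hall : ex_series (fun i => Series (fun j => Cmod (u i j))).

Lemma fubini_col j : abssum (fun i => u i j).
Proof.
  apply ex_series_le_R with (2 := Hall). intros i; split; [apply Cmod_ge_0|].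
  apply (term_le_Series (fun j => Cmod (u i j))); [intros; apply Cmod_ge_0 | apply Hrow].
Qed.

Let part J : rsum (fun j => Series (fun i => Cmod (u i j))) J
  <= Series (fun i => Series (fun j => Cmod (u i j))).
Proof.
  replace (rsum (fun j => Series (fun i => Cmod (u i j))) J)
    with (Series (fun i => rsum (fun j => Cmod (u i j)) J)).
  - apply Series_le; auto. intros i; split.
    + induction J as [|J IH]; simpl; [lra|]. generalize (Cmod_ge_0 (u i J)); lra.
    + apply rsum_le_Series; [intros; apply Cmod_ge_0 | apply Hrow].
  - induction J as [|J IH]; simpl.
    + rewrite (Series_ext _ (fun _ => 0 * 0)) by (intros; ring).
      rewrite Series_scal_l; ring.
    + rewrite <- IH. apply Series_plus; [|apply fubini_col].
      clear - Hrow Hall. induction J as [|J IH]; simpl.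
      * exists 0. apply is_series_Reals. intros e He; exists O; intros m _; unfold Rdist.
        replace (sum_f_R0 (fun _ => 0) m) with 0; [rewrite Rminus_0_r, Rabs_R0; auto|].
        symmetry; apply sum_eq_R0; auto.
      * exact (ex_series_plus _ _ IH (fubini_col J)).
Qed.

Lemma fubini_abs : ex_series (fun j => Series (fun i => Cmod (u i j))).
Proof.
  apply ex_series_bounded with (2 := part).
  intros j; apply Series_pos; [intros; apply Cmod_ge_0 | apply fubini_col].
Qed.

(** Both sides are limits of the same partial sums over i: the left one directly, the right one by
    dominated convergence in j, with the absolute column sums as majorant. *)
Lemma fubini : Cser (fun i => Cser (u i)) = Cser (fun j => Cser (fun i => u i j)).
Proof.
  assert (Ho : abssum (fun i => Cser (u i))).
  { apply abssum_le with (2 := Hall); intros; apply Cser_norm, Hrow. }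
  apply (Clim_unique eventually (csum (fun i => Cser (u i)))).
  - apply abssum_lim; auto.
  - apply (Clim_ext eventually) with (fun I => Cser (fun j => csum (fun i => u i j) I)).
    + assert (H : forall I, Cser (fun j => csum (fun i => u i j) I) = csum (fun i => Cser (u i)) I
         /\ abssum (fun j => csum (fun i => u i j) I)); [|intros I; apply H].
      intros I; induction I as [|I [IH1 IH2]]; simpl.
      * destruct (Cser_finite_supp (fun _ => 0%C) 0) as [H1 H2]; auto.
      * rewrite Cser_plus, IH1; auto. split; auto. apply abssum_plus; auto.
    + apply (Clim_Cser eventually) with (M := fun j => Series (fun i => Cmod (u i j))).
      * apply fubini_abs.
      * apply filter_forall; intros I j.
        eapply Rle_trans; [apply csum_norm|].
        apply (rsum_le_Series (fun i => Cmod (u i j))); [intros; apply Cmod_ge_0|apply fubini_col].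
      * intros j; apply Cser_norm, fubini_col.
      * intros j; apply abssum_lim, fubini_col.
Qed.

End Fubini.

(** Row i is moved i places to the right and padded with zeros; the columns of the new array are the
    finite antidiagonals, and [fubini] applies to it. *)
Lemma antidiag (u : nat -> nat -> C) :
  (forall i, abssum (u i)) -> ex_series (fun i => Series (fun j => Cmod (u i j))) ->
  abssum (fun n => csum (fun i => u i (n - i)%nat) (S n)) /\ Cser (fun i => Cser (u i)) = Cser (fun n => csum (fun i => u i (n - i)%nat) (S n)).
Proof.
  intros Hrow Hall.
  set (w := fun i n => if le_dec i n then u i (n - i)%nat else 0%C).
  assert (Hz : forall i k, (k < i)%nat -> w i k = 0%C).
  { intros i k Hk; unfold w; destruct le_dec; auto; lia. }
  assert (Hs : forall i k, w i (i + k)%nat = u i k).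
  { intros i k; unfold w; destruct le_dec; [f_equal|]; lia. }
  assert (Hw : forall i, abssum (w i)).
  { intros i. apply (ex_series_incr_n _ i).
    apply ex_series_ext with (2 := Hrow i); intros; rewrite Hs; auto. }
  assert (E : forall i, Series (fun j => Cmod (w i j)) = Series (fun j => Cmod (u i j))).
  { intros i; rewrite (Series_incr_n_aux _ i).
    - apply Series_ext; intros; rewrite Hs; auto.
    - intros; rewrite Hz, Cmod_0; auto. }
  assert (Hall' : ex_series (fun i => Series (fun j => Cmod (w i j)))).
  { apply ex_series_ext with (2 := Hall); auto. }
  assert (Hc : forall n, Cser (fun i => w i n) = csum (fun i => u i (n - i)%nat) (S n)).
  { intros n. rewrite (proj2 (Cser_finite_supp (fun i => w i n) (S n) (fun k Hk => Hz k n Hk))).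
    apply csum_ext; intros k Hk. unfold w; destruct le_dec; auto; lia. }
  split.
  - apply abssum_ext with (1 := Hc).
    apply abssum_le with (2 := fubini_abs w Hw Hall').
    intros; apply Cser_norm, fubini_col; auto.
  - rewrite <- (Cser_ext _ _ Hc), <- (fubini w Hw Hall').
    apply Cser_ext; intros i. rewrite (Cser_split (w i) i (Hw i)).
    rewrite (Cser_ext (fun k => w i (i + k)%nat) (u i)) by auto.
    replace (csum (w i) i) with (RtoC 0); [ring|].
    rewrite (csum_ext _ (fun _ => 0 * 0)%C).
    + rewrite csum_scal; ring.
    + intros; rewrite Hz by auto; ring.
Qed.

Lemma cauchy_product (u v : nat -> C) :
  abssum u -> abssum v ->
  abssum (fun n => csum (fun i => u i * v (n - i)%nat)%C (S n)) /\ (Cser u * Cser v)%C = Cser (fun n => csum (fun i => u i * v (n - i)%nat)%C (S n)).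
Proof.
  intros Hu Hv.
  destruct (antidiag (fun i j => u i * v j)%C) as [H1 H2].
  - intros i; apply abssum_scal; auto.
  - apply ex_series_ext with (fun i => Series (fun j => Cmod (v j)) * Cmod (u i)).
    + intros i. rewrite (Series_ext (fun j => Cmod (u i * v j)) (fun j => Cmod (u i) * Cmod (v j)))
        by (intros; apply Cmod_mult). rewrite Series_scal_l; apply Rmult_comm.
    + exact (ex_series_scal (Series (fun j => Cmod (v j))) _ Hu).
  - split; auto. rewrite <- H2.
    rewrite (Cser_ext (fun i => Cser (fun j => u i * v j)%C) (fun i => Cser v * u i)%C).
    + rewrite Cser_scal by auto; ring.
    + intros; rewrite Cser_scal by auto; ring.
Qed.

(** * Complex exponentials and powers *)

(** Induction on D, with r strictly between q and 1 and t = q / r. One factor k + 1 is absorbed by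
    t^k: t^k is the least of the first k + 1 terms of a convergent geometric series, so (k + 1) t^k
    is bounded by its sum. *)
Lemma ex_series_poly_geom (D : nat) (q : R) :
  0 <= q < 1 -> ex_series (fun k => (INR k + 1) ^ D * q ^ k).
Proof.
  revert q; induction D as [|D IH]; intros q Hq.
  - apply ex_series_ext with (fun k => q ^ k); [intros; simpl; ring|].
    apply ex_series_geom; rewrite Rabs_pos_eq; lra.
  - set (r := (1 + q) / 2). set (t := q / r).
    assert (Hr : 0 < r < 1) by (unfold r; lra).
    assert (Ht : 0 <= t < 1).
    { unfold t; split; [apply Rdiv_le_0_compat; lra|].
      apply Rmult_lt_reg_r with r; [lra|]. unfold Rdiv; rewrite Rmult_assoc, Rinv_l; unfold r; lra. }
    assert (Hg : ex_series (fun k => t ^ k)) by (apply ex_series_geom; rewrite Rabs_pos_eq; lra).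
    assert (Hlin : forall k, (INR k + 1) * t ^ k <= Series (fun k => t ^ k)).
    { intros k. eapply Rle_trans; [|apply (rsum_le_Series _ (S k)); auto].
      - apply Rle_trans with (rsum (fun _ => t ^ k) (S k)); [rewrite rsum_const, S_INR; lra|].
        apply rsum_le; intros j Hj. replace k with (j + (k - j))%nat at 1 by lia.
        rewrite pow_add. rewrite <- (Rmult_1_r (t ^ j)) at 2.
        apply Rmult_le_compat_l; [apply pow_le; lra|].
        rewrite <- (pow1 (k - j)); apply pow_incr; lra.
      - intros; apply pow_le; lra. }
    apply ex_series_le_R with (fun k => Series (fun k => t ^ k) * ((INR k + 1) ^ D * r ^ k)).
    + intros k; split.
      * apply Rmult_le_pos; apply pow_le; [generalize (pos_INR k)|]; lra.
      * replace q with (t * r) by (unfold t; field; lra).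
        rewrite Rpow_mult_distr; simpl.
        replace ((INR k + 1) * (INR k + 1) ^ D * (t ^ k * r ^ k))
          with (((INR k + 1) * t ^ k) * ((INR k + 1) ^ D * r ^ k)) by ring.
        apply Rmult_le_compat_r; auto.
        apply Rmult_le_pos; apply pow_le; [generalize (pos_INR k)|]; lra.
    + apply ex_series_scal_R, IH; lra.
Qed.

Lemma poly_le_pow2 (D : nat) : exists M, 0 <= M /\ forall k, (INR k + 1) ^ D <= M * 2 ^ k.
Proof.
  assert (H : ex_series (fun k => (INR k + 1) ^ D * (/ 2) ^ k)) by (apply ex_series_poly_geom; lra).
  assert (Hp : forall k, 0 <= (INR k + 1) ^ D * (/ 2) ^ k).
  { intros k; apply Rmult_le_pos; apply pow_le; [generalize (pos_INR k)|]; lra. }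
  exists (Series (fun k => (INR k + 1) ^ D * (/ 2) ^ k)); split; [apply Series_pos; auto|].
  intros k; assert (E := term_le_Series _ k Hp H); simpl in E.
  rewrite pow_inv in E. assert (0 < 2 ^ k) by (apply pow_lt; lra).
  apply Rmult_le_compat_r with (r := 2 ^ k) in E; [|lra].
  rewrite Rmult_assoc, Rinv_l, Rmult_1_r in E; lra.
Qed.

Lemma is_series_exp (x : R) : is_series (fun k => x ^ k / INR (fact k)) (exp x).
Proof.
  assert (H := is_exp_Reals x). apply is_pseries_R in H.
  revert H; apply is_series_ext; intros n; apply Rmult_comm.
Qed.

Lemma ex_series_poly_exp (D : nat) (x : R) :
  0 <= x -> ex_series (fun k => (INR k + 1) ^ D * (x ^ k / INR (fact k))).
Proof.
  intros Hx; destruct (poly_le_pow2 D) as [M [HM H]].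
  apply ex_series_le_R with (fun k => M * ((2 * x) ^ k / INR (fact k))).
  - intros k; assert (Hf := INR_fact_lt_0 k).
    assert (0 <= x ^ k / INR (fact k)) by (apply Rdiv_le_0_compat; auto; apply pow_le; auto).
    split.
    + apply Rmult_le_pos; auto; apply pow_le; generalize (pos_INR k); lra.
    + rewrite Rpow_mult_distr.
      replace (M * (2 ^ k * x ^ k / INR (fact k))) with ((M * 2 ^ k) * (x ^ k / INR (fact k)))
        by (field; lra).
      apply Rmult_le_compat_r; auto.
  - apply ex_series_scal_R; eexists; apply is_series_exp.
Qed.

Lemma Cexp_add (u v : C) : Cexp (u + v) = (Cexp u * Cexp v)%C.
Proof.
  apply C_eq; simpl; rewrite exp_plus; [rewrite cos_plus | rewrite sin_plus]; unfold Re, Im; simpl; ring.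
Qed.

Lemma Cexp_RtoC (x : R) : Cexp x = RtoC (exp x).
Proof. apply C_eq; simpl; rewrite ?cos_0, ?sin_0; ring. Qed.

Lemma Cexp_0 : Cexp 0 = RtoC 1.
Proof. rewrite Cexp_RtoC, exp_0; auto. Qed.

Lemma Cmod_Cexp (z : C) : Cmod (Cexp z) = exp (Re z).
Proof.
  unfold Cmod, Cexp; simpl.
  replace (_ + _) with (exp (Re z) ^ 2 * ((sin (Im z))² + (cos (Im z))²)) by (unfold Rsqr; ring).
  rewrite sin2_cos2, Rmult_1_r, sqrt_pow2; auto; left; apply exp_pos.
Qed.

Lemma Cexp_neq_0 (z : C) : Cexp z <> RtoC 0.
Proof. apply Cmod_gt_0; rewrite Cmod_Cexp; apply exp_pos. Qed.

Lemma Cexp_opp (z : C) : Cexp (- z) = (/ Cexp z)%C.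
Proof.
  assert (H := Cexp_neq_0 z).
  replace (/ Cexp z)%C with (Cexp (- z + z) / Cexp z)%C.
  - rewrite Cexp_add; field; auto.
  - replace (- z + z)%C with (RtoC 0) by ring; rewrite Cexp_0; field; auto.
Qed.

(** Only derivatives along a real parameter are taken: power series are identified on the segment
    from 0 to the point h, without complex differentiation. *)
Definition Cderiv (f : R -> C) (t : R) (l : C) : Prop :=
  is_derive (fun t => Re (f t)) t (Re l) /\ is_derive (fun t => Im (f t)) t (Im l).

Lemma Cderiv_eq (f : R -> C) t l m : l = m -> Cderiv f t l -> Cderiv f t m.
Proof. intros ->; auto. Qed.

Lemma Cderiv_mult (f g : R -> C) t l m :
  Cderiv f t l -> Cderiv g t m -> Cderiv (fun t => f t * g t)%C t (l * g t + f t * m)%C.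
Proof.
  assert (A : forall (a b c d : R -> R) t a' b' c' d',
    is_derive a t a' -> is_derive b t b' -> is_derive c t c' -> is_derive d t d' ->
    is_derive (fun t => a t * b t - c t * d t) t (a' * b t + a t * b' - (c' * d t + c t * d')) /\
    is_derive (fun t => a t * d t + c t * b t) t (a' * d t + a t * d' + (c' * b t + c t * b'))).
  { intros a b c d x a' b' c' d' Ha Hb Hc Hd.
    split; auto_derive; try (repeat split; eexists; eassumption);
    rewrite (is_derive_unique (fun y : R => a y) _ _ Ha), (is_derive_unique (fun y : R => b y) _ _ Hb),
      (is_derive_unique (fun y : R => c y) _ _ Hc), (is_derive_unique (fun y : R => d y) _ _ Hd); ring. }
  intros [F1 F2] [G1 G2].
  destruct (A _ _ _ _ _ _ _ _ _ F1 G1 F2 G2) as [H1 H2]; split.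
  - eapply is_derive_ext; [|replace (Re _) with (Re l * Re (g t) + Re (f t) * Re m - (Im l * Im (g t) + Im (f t) * Im m)); [exact H1|]].
    + reflexivity.
    + simpl; unfold Re, Im; ring.
  - eapply is_derive_ext; [|replace (Im _) with (Re l * Im (g t) + Re (f t) * Im m + (Im l * Re (g t) + Im (f t) * Re m)); [exact H2|]].
    + reflexivity.
    + simpl; unfold Re, Im; ring.
Qed.

Lemma Cderiv_const (c : C) t : Cderiv (fun _ => c) t 0.
Proof. split; apply (is_derive_const (K := R_AbsRing) (V := R_NormedModule)). Qed.

Lemma Cderiv_scal (c : C) (f : R -> C) t l :
  Cderiv f t l -> Cderiv (fun t => c * f t)%C t (c * l)%C.
Proof.
  intros H; eapply Cderiv_eq; [|apply Cderiv_mult; [apply Cderiv_const|exact H]]; cbv beta; ring.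
Qed.

Lemma Cderiv_Cexp (f : R -> C) t l :
  Cderiv f t l -> Cderiv (fun t => Cexp (f t)) t (l * Cexp (f t))%C.
Proof.
  assert (A : forall (a b : R -> R) t a' b', is_derive a t a' -> is_derive b t b' ->
    is_derive (fun t => exp (a t) * cos (b t)) t
      (a' * (exp (a t) * cos (b t)) - b' * (exp (a t) * sin (b t))) /\
    is_derive (fun t => exp (a t) * sin (b t)) t
      (a' * (exp (a t) * sin (b t)) + b' * (exp (a t) * cos (b t)))).
  { intros a b x a' b' Ha Hb.
    split; auto_derive; try (repeat split; eexists; eassumption);
    rewrite (is_derive_unique (fun y : R => a y) _ _ Ha), (is_derive_unique (fun y : R => b y) _ _ Hb); ring. }
  intros [F1 F2]. destruct (A _ _ _ _ _ F1 F2) as [H1 H2]; split; assumption.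
Qed.

Lemma Cderiv_zero_const (f : R -> C) :
  (forall t, 0 <= t <= 1 -> Cderiv f t 0) -> f 1 = f 0.
Proof.
  intros H; apply C_eq.
  - symmetry; apply (eq_is_derive (V := R_NormedModule) (fun t => Re (f t)) 0 1); [|lra]. intros; apply H; auto.
  - symmetry; apply (eq_is_derive (V := R_NormedModule) (fun t => Im (f t)) 0 1); [|lra]. intros; apply H; auto.
Qed.

Lemma CV_radius_gt (a : nat -> R) (r M x : R) :
  (forall n, Rabs (a n * r ^ n) <= M) -> Rabs x < r -> Rbar_lt (Rabs x) (CV_radius a).
Proof.
  intros H Hx. apply Rbar_lt_le_trans with r; auto.
  apply (CV_radius_bounded a). exists M; auto.
Qed.

Lemma Cderiv_series (v : nat -> C) (r t : R) :
  0 < r -> abssum (fun n => v n * RtoC (r ^ n))%C -> Rabs t < r ->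
  Cderiv (fun t => Cser (fun n => v n * RtoC (t ^ n))%C) t
    (Cser (fun n => RtoC (INR (S n)) * v (S n) * RtoC (t ^ n))%C).
Proof.
  intros Hr Hs Ht.
  assert (Hb : forall n, Cmod (v n * RtoC (r ^ n)) <= Series (fun n => Cmod (v n * RtoC (r ^ n)))).
  { intros n; apply (term_le_Series (fun n => Cmod (v n * RtoC (r ^ n)))); auto.
    intros; apply Cmod_ge_0. }
  split; simpl.
  - apply is_derive_ext with (PSeries (fun n => Re (v n))).
    + intros u; apply Series_ext; intros; simpl; unfold Re; ring.
    + replace (Series _) with (PSeries (PS_derive (fun n => Re (v n))) t).
      * apply is_derive_PSeries. eapply CV_radius_gt; eauto.
        intros n. eapply Rle_trans; [|apply Hb].
        replace (Re (v n) * r ^ n) with (Re (v n * RtoC (r ^ n))%C) by (simpl; unfold Re; ring).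
        apply re_le_Cmod.
      * apply Series_ext; intros; unfold PS_derive, Re; simpl. ring.
  - apply is_derive_ext with (PSeries (fun n => Im (v n))).
    + intros u; apply Series_ext; intros; simpl; unfold Im; ring.
    + replace (Series _) with (PSeries (PS_derive (fun n => Im (v n))) t).
      * apply is_derive_PSeries. eapply CV_radius_gt; eauto.
        intros n. eapply Rle_trans; [|apply Hb].
        replace (Im (v n) * r ^ n) with (Im (v n * RtoC (r ^ n))%C) by (simpl; unfold Im; ring).
        apply im_le_Cmod.
      * apply Series_ext; intros; unfold PS_derive, Im; simpl. ring.
Qed.

Lemma Cser_0 (u : nat -> C) : (forall n, u (S n) = RtoC 0) -> Cser u = u O.
Proof.
  intros H. destruct (Cser_finite_supp u 1) as [_ E].
  - intros [|k] Hk; [lia|auto].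
  - rewrite E; simpl; ring.
Qed.

(** The hypotheses say V' = s L' V, so V(t) exp (- s L(t)) has derivative zero on [0, 1].
    Summability at some r > 1 makes V differentiable up to t = 1. The exponential series is the case
    L(t) = t, the binomial series the case L(t) = [Clog] (1 - t h). *)
Lemma series_ode (v : nat -> C) (r : R) (s : C) (L dL : R -> C) :
  1 < r -> abssum (fun n => v n * RtoC (r ^ n))%C ->
  (forall t, 0 <= t <= 1 -> Cderiv L t (dL t)) ->
  (forall t, 0 <= t <= 1 -> Cser (fun n => RtoC (INR (S n)) * v (S n) * RtoC (t ^ n))%C
     = (s * dL t * Cser (fun n => v n * RtoC (t ^ n)))%C) ->
  Cser v = (v O * Cexp (s * (L 1 - L 0)))%C.
Proof.
  intros Hr Hs HL HV.
  set (V := fun t : R => Cser (fun n => v n * RtoC (t ^ n))%C).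
  assert (V1 : V 1 = Cser v).
  { apply Cser_ext; intros; rewrite pow1; ring. }
  assert (V0 : V 0 = v O).
  { unfold V; rewrite Cser_0; [simpl; ring|]. intros; rewrite pow_i by lia; ring. }
  assert (H : (V 1 * Cexp (- s * L 1) = V 0 * Cexp (- s * L 0))%C).
  { apply (Cderiv_zero_const (fun t => V t * Cexp (- s * L t))%C).
    intros t Ht. eapply Cderiv_eq.
    2: { apply Cderiv_mult.
         - apply Cderiv_series with r; [lra|auto|]. rewrite Rabs_pos_eq; lra.
         - apply Cderiv_Cexp, Cderiv_scal, HL; auto. }
    cbv beta. rewrite HV by auto. fold (V t). ring. }
  rewrite <- V1, <- V0.
  replace (s * (L 1 - L 0))%C with (- s * L 0 + - (- s * L 1))%C by ring.
  rewrite Cexp_add, Cexp_opp, Cmult_assoc, <- H. field. apply Cexp_neq_0.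
Qed.

Lemma RtoC_neq_0 (x : R) : x <> 0 -> RtoC x <> RtoC 0.
Proof. intros H E; apply H, RtoC_inj, E. Qed.

Lemma abssum_exp (z : C) : abssum (fun n => z ^ n / RtoC (INR (fact n)))%C.
Proof.
  apply abssum_le with (fun n => Cmod z ^ n / INR (fact n)).
  - intros n; rewrite Cmod_div, Cmod_pow, Cmod_R, Rabs_pos_eq; [lra|left; apply INR_fact_lt_0|].
    apply RtoC_neq_0, INR_fact_neq_0.
  - eexists; apply is_series_exp.
Qed.

Lemma Cexp_series (z : C) : Cexp z = Cser (fun n => z ^ n / RtoC (INR (fact n)))%C.
Proof.
  assert (Hf : forall n, RtoC (INR (fact n)) <> RtoC 0)
    by (intros; apply RtoC_neq_0, INR_fact_neq_0).
  rewrite (series_ode _ 2 z (fun t => RtoC t) (fun _ => RtoC 1)); [|lra| | |].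
  - simpl. replace (z * (RtoC 1 - RtoC 0))%C with z by ring. field.
  - apply abssum_ext with (2 := abssum_exp (2 * z)%C).
    intros n; rewrite Cpow_mult_l, RtoC_pow; unfold Cdiv; ring.
  - intros t _; split; simpl; auto_derive; auto; ring.
  - intros t Ht. rewrite Cmult_1_r, <- Cser_scal.
    + apply Cser_ext; intros n.
      rewrite Cpow_S, fact_simpl, mult_INR, RtoC_mult.
      field; split; auto. apply RtoC_neq_0, not_0_INR; lia.
    + apply abssum_ext with (2 := abssum_exp (t * z)%C).
      intros n; rewrite Cpow_mult_l, RtoC_pow; unfold Cdiv; ring.
Qed.

Lemma Cexp_bound2 (z : C) : Cmod (Cexp z - 1 - z) <= Cmod z ^ 2 * exp (Cmod z).
Proof.
  rewrite Cexp_series, (Cser_split _ 2 (abssum_exp z)); simpl csum.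
  replace (_ - 1 - z)%C with (Cser (fun k => z ^ (2 + k) / RtoC (INR (fact (2 + k))))%C)
    by (simpl; field; apply RtoC_neq_0; lra).
  assert (Ht := abssum_shift _ 2 (abssum_exp z)).
  eapply Rle_trans; [apply Cser_norm; exact Ht|].
  rewrite <- (is_series_unique _ _ (is_series_exp (Cmod z))), <- Series_scal_l.
  apply Series_le; [|apply ex_series_scal_R; eexists; apply is_series_exp].
  intros n; split; [apply Cmod_ge_0|].
  rewrite Cmod_div, Cmod_pow, Cmod_R, Rabs_pos_eq; [|left; apply INR_fact_lt_0|apply RtoC_neq_0, INR_fact_neq_0].
  rewrite pow_add; unfold Rdiv; rewrite Rmult_assoc.
  apply Rmult_le_compat_l; [apply pow_le, Cmod_ge_0|].
  apply Rmult_le_compat_l; [apply pow_le, Cmod_ge_0|].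
  apply Rinv_le_contravar; [apply INR_fact_lt_0|]. apply le_INR, fact_le; lia.
Qed.

Lemma Cexp_bound1 (z : C) : Cmod (Cexp z - 1) <= Cmod z * exp (Cmod z).
Proof.
  rewrite Cexp_series, (Cser_split _ 1 (abssum_exp z)); simpl csum.
  replace (_ - 1)%C with (Cser (fun k => z ^ (1 + k) / RtoC (INR (fact (1 + k))))%C)
    by (simpl; field; apply RtoC_neq_0; lra).
  assert (Ht := abssum_shift _ 1 (abssum_exp z)).
  eapply Rle_trans; [apply Cser_norm; exact Ht|].
  rewrite <- (is_series_unique _ _ (is_series_exp (Cmod z))), <- Series_scal_l.
  apply Series_le; [|apply ex_series_scal_R; eexists; apply is_series_exp].
  intros n; split; [apply Cmod_ge_0|].
  rewrite Cmod_div, Cmod_pow, Cmod_R, Rabs_pos_eq; [|left; apply INR_fact_lt_0|apply RtoC_neq_0, INR_fact_neq_0].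
  rewrite pow_add, pow_1; unfold Rdiv; rewrite Rmult_assoc.
  apply Rmult_le_compat_l; [apply Cmod_ge_0|].
  apply Rmult_le_compat_l; [apply pow_le, Cmod_ge_0|].
  apply Rinv_le_contravar; [apply INR_fact_lt_0|]. apply le_INR, fact_le; lia.
Qed.

(** * Principal argument, logarithm and powers *)

Lemma Cmod_ratio (z : C) : z <> RtoC 0 -> -1 <= Re z / Cmod z <= 1.
Proof.
  intros Hz; apply Cmod_gt_0 in Hz; assert (H := re_le_Cmod z).
  apply Rabs_le_between in H.
  split; apply Rmult_le_reg_r with (Cmod z); auto; unfold Rdiv; rewrite Rmult_assoc, Rinv_l; lra.
Qed.

Lemma Carg_abs (z : C) : Rabs (Carg z) = acos (Re z / Cmod z).
Proof.
  unfold Carg; assert (H := proj1 (acos_bound (Re z / Cmod z))).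
  destruct Rle_dec; [|rewrite Rabs_Ropp]; apply Rabs_pos_eq; auto.
Qed.

Lemma polar (z : C) : z <> RtoC 0 -> z = (Cmod z * cos (Carg z), Cmod z * sin (Carg z)).
Proof.
  intros Hz; assert (Hr := Cmod_ratio z Hz); assert (Hp := proj1 (Cmod_gt_0 z) Hz).
  assert (Hc : cos (Carg z) = Re z / Cmod z).
  { unfold Carg; destruct Rle_dec; rewrite ?cos_neg; apply cos_acos; auto. }
  assert (Hs : Cmod z * sqrt (1 - (Re z / Cmod z)²) = Rabs (Im z)).
  { rewrite <- (sqrt_pow2 (Cmod z)) at 1 by lra. rewrite <- sqrt_mult_alt by nra.
    replace (Cmod z ^ 2 * (1 - (Re z / Cmod z)²)) with (Cmod z ^ 2 - Re z ^ 2)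
      by (unfold Rsqr; field; lra).
    rewrite Cmod2_alt. replace (_ - _) with (Im z ^ 2) by ring.
    rewrite <- sqrt_Rsqr_abs; f_equal; unfold Rsqr; ring. }
  apply C_eq; simpl; [rewrite Hc; field; lra|].
  unfold Carg; destruct Rle_dec as [H|H].
  - rewrite sin_acos, Hs, Rabs_pos_eq; auto.
  - rewrite sin_neg, sin_acos, Ropp_mult_distr_r_reverse, Hs, Rabs_left by (auto; lra); ring.
Qed.

Lemma Cmod_polar (r theta : R) : 0 <= r -> Cmod (r * cos theta, r * sin theta) = r.
Proof.
  intros Hr; unfold Cmod; simpl.
  replace (_ + _) with (r ^ 2 * ((sin theta)² + (cos theta)²)) by (unfold Rsqr; ring).
  rewrite sin2_cos2, Rmult_1_r, sqrt_pow2; auto.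
Qed.

Lemma Carg_polar (r theta : R) :
  0 < r -> - PI < theta < PI -> Carg (r * cos theta, r * sin theta) = theta.
Proof.
  intros Hr Ht; unfold Carg; rewrite Cmod_polar by lra; simpl.
  replace (r * cos theta / r) with (cos theta) by (field; lra).
  destruct Rle_dec as [H|H]; destruct (Rle_lt_dec 0 theta) as [H'|H'].
  - apply acos_cos; lra.
  - assert (0 < sin (- theta)) by (apply sin_gt_0; lra). rewrite sin_neg in *; nra.
  - exfalso; apply H; apply Rmult_le_pos; [lra|apply sin_ge_0; lra].
  - rewrite <- cos_neg, acos_cos; lra.
Qed.

Lemma Carg_pos (x : R) : 0 < x -> Carg x = 0.
Proof.
  intros H; generalize (Carg_polar x 0 H).
  rewrite cos_0, sin_0, Rmult_1_r, Rmult_0_r; intros E; apply E.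
  generalize PI_RGT_0; lra.
Qed.

Lemma Clog_pos (x : R) : 0 < x -> Clog x = RtoC (ln x).
Proof.
  intros H; unfold Clog; rewrite Carg_pos, Cmod_R, Rabs_pos_eq by lra; auto.
Qed.

(** The bound on the arguments keeps their sum strictly inside (-PI, PI), where it is again the
    principal value. *)
Lemma Clog_mult (u v : C) :
  u <> RtoC 0 -> v <> RtoC 0 -> Rabs (Carg u) + Rabs (Carg v) < PI ->
  Clog (u * v) = (Clog u + Clog v)%C.
Proof.
  intros Hu Hv H.
  assert (Pu := proj1 (Cmod_gt_0 u) Hu); assert (Pv := proj1 (Cmod_gt_0 v) Hv).
  assert (Hb : - PI < Carg u + Carg v < PI)
    by (apply Rabs_lt_between; eapply Rle_lt_trans; [apply Rabs_triang|exact H]).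
  apply C_eq; simpl.
  - rewrite Cmod_mult, ln_mult; auto.
  - rewrite <- (Carg_polar (Cmod u * Cmod v) (Carg u + Carg v)); auto; [|nra].
    f_equal. rewrite (polar u Hu) at 1; rewrite (polar v Hv) at 1.
    apply C_eq; simpl; rewrite ?cos_plus, ?sin_plus; ring.
Qed.

Lemma Cpower_add (z s t : C) : Cpower z (s + t) = (Cpower z s * Cpower z t)%C.
Proof. unfold Cpower; rewrite <- Cexp_add; f_equal; ring. Qed.

Lemma Cpower_opp (z s : C) : Cpower z (- s) = (/ Cpower z s)%C.
Proof. unfold Cpower; rewrite <- Cexp_opp; f_equal; ring. Qed.

Lemma Cpower_neq_0 (z s : C) : Cpower z s <> RtoC 0.
Proof. apply Cexp_neq_0. Qed.

Lemma Cpower_mult (u v s : C) :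
  u <> RtoC 0 -> v <> RtoC 0 -> Rabs (Carg u) + Rabs (Carg v) < PI ->
  Cpower (u * v) s = (Cpower u s * Cpower v s)%C.
Proof.
  intros Hu Hv H; unfold Cpower; rewrite Clog_mult, <- Cexp_add by auto; f_equal; ring.
Qed.

Lemma Cpower_pos (x : R) (s : C) : 0 < x -> Cpower x s = Cexp (s * RtoC (ln x)).
Proof. intros H; unfold Cpower; rewrite Clog_pos; auto. Qed.

Lemma Cpower_mult_pos (x y : R) (s : C) :
  0 < x -> 0 < y -> Cpower (RtoC (x * y)) s = (Cpower x s * Cpower y s)%C.
Proof.
  intros Hx Hy. rewrite !Cpower_pos, <- Cexp_add, ln_mult, RtoC_plus by nra. f_equal; ring.
Qed.

Lemma Cpower_inv_pos (x : R) (s : C) : 0 < x -> Cpower (RtoC (/ x)) s = (/ Cpower x s)%C.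
Proof.
  intros Hx. rewrite !Cpower_pos, <- Cexp_opp, ln_Rinv, RtoC_opp by auto using Rinv_0_lt_compat.
  f_equal; ring.
Qed.

Lemma Cmod_Cpower_pos (x : R) (s : C) : 0 < x -> Cmod (Cpower x s) = Rpower x (Re s).
Proof.
  intros Hx; rewrite Cpower_pos, Cmod_Cexp by auto; unfold Rpower; f_equal; simpl; unfold Re; ring.
Qed.

Lemma Cpower_1_pos (x : R) : 0 < x -> Cpower x 1 = RtoC x.
Proof. intros Hx; rewrite Cpower_pos, Cmult_1_l, Cexp_RtoC, exp_ln; auto. Qed.

Lemma Cpower_INR (x : R) (n : nat) : 0 < x -> Cpower x (RtoC (INR n)) = RtoC (x ^ n).
Proof.
  intros Hx; rewrite Cpower_pos, <- RtoC_mult, Cexp_RtoC by auto.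
  rewrite <- Rpower_pow by auto; auto.
Qed.

(** * Pochhammer symbols and the binomial series *)

Lemma INR1_pos n : 0 < INR n + 1.
Proof. generalize (pos_INR n); lra. Qed.

Lemma INR1_ge1 n : 1 <= INR n + 1.
Proof. generalize (pos_INR n); lra. Qed.

Lemma RtoC_fact_neq_0 n : RtoC (INR (fact n)) <> RtoC 0.
Proof. apply RtoC_neq_0, INR_fact_neq_0. Qed.

Lemma abssum_poly_geom (u : nat -> C) (M q : R) (D : nat) :
  0 <= q < 1 -> (forall n, Cmod (u n) <= M * ((INR n + 1) ^ D * q ^ n)) -> abssum u.
Proof.
  intros Hq H; apply abssum_le with (1 := H).
  apply ex_series_scal_R, ex_series_poly_geom; auto.
Qed.

Lemma poch_S_l (a : C) n : poch a (S n) = (a * poch (a + 1) n)%C.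
Proof.
  induction n as [|n IH]; [simpl; ring|].
  change (poch a (S (S n))) with (poch a (S n) * (a + RtoC (INR (S n))))%C.
  rewrite IH, S_INR, RtoC_plus; simpl; ring.
Qed.

Lemma poch_add (a : C) m n : poch a (m + n) = (poch a m * poch (a + RtoC (INR m)) n)%C.
Proof.
  induction n as [|n IH]; [rewrite Nat.add_0_r; simpl; ring|].
  rewrite Nat.add_succ_r; simpl poch; rewrite IH, plus_INR, RtoC_plus; ring.
Qed.

Lemma poch_neq_0 (z : C) n : ~ nonpos_int z -> poch z n <> RtoC 0.
Proof.
  intros Hz; induction n as [|n IH]; simpl.
  - apply RtoC_neq_0; lra.
  - apply Cmult_neq_0; auto. intros E; apply Hz; exists n.
    rewrite RtoC_opp; replace z with (z + RtoC (INR n) - RtoC (INR n))%C by ring.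
    rewrite E; ring.
Qed.

Lemma Re_pos_not_nonpos (z : C) : 0 < Re z -> ~ nonpos_int z.
Proof. intros H [k E]; rewrite E in H; simpl in H; generalize (pos_INR k); lra. Qed.

Lemma poch_poly_bound (a : C) :
  exists D, forall n, Cmod (poch a n) <= INR (fact n) * (INR n + 1) ^ D.
Proof.
  destruct (INR_unbounded (Cmod a)) as [D HD]. exists D.
  induction n as [|n IH].
  - simpl; rewrite Cmod_1, Rplus_0_l, pow1; lra.
  - simpl poch; rewrite Cmod_mult, fact_simpl, mult_INR, S_INR.
    assert (H1 : Cmod (a + RtoC (INR n)) <= INR D + INR n).
    { eapply Rle_trans; [apply Cmod_triangle|].
      rewrite Cmod_R, Rabs_pos_eq by apply pos_INR; lra. }
    assert (Hn := INR1_pos n). assert (Hf := INR_fact_lt_0 n).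
    assert (H2 : (INR n + 1 + INR D) * (INR n + 1) ^ D <= (INR n + 1) * (INR n + 1 + 1) ^ D).
    { replace (INR n + 1 + 1) with ((INR n + 1) * (1 + / (INR n + 1))) by (field; lra).
      rewrite Rpow_mult_distr.
      replace ((INR n + 1 + INR D) * (INR n + 1) ^ D)
        with ((INR n + 1) * ((INR n + 1) ^ D * (1 + INR D * / (INR n + 1)))) by (field; lra).
      repeat (apply Rmult_le_compat_l; [left; try apply pow_lt; auto|]).
      (* [poly] is Bernoulli's inequality, here 1 + D / (n + 1) <= (1 + 1 / (n + 1))^D. *)
      apply poly, Rinv_0_lt_compat; auto. }
    apply Rle_trans with (INR (fact n) * (INR n + 1) ^ D * (INR D + INR n)).
    + apply Rmult_le_compat; auto using Cmod_ge_0.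
    + assert (0 < (INR n + 1) ^ D) by (apply pow_lt; auto).
      replace (INR (fact n) * (INR n + 1) ^ D * (INR D + INR n))
        with (INR (fact n) * ((INR n + INR D) * (INR n + 1) ^ D)) by ring.
      replace ((INR n + 1) * INR (fact n) * (INR n + 1 + 1) ^ D)
        with (INR (fact n) * ((INR n + 1) * (INR n + 1 + 1) ^ D)) by ring.
      apply Rmult_le_compat_l; nra.
Qed.

Definition bcoef (a : C) (n : nat) : C := (poch a n / RtoC (INR (fact n)))%C.

Lemma bcoef_poly_bound (a : C) : exists D, forall n, Cmod (bcoef a n) <= (INR n + 1) ^ D.
Proof.
  destruct (poch_poly_bound a) as [D HD]; exists D; intros n; unfold bcoef.
  rewrite Cmod_div, Cmod_R, Rabs_pos_eq; [|left; apply INR_fact_lt_0|apply RtoC_fact_neq_0].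
  apply Rmult_le_reg_r with (INR (fact n)); [apply INR_fact_lt_0|].
  unfold Rdiv; rewrite Rmult_assoc, Rinv_l by apply INR_fact_neq_0.
  rewrite Rmult_1_r, (Rmult_comm (_ ^ D)); auto.
Qed.

Lemma bcoef_S (a : C) n : (RtoC (INR (S n)) * bcoef a (S n) = (a + RtoC (INR n)) * bcoef a n)%C.
Proof.
  unfold bcoef; rewrite fact_simpl, mult_INR, RtoC_mult; simpl poch.
  field; split; [apply RtoC_fact_neq_0|apply RtoC_neq_0, not_0_INR; lia].
Qed.

Lemma abssum_binom (a h : C) : Cmod h < 1 -> abssum (fun n => bcoef a n * h ^ n)%C.
Proof.
  intros Hh; destruct (bcoef_poly_bound a) as [D HD].
  apply abssum_poly_geom with 1 (Cmod h) D; [split; auto using Cmod_ge_0|].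
  intros n; rewrite Rmult_1_l, Cmod_mult, Cmod_pow.
  apply Rmult_le_compat_r; auto; apply pow_le, Cmod_ge_0.
Qed.

Lemma Carg_atan (z : C) : 0 < Re z -> Carg z = atan (Im z / Re z).
Proof.
  intros H; set (t := atan (Im z / Re z)).
  assert (Ht := atan_bound (Im z / Re z)); fold t in Ht.
  assert (Hc : 0 < cos t) by (apply cos_gt_0; lra).
  replace z with ((Re z / cos t) * cos t, (Re z / cos t) * sin t).
  - apply Carg_polar; [apply Rdiv_lt_0_compat; auto|lra].
  - apply C_eq; simpl; [field; lra|].
    replace (Re z / cos t * sin t) with (Re z * tan t) by (unfold tan; field; lra).
    unfold t; rewrite tan_atan; field; lra.
Qed.

Lemma ln_sqrt (x : R) : ln (sqrt x) = / 2 * ln x.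
Proof.
  destruct (Rlt_le_dec 0 x) as [H|H].
  - assert (Hs := sqrt_lt_R0 _ H).
    rewrite <- (sqrt_sqrt x) at 2 by lra. rewrite ln_mult by auto; lra.
  - rewrite sqrt_neg_0 by auto. unfold ln.
    destruct (Rlt_dec 0 0); [exfalso; lra|]. destruct (Rlt_dec 0 x); [exfalso|]; lra.
Qed.

Lemma Cderiv_Clog_ray (h : C) (t : R) :
  0 < Re (1 - RtoC t * h) -> Cderiv (fun t => Clog (1 - RtoC t * h)) t (- h / (1 - RtoC t * h))%C.
Proof.
  intros H. assert (Hz : (1 - RtoC t * h)%C <> RtoC 0).
  { intros E; rewrite E in H; simpl in H; lra. }
  destruct h as [p q].
  assert (E1 : forall t, Re (1 - RtoC t * (p, q)) = 1 - t * p) by (intros; simpl; ring).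
  assert (E2 : forall t, Im (1 - RtoC t * (p, q)) = - (t * q)) by (intros; simpl; ring).
  rewrite E1 in H.
  assert (H2 : 0 < (1 - t * p) ^ 2 + (t * q) ^ 2) by nra.
  assert (E : (- (p, q) / (1 - RtoC t * (p, q)))%C =
     ((- p * (1 - t * p) + t * q * q) / ((1 - t * p) ^ 2 + (t * q) ^ 2),
      (- q * (1 - t * p) - p * t * q) / ((1 - t * p) ^ 2 + (t * q) ^ 2))).
  { apply C_eq; simpl; field; nra. }
  rewrite E; split; simpl Re; simpl Im.
  - apply is_derive_ext with (fun t => / 2 * ln ((1 - t * p) ^ 2 + (t * q) ^ 2)).
    + intros u; simpl Re. unfold Cmod. rewrite ln_sqrt. do 3 f_equal; simpl; ring.
    + auto_derive; [simpl in *; lra|]. simpl in H2; field. nra.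
  - apply is_derive_ext_loc with (fun t => atan (- (t * q) / (1 - t * p))).
    (* [Carg] agrees with [atan] only where the real part is positive. This radius gives |(u - t) p|
       < 1 - t p, so that 1 - u p stays positive. *)
    + assert (Hd : 0 < (1 - t * p) / (Rabs p + 1)).
      { apply Rdiv_lt_0_compat; auto; generalize (Rabs_pos p); lra. }
      exists (mkposreal _ Hd); intros u Hu.
      change (Rabs (u - t) < (1 - t * p) / (Rabs p + 1)) in Hu.
      simpl Im. rewrite Carg_atan.
      * rewrite E1, E2; auto.
      * rewrite E1. assert (Hp := Rabs_pos p).
        assert (Rabs ((u - t) * p) < 1 - t * p).
        { rewrite Rabs_mult. apply Rle_lt_trans with (Rabs (u - t) * (Rabs p + 1)).
          - apply Rmult_le_compat_l; [apply Rabs_pos|lra].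
          - apply Rmult_lt_compat_r with (r := Rabs p + 1) in Hu; [|lra].
            unfold Rdiv in Hu; rewrite Rmult_assoc, Rinv_l in Hu; lra. }
        apply Rabs_def2 in H0. lra.
    + auto_derive; [simpl in *; lra|]. simpl in H2; field. split; nra.
Qed.

Lemma Cinv_neq_0 (x : C) : x <> RtoC 0 -> (/ x)%C <> RtoC 0.
Proof.
  intros Hx E; assert (E2 := Cinv_r _ Hx); rewrite E, Cmult_0_r in E2.
  apply (RtoC_neq_0 1); [lra|]. rewrite <- E2; auto.
Qed.

Lemma Cmult_reg_l (c x y : C) : c <> RtoC 0 -> (c * x)%C = (c * y)%C -> x = y.
Proof.
  intros Hc E; replace x with (/ c * (c * x))%C by (field; auto).
  rewrite E; field; auto.
Qed.

Lemma Re_one_minus_pos (h : C) : Cmod h < 1 -> 0 < Re (1 - h).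
Proof.
  intros H; generalize (re_le_Cmod h) (Rle_abs (Re h)); simpl; unfold Re; lra.
Qed.

(** On the ray t h the recurrence [bcoef_S] reads (1 - t h) V' = a h V, which is the equation of
    [series_ode] with L(t) = [Clog] (1 - t h) and exponent - a. *)
Lemma binomial_series (a h : C) :
  Cmod h < 1 -> Cpower (1 - h) (- a) = Cser (fun n => bcoef a n * h ^ n)%C.
Proof.
  intros Hh. assert (H0 := Cmod_ge_0 h).
  (* Chosen so that r > 1 and still r |h| < 1, as 2 |h| < 1 + |h|. *)
  set (r := 2 / (1 + Cmod h)).
  assert (Hr : 1 < r).
  { apply Rmult_lt_reg_r with (1 + Cmod h); [lra|]. unfold r; field_simplify; lra. }
  assert (Hrh : Cmod (RtoC r * h) < 1).
  { rewrite Cmod_mult, Cmod_R, Rabs_pos_eq by lra.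
    apply Rmult_lt_reg_r with (1 + Cmod h); [lra|]. unfold r; field_simplify; lra. }
  assert (Hth : forall t, 0 <= t <= 1 -> Cmod (RtoC t * h) < 1).
  { intros t Ht; rewrite Cmod_mult, Cmod_R, Rabs_pos_eq by lra; nra. }
  assert (Ep : forall t n, (bcoef a n * (RtoC t * h) ^ n = bcoef a n * h ^ n * RtoC (t ^ n))%C).
  { intros; rewrite Cpow_mult_l, RtoC_pow; ring. }
  rewrite (series_ode _ r (- a) (fun t => Clog (1 - RtoC t * h))
    (fun t => - h / (1 - RtoC t * h))%C); auto.
  - rewrite !Cmult_1_l, Cmult_0_l. replace (1 - 0)%C with (RtoC 1) by ring.
    rewrite Clog_pos, ln_1 by lra.
    replace (Clog (1 - h) - 0)%C with (Clog (1 - h)) by ring.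
    unfold bcoef, Cpower; simpl; field.
  - apply abssum_ext with (1 := Ep r), abssum_binom; auto.
  - intros t Ht; apply Cderiv_Clog_ray, Re_one_minus_pos; auto.
  - intros t Ht. set (v := fun n => (bcoef a n * h ^ n * RtoC (t ^ n))%C).
    set (u := fun n => (RtoC (INR (S n)) * (bcoef a (S n) * h ^ S n) * RtoC (t ^ n))%C).
    assert (Hz : (1 - RtoC t * h)%C <> RtoC 0).
    { intros E; assert (Hp := Re_one_minus_pos _ (Hth t Ht)); rewrite E in Hp; simpl in Hp; lra. }
    assert (Eu : forall n, u n = (h * ((a + RtoC (INR n)) * v n))%C).
    { intros n; unfold u, v. rewrite Cpow_S.
      replace (RtoC (INR (S n)) * (bcoef a (S n) * (h * h ^ n)))%C
        with ((RtoC (INR (S n)) * bcoef a (S n)) * (h * h ^ n))%C by ring.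
      rewrite bcoef_S; ring. }
    assert (Hv : abssum v) by (apply abssum_ext with (1 := Ep t), abssum_binom; auto).
    assert (Hnv : abssum (fun n => RtoC (INR n) * v n)%C).
    { destruct (bcoef_poly_bound a) as [D HD].
      apply abssum_poly_geom with 1 (Cmod (RtoC t * h)) (S D); [split; auto using Cmod_ge_0|].
      intros n; unfold v; rewrite <- Ep, !Cmod_mult, Cmod_R, Rabs_pos_eq, Cmod_pow, Cmod_mult by apply pos_INR.
      rewrite Rmult_1_l; simpl. rewrite <- Rmult_assoc.
      apply Rmult_le_compat_r; [apply pow_le, Rmult_le_pos; apply Cmod_ge_0|].
      apply Rmult_le_compat; auto using pos_INR, Cmod_ge_0; lra. }
    assert (Hu : abssum u).
    { apply abssum_ext with (fun n => h * (a * v n + RtoC (INR n) * v n))%C.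
      - intros n; rewrite Eu; ring.
      - apply abssum_scal, abssum_plus; auto; apply abssum_scal; auto. }
    assert (E1 : Cser u = (h * (a * Cser v + Cser (fun n => RtoC (INR n) * v n)))%C).
    { rewrite <- (Cser_scal a v), <- Cser_plus, <- Cser_scal; auto.
      - apply Cser_ext; intros n; rewrite Eu; ring.
      - apply abssum_plus; auto; apply abssum_scal; auto.
      - apply abssum_scal; auto. }
    assert (E2 : Cser (fun n => RtoC (INR n) * v n)%C = (RtoC t * Cser u)%C).
    { rewrite Cser_S by auto. rewrite <- Cser_scal by auto. simpl INR at 1.
      rewrite Cmult_0_l, Cplus_0_l. apply Cser_ext; intros n; unfold u, v.
      change (t ^ S n) with (t * t ^ n); rewrite RtoC_mult; ring. }
    rewrite E2 in E1. change (Cser u = - a * (- h / (1 - RtoC t * h)) * Cser v)%C.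
    apply Cmult_reg_l with (1 - RtoC t * h)%C; auto.
    replace ((1 - RtoC t * h) * (- a * (- h / (1 - RtoC t * h)) * Cser v))%C
      with (h * (a * Cser v))%C by (field; auto).
    transitivity (Cser u - RtoC t * h * Cser u)%C; [ring|]. rewrite E1 at 1; ring.
Qed.

(** * Sequences whose relative increments are O(1/n^2) *)

Lemma bounded_of_Clim (u : nat -> C) (l : C) :
  Clim eventually u l -> exists M, 0 < M /\ forall n, Cmod (u n) <= M.
Proof.
  intros H; destruct (Clim_bound eventually u l H) as [N HN].
  assert (HM : exists M, forall n, (n < N)%nat -> Cmod (u n) <= M).
  { clear; induction N as [|N [M HM]]; [exists 0; lia|].
    exists (Rmax M (Cmod (u N))); intros n Hn.
    destruct (Nat.eq_dec n N) as [->|]; [apply Rmax_r|].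
    eapply Rle_trans; [apply HM; lia|apply Rmax_l]. }
  destruct HM as [M HM]; exists (Rmax M (Cmod l + 1)); split.
  - eapply Rlt_le_trans; [|apply Rmax_r]; generalize (Cmod_ge_0 l); lra.
  - intros n; destruct (le_lt_dec N n).
    + eapply Rle_trans; [apply HN; auto|apply Rmax_r].
    + eapply Rle_trans; [apply HM; auto|apply Rmax_l].
Qed.

Lemma rsum_inv_sq n : rsum (fun k => / (INR k + 1) ^ 2) (S n) <= 2 - / (INR n + 1).
Proof.
  induction n as [|n IH]; [simpl; rewrite !Rplus_0_l, !Rmult_1_r, Rinv_1; lra|].
  rewrite rsum_S, S_INR. assert (H := INR1_pos n).
  enough (/ (INR n + 1 + 1) ^ 2 <= / (INR n + 1) - / (INR n + 1 + 1)) by lra.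
  replace (/ (INR n + 1) - / (INR n + 1 + 1)) with (/ ((INR n + 1) * (INR n + 1 + 1))) by (field; lra).
  apply Rinv_le_contravar; nra.
Qed.

Lemma ex_series_inv_sq : ex_series (fun k => / (INR k + 1) ^ 2).
Proof.
  apply ex_series_bounded with 2.
  - intros n; left; apply Rinv_0_lt_compat, pow_lt, INR1_pos.
  - intros [|n]; [simpl; lra|]. eapply Rle_trans; [apply rsum_inv_sq|].
    assert (H := Rinv_0_lt_compat _ (INR1_pos n)); lra.
Qed.

Lemma exp_mono (x y : R) : x <= y -> exp x <= exp y.
Proof. intros [H|H]; [left; apply exp_increasing; auto|rewrite H; lra]. Qed.

(** Each step multiplies the modulus by at most 1 + K / (n + 1)^2 <= exp (K / (n + 1)^2), and the
    inverse squares sum to at most 2. *)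
Lemma almost_const_bounded (u : nat -> C) (K : R) :
  0 <= K -> (forall n, Cmod (u (S n) - u n) <= K / (INR n + 1) ^ 2 * Cmod (u n)) ->
  exists M, 0 < M /\ forall n, Cmod (u n) <= M.
Proof.
  intros HK H. exists ((Cmod (u O) + 1) * exp (2 * K)).
  assert (H0 := Cmod_ge_0 (u O)).
  split; [apply Rmult_lt_0_compat; [lra|apply exp_pos]|].
  assert (Hb : forall n, Cmod (u n) <= Cmod (u O) * exp (K * rsum (fun k => / (INR k + 1) ^ 2) n)).
  { induction n as [|n IH]; [simpl; rewrite Rmult_0_r, exp_0; lra|].
    simpl rsum; rewrite Rmult_plus_distr_l, exp_plus.
    replace (u (S n)) with (u n + (u (S n) - u n))%C by ring.
    eapply Rle_trans; [apply Cmod_triangle|].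
    apply Rle_trans with (Cmod (u n) * exp (K * / (INR n + 1) ^ 2)).
    - specialize (H n). assert (E := exp_ineq1_le (K * / (INR n + 1) ^ 2)).
      assert (Hn := Cmod_ge_0 (u n)). unfold Rdiv in H. nra.
    - rewrite <- Rmult_assoc. apply Rmult_le_compat_r; auto. left; apply exp_pos. }
  intros n; eapply Rle_trans; [apply Hb|].
  apply Rmult_le_compat; [lra|left; apply exp_pos|lra|].
  apply exp_mono. rewrite (Rmult_comm 2). apply Rmult_le_compat_l; auto.
  destruct n as [|n]; [simpl; lra|].
  eapply Rle_trans; [apply rsum_inv_sq|].
  assert (Hn := Rinv_0_lt_compat _ (INR1_pos n)); lra.
Qed.

Lemma almost_const_lim (u : nat -> C) (K : R) :
  0 <= K -> (forall n, Cmod (u (S n) - u n) <= K / (INR n + 1) ^ 2 * Cmod (u n)) ->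
  exists l, Clim eventually u l.
Proof.
  intros HK H. destruct (almost_const_bounded u K HK H) as [M [HM Hb]].
  assert (Hs : abssum (fun n => u (S n) - u n)%C).
  { apply abssum_le with (fun n => K * M * / (INR n + 1) ^ 2).
    - intros n; eapply Rle_trans; [apply H|]. specialize (Hb n).
      assert (0 <= K / (INR n + 1) ^ 2).
      { apply Rdiv_le_0_compat; auto; apply pow_lt, INR1_pos. }
      unfold Rdiv in *; nra.
    - apply ex_series_scal_R, ex_series_inv_sq. }
  exists (u O + Cser (fun n => u (S n) - u n))%C.
  apply (Clim_ext eventually) with (fun n => u O + csum (fun n => u (S n) - u n) n)%C.
  - induction r as [|n IH]; simpl; [ring|].
    transitivity ((u O + csum (fun n => u (S n) - u n) n) + (u (S n) - u n))%C; [ring|].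
    rewrite IH; ring.
  - apply (Clim_plus eventually); [apply (Clim_const eventually)|apply abssum_lim; auto].
Qed.

(** A zero limit is excluded by bounding 1/u. Past an index N > 2 K a step loses at most half of the
    modulus, so 1/u satisfies the hypothesis of [almost_const_bounded] with 2 K in place of K. *)
Lemma almost_const_lim_neq_0 (u : nat -> C) (K : R) :
  0 <= K -> (forall n, u n <> RtoC 0) ->
  (forall n, Cmod (u (S n) - u n) <= K / (INR n + 1) ^ 2 * Cmod (u n)) ->
  exists l, l <> RtoC 0 /\ Clim eventually u l.
Proof.
  intros HK Hu H. destruct (almost_const_lim u K HK H) as [l Hl].
  exists l; split; auto.
  destruct (INR_unbounded (2 * K)) as [N HN].
  assert (Hp : forall n, 0 < Cmod (u n)) by (intros; apply Cmod_gt_0; auto).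
  destruct (almost_const_bounded (fun n => / u (N + n)%nat)%C (2 * K)) as [M [HM Hb]]; [lra| |].
  - intros n. rewrite Nat.add_succ_r. set (m := (N + n)%nat).
    assert (Hm : K / (INR m + 1) ^ 2 <= / 2).
    { assert (Hm1 : 2 * K <= INR m) by (unfold m; rewrite plus_INR; generalize (pos_INR n); lra).
      assert (H1 := INR1_ge1 m). apply Rmult_le_reg_r with ((INR m + 1) ^ 2); [nra|].
      unfold Rdiv; rewrite Rmult_assoc, Rinv_l by nra. nra. }
    assert (H1 := H m). assert (P0 := Hp m). assert (P1 := Hp (S m)).
    assert (Hlow : Cmod (u m) / 2 <= Cmod (u (S m))).
    { generalize (Cmod_triangle_rev (u m) (u (S m))); rewrite Cmod_sub_comm; nra. }
    replace (/ u (S m) - / u m)%C with (- (u (S m) - u m) / (u (S m) * u m))%C by (field; auto).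
    rewrite Cmod_div, Cmod_opp, Cmod_mult, Cmod_inv by (auto; apply Cmult_neq_0; auto).
    assert (Hmn : / (INR m + 1) ^ 2 <= / (INR n + 1) ^ 2).
    { apply Rinv_le_contravar; [apply pow_lt, INR1_pos|]. apply pow_incr; split; [left; apply INR1_pos|].
      unfold m; rewrite plus_INR; generalize (pos_INR N); lra. }
    assert (Hi := Rinv_0_lt_compat _ (pow_lt _ 2 (INR1_pos m))).
    apply Rmult_le_reg_r with (Cmod (u (S m)) * Cmod (u m)); [nra|].
    unfold Rdiv at 1; rewrite Rmult_assoc, Rinv_l, Rmult_1_r by nra.
    replace (2 * K / (INR n + 1) ^ 2 * / Cmod (u m) * (Cmod (u (S m)) * Cmod (u m)))
      with (2 * K * / (INR n + 1) ^ 2 * Cmod (u (S m))).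
    2: field; split; [lra|generalize (INR1_pos n); lra].
    eapply Rle_trans; [exact H1|]. unfold Rdiv.
    apply Rle_trans with (K * / (INR n + 1) ^ 2 * Cmod (u m)).
    + apply Rmult_le_compat_r; [lra|]. apply Rmult_le_compat_l; auto.
    + assert (0 <= K * / (INR n + 1) ^ 2) by (apply Rmult_le_pos; lra). nra.
  - intros El; rewrite El in Hl.
    destruct (Hl (/ M) (Rinv_0_lt_compat _ HM)) as [N' HN'].
    specialize (HN' (N + N')%nat ltac:(lia)). specialize (Hb N').
    replace (u (N + N')%nat - 0)%C with (u (N + N')%nat) in HN' by ring.
    rewrite Cmod_inv in Hb by auto. assert (P := Hp (N + N')%nat).
    apply Rinv_le_contravar in Hb; [|apply Rinv_0_lt_compat; auto].
    rewrite Rinv_inv in Hb; lra.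
Qed.

(** * Euler's limit for Gamma *)

Lemma ln_1p_bound (e : R) : 0 <= e -> 0 <= ln (1 + e) <= e /\ Rabs (ln (1 + e) - e) <= e ^ 2.
Proof.
  intros He.
  assert (H1 : ln (1 + e) <= e).
  { rewrite <- (ln_exp e) at 2. apply ln_le; [lra|apply exp_ineq1_le]. }
  assert (H2 : e - e ^ 2 <= ln (1 + e)).
  { assert (H := exp_ineq1_le (- ln (1 + e))). rewrite exp_Ropp, exp_ln in H by lra.
    assert (e - e ^ 2 <= 1 - / (1 + e)); [|lra].
    replace (1 - / (1 + e)) with (e * / (1 + e)) by (field; lra).
    apply Rmult_le_reg_r with (1 + e); [lra|]. rewrite Rmult_assoc, Rinv_l by lra. nra. }
  assert (H3 : 0 <= ln (1 + e)) by (rewrite <- ln_1; apply ln_le; lra).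
  split; [lra|]. apply Rabs_le; nra.
Qed.

Lemma Cpower_1p_bound (s : C) :
  exists K, 0 <= K /\ forall e, 0 <= e <= 1 ->
    Cmod (Cpower (RtoC (1 + e)) s - 1 - s * RtoC e) <= K * e ^ 2.
Proof.
  assert (Hs := Cmod_ge_0 s).
  exists (Cmod s ^ 2 * exp (Cmod s) + Cmod s); split.
  { assert (0 < exp (Cmod s)) by apply exp_pos. nra. }
  intros e He. destruct (ln_1p_bound e ltac:(lra)) as [[L1 L2] L3].
  rewrite Cpower_pos by lra. set (l := ln (1 + e)) in *.
  replace (_ - 1 - s * RtoC e)%C
    with ((Cexp (s * RtoC l) - 1 - s * RtoC l) + s * RtoC (l - e))%C
    by (rewrite RtoC_minus; ring).
  eapply Rle_trans; [apply Cmod_triangle|].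
  assert (Hm : Cmod (s * RtoC l) <= Cmod s * e).
  { rewrite Cmod_mult, Cmod_R, Rabs_pos_eq by auto. nra. }
  assert (Hm0 := Cmod_ge_0 (s * RtoC l)).
  assert (B1 : Cmod (Cexp (s * RtoC l) - 1 - s * RtoC l) <= Cmod s ^ 2 * exp (Cmod s) * e ^ 2).
  { eapply Rle_trans; [apply Cexp_bound2|].
    replace (Cmod s ^ 2 * exp (Cmod s) * e ^ 2) with ((Cmod s * e) ^ 2 * exp (Cmod s)) by ring.
    apply Rmult_le_compat; [apply pow_le; auto|left; apply exp_pos|apply pow_incr; auto|].
    apply exp_mono; nra. }
  assert (B2 : Cmod (s * RtoC (l - e)) <= Cmod s * e ^ 2).
  { rewrite Cmod_mult, Cmod_R; nra. }
  lra.
Qed.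

(** Tends to 1 / Gamma (z). The base n + 1 keeps the power meaningful at n = 0. *)
Definition rho (z : C) (n : nat) : C :=
  (poch z n / (RtoC (INR (fact n)) * Cpower (RtoC (INR n + 1)) (z - 1)))%C.

(** With e = 1 / (n + 1) the ratio of consecutive terms is (1 + (z - 1) e) (1 + e)^(1 - z); the
    exponent z - 1 in [rho] is the one for which the first-order terms in e cancel. *)
Lemma rho_step (z : C) : exists K, 0 <= K /\
  forall n, Cmod (rho z (S n) - rho z n) <= K / (INR n + 1) ^ 2 * Cmod (rho z n).
Proof.
  destruct (Cpower_1p_bound (1 - z)) as [K [HK HB]].
  set (S1 := Cmod (1 - z)). assert (HS := Cmod_ge_0 (1 - z)); fold S1 in HS.
  exists (S1 ^ 2 + (1 + S1) * K); split; [nra|].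
  intros n. set (e := / (INR n + 1)).
  assert (Hn := INR1_ge1 n).
  assert (He : 0 < e <= 1).
  { unfold e; split; [apply Rinv_0_lt_compat; lra|]. rewrite <- Rinv_1; apply Rinv_le_contravar; lra. }
  set (d := (Cpower (RtoC (1 + e)) (1 - z) - 1 - (1 - z) * RtoC e)%C).
  assert (Hd : Cmod d <= K * e ^ 2) by (apply HB; lra).
  assert (E : (rho z (S n) = (1 + (z - 1) * RtoC e) * (1 + (1 - z) * RtoC e + d) * rho z n)%C).
  { replace (1 + (1 - z) * RtoC e + d)%C with (Cpower (RtoC (1 + e)) (1 - z)) by (unfold d; ring).
    unfold rho. rewrite S_INR.
    replace (INR n + 1 + 1) with ((INR n + 1) * (1 + e)) by (unfold e; field; lra).
    rewrite Cpower_mult_pos by lra.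
    replace (1 - z)%C with (- (z - 1))%C by ring. rewrite Cpower_opp.
    rewrite fact_simpl, mult_INR, RtoC_mult, S_INR. simpl poch.
    unfold e; rewrite RtoC_inv by lra.
    rewrite RtoC_plus. field. repeat split; try apply Cpower_neq_0; try apply RtoC_fact_neq_0.
    rewrite <- RtoC_plus; apply RtoC_neq_0; lra. }
  replace (rho z (S n) - rho z n)%C
    with ((- ((1 - z) * (1 - z)) * RtoC e * RtoC e + (1 - (1 - z) * RtoC e) * d) * rho z n)%C
    by (rewrite E; ring).
  rewrite Cmod_mult. apply Rmult_le_compat_r; [apply Cmod_ge_0|].
  eapply Rle_trans; [apply Cmod_triangle|].
  rewrite !Cmod_mult, Cmod_opp, !Cmod_mult, Cmod_R, Rabs_pos_eq by lra. fold S1.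
  assert (Cmod (1 - (1 - z) * RtoC e) <= 1 + S1).
  { eapply Rle_trans; [apply Cmod_triangle_sub|].
    rewrite Cmod_mult, Cmod_1, Cmod_R, Rabs_pos_eq by lra. fold S1; nra. }
  replace ((S1 ^ 2 + (1 + S1) * K) / (INR n + 1) ^ 2) with (S1 * S1 * e * e + (1 + S1) * (K * e ^ 2))
    by (unfold e; field; lra).
  apply Rplus_le_compat; [lra|]. apply Rmult_le_compat; auto using Cmod_ge_0.
Qed.

Lemma Cpower_cvg_1 (g : nat -> R) (s : C) :
  (forall n, 0 <= g n) -> is_lim_seq g 0 -> Clim eventually (fun n => Cpower (RtoC (1 + g n)) s) 1.
Proof.
  intros Hg Hl. destruct (Cpower_1p_bound s) as [K [HK HB]].
  assert (Hs := Cmod_ge_0 s).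
  apply (small_le eventually) with (fun n => (K + Cmod s) * g n).
  - apply is_lim_seq_spec in Hl. destruct (Hl (mkposreal 1 Rlt_0_1)) as [N HN]; simpl in HN.
    exists N; intros n Hn; specialize (HN n Hn). rewrite Rminus_0_r, Rabs_pos_eq in HN by auto.
    specialize (Hg n). specialize (HB (g n) ltac:(lra)).
    replace (Cpower (RtoC (1 + g n)) s - 1)%C
      with ((Cpower (RtoC (1 + g n)) s - 1 - s * RtoC (g n)) + s * RtoC (g n))%C by ring.
    eapply Rle_trans; [apply Cmod_triangle|].
    rewrite (Cmod_mult s), Cmod_R, Rabs_pos_eq by auto.
    assert (K * g n ^ 2 <= K * g n) by (apply Rmult_le_compat_l; nra). lra.
  - apply (small_scal eventually); [lra|]. intros e He.
    apply is_lim_seq_spec in Hl. destruct (Hl (mkposreal e He)) as [N HN]; simpl in HN.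
    exists N; intros n Hn; specialize (HN n Hn). rewrite Rminus_0_r, Rabs_pos_eq in HN; auto.
Qed.

Lemma is_lim_seq_inv_INR1 : is_lim_seq (fun n => / (INR n + 1)) 0.
Proof.
  apply is_lim_seq_ext with (fun n => / INR (S n)); [intros; rewrite S_INR; auto|].
  apply (is_lim_seq_incr_1 (fun n => / INR n)).
  apply is_lim_seq_spec. intros [e He].
  destruct (INR_unbounded (/ e)) as [N HN]. exists N; intros n Hn; simpl.
  assert (Hn' : INR N <= INR n) by (apply le_INR; auto).
  assert (Hp := Rinv_0_lt_compat _ He).
  rewrite Rminus_0_r, Rabs_pos_eq by (left; apply Rinv_0_lt_compat; lra).
  rewrite <- (Rinv_inv e). apply Rinv_lt_contravar; nra.
Qed.

Lemma Clim_eventually_S (u : nat -> C) (l : C) :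
  Clim eventually u l -> Clim eventually (fun n => u (S n)) l.
Proof. intros H e He; destruct (H e He) as [N HN]; exists N; intros; apply HN; lia. Qed.

(** Euler's quotient at n is 1 / rho (n + 1) times (1 + 2/n)^(-z) (1 + 1 / (n + 1)), because n + 2 =
    n (1 + 2/n); the correction tends to 1. As the limit of [rho] is not 0, the value of [CGamma] is
    its inverse and is itself not 0. *)
Lemma gamma_lim (z : C) : ~ nonpos_int z ->
  CGamma z <> RtoC 0 /\ Clim eventually (rho z) (/ CGamma z)%C.
Proof.
  intros Hz. destruct (rho_step z) as [K [HK HB]].
  destruct (almost_const_lim_neq_0 (rho z) K HK) as [l [Hl0 Hl]]; auto.
  { intros n; unfold rho. apply Cmult_neq_0; [apply poch_neq_0; auto|].
    apply Cinv_neq_0, Cmult_neq_0; [apply RtoC_fact_neq_0|apply Cpower_neq_0]. }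
  assert (HG : CGamma z = (/ l)%C).
  { unfold CGamma; apply CLim_Clim.
    apply (Clim_ext_loc eventually) with
      (fun n => / rho z (S n) * (/ Cpower (RtoC (1 + 2 / INR n)) z * RtoC (1 + / (INR n + 1))))%C.
    - exists 1%nat; intros n Hn.
      assert (Hn0 : 0 < INR n) by (apply lt_0_INR; lia).
      unfold rho. rewrite S_INR, fact_simpl, mult_INR, RtoC_mult, S_INR.
      replace (INR n + 1 + 1) with (INR n * (1 + 2 / INR n)) at 1 by (field; lra).
      assert (H2 : 0 < 2 / INR n) by (apply Rdiv_lt_0_compat; lra).
      rewrite Cpower_mult_pos by lra.
      replace (Cpower (RtoC (1 + 2 / INR n)) (z - 1))
        with (Cpower (RtoC (1 + 2 / INR n)) z / RtoC (1 + 2 / INR n))%C.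
      2: { unfold Cminus; rewrite Cpower_add, Cpower_opp, Cpower_1_pos by lra; auto. }
      replace (Cpower (RtoC (INR n)) (z - 1))
        with (Cpower (RtoC (INR n)) z / RtoC (INR n))%C.
      2: { unfold Cminus; rewrite Cpower_add, Cpower_opp, Cpower_1_pos by lra; auto. }
      replace (RtoC (1 + / (INR n + 1)))
        with (RtoC (1 + 2 / INR n) * RtoC (INR n) / RtoC (INR n + 1))%C.
      2: { rewrite <- RtoC_mult, <- RtoC_div by lra. f_equal; field; lra. }
      field. repeat split; try apply Cpower_neq_0; try apply RtoC_fact_neq_0;
        try (apply RtoC_neq_0; lra); try (apply poch_neq_0; auto).
    - replace (/ l)%C with (/ l * (/ 1 * 1))%C by (field; auto).
      apply (Clim_mult eventually); [apply (Clim_inv eventually); auto; apply Clim_eventually_S; auto|].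
      apply (Clim_mult eventually).
      + apply (Clim_inv eventually); [apply RtoC_neq_0; lra|].
        (* [Cpower_cvg_1] wants a perturbation that is non-negative at every n; the absolute value
           also covers the meaningless / [INR] 0. *)
        apply (Clim_ext_loc eventually) with (fun n => Cpower (RtoC (1 + 2 * Rabs (/ INR n))) z).
        * exists 1%nat; intros n Hn. assert (0 < INR n) by (apply lt_0_INR; lia).
          rewrite Rabs_pos_eq by (left; apply Rinv_0_lt_compat; auto); auto.
        * apply Cpower_cvg_1.
          -- intros n; generalize (Rabs_pos (/ INR n)); lra.
          -- replace (Finite 0) with (Rbar_mult 2 0) by (simpl; f_equal; ring).
             apply is_lim_seq_scal_l. rewrite <- Rabs_R0. apply (is_lim_seq_abs _ 0).
             apply is_lim_seq_incr_1.
             apply is_lim_seq_ext with (2 := is_lim_seq_inv_INR1); intros; rewrite S_INR; auto.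
      + apply (Clim_ext eventually) with (fun n => Cpower (RtoC (1 + / (INR n + 1))) 1).
        * intros n; rewrite Cpower_1_pos; auto.
          assert (H := Rinv_0_lt_compat _ (INR1_pos n)); lra.
        * apply Cpower_cvg_1; [|apply is_lim_seq_inv_INR1].
          intros n; left; apply Rinv_0_lt_compat, INR1_pos. }
  rewrite HG; split.
  - apply Cinv_neq_0; auto.
  - replace (/ / l)%C with l; auto. field; auto. 
Qed.

Lemma Cmod_rho (z : C) n : Cmod (rho z n) =
  Cmod (poch z n) / (INR (fact n) * Rpower (INR n + 1) (Re z - 1)).
Proof.
  unfold rho. rewrite Cmod_div, Cmod_mult, Cmod_R, Rabs_pos_eq, Cmod_Cpower_pos.
  - simpl; unfold Re; auto.
  - apply INR1_pos.
  - left; apply INR_fact_lt_0.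
  - apply Cmult_neq_0; [apply RtoC_fact_neq_0|apply Cpower_neq_0].
Qed.

Lemma Rpower_pos (x y : R) : 0 < Rpower x y.
Proof. apply exp_pos. Qed.

Lemma poch_upper (z : C) : exists M, 0 < M /\
  forall n, Cmod (poch z n) <= M * INR (fact n) * Rpower (INR n + 1) (Re z - 1).
Proof.
  destruct (rho_step z) as [K [HK HB]].
  destruct (almost_const_bounded (rho z) K HK HB) as [M [HM H]].
  exists M; split; auto; intros n. specialize (H n). rewrite Cmod_rho in H.
  assert (Hf := INR_fact_lt_0 n); assert (Hr := Rpower_pos (INR n + 1) (Re z - 1)).
  apply Rmult_le_compat_r with (r := INR (fact n) * Rpower (INR n + 1) (Re z - 1)) in H; [|nra].
  unfold Rdiv in H; rewrite Rmult_assoc, Rinv_l in H by nra. lra.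
Qed.

(** Together with [poch_upper] this pins |(z)_n| to the order n! (n + 1)^(Re z - 1). Here 1 / [rho]
    converges, hence is bounded. *)
Lemma poch_lower (z : C) : ~ nonpos_int z -> exists M, 0 < M /\
  forall n, / Cmod (poch z n) <= M * Rpower (INR n + 1) (1 - Re z) / INR (fact n).
Proof.
  intros Hz. destruct (gamma_lim z Hz) as [HG Hl].
  assert (Hn0 := Cinv_neq_0 _ HG).
  apply (Clim_inv eventually) in Hl; auto.
  destruct (bounded_of_Clim _ _ Hl) as [M [HM H]].
  exists M; split; auto; intros n. specialize (H n).
  assert (Hf := INR_fact_lt_0 n); assert (Hr := Rpower_pos (INR n + 1) (Re z - 1)).
  assert (Hp := proj1 (Cmod_gt_0 _) (poch_neq_0 z n Hz)).
  rewrite Cmod_inv in H.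
  2: { apply Cmod_gt_0; rewrite Cmod_rho. apply Rdiv_lt_0_compat; nra. }
  rewrite Cmod_rho in H.
  replace (1 - Re z) with (- (Re z - 1)) by ring. rewrite Rpower_Ropp.
  replace (/ Cmod (poch z n)) with
    (/ (Cmod (poch z n) / (INR (fact n) * Rpower (INR n + 1) (Re z - 1))) *
       (/ Rpower (INR n + 1) (Re z - 1) / INR (fact n))) by (field; lra).
  replace (M * / Rpower (INR n + 1) (Re z - 1) / INR (fact n))
    with (M * (/ Rpower (INR n + 1) (Re z - 1) / INR (fact n))) by (field; lra).
  apply Rmult_le_compat_r; auto. apply Rlt_le, Rdiv_lt_0_compat; auto. apply Rinv_0_lt_compat; auto.
Qed.

(** * The beta-binomial functional *)

Lemma bcoef_neq_0 (z : C) n : ~ nonpos_int z -> bcoef z n <> RtoC 0.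
Proof.
  intros Hz; apply Cmult_neq_0; [apply poch_neq_0; auto|apply Cinv_neq_0, RtoC_fact_neq_0].
Qed.

Lemma bcoef_S_l (a : C) n : (RtoC (INR (S n)) * bcoef a (S n) = a * bcoef (a + 1) n)%C.
Proof.
  unfold bcoef; rewrite fact_simpl, mult_INR, RtoC_mult, poch_S_l.
  field; split; [apply RtoC_fact_neq_0|apply RtoC_neq_0, not_0_INR; lia].
Qed.

(* Weights of the beta-binomial law with parameters N, b, d. *)
Definition lam (b d : C) (N j : nat) : C := (bcoef b j * bcoef d (N - j) / bcoef (b + d) N)%C.

Definition LamN (b d : C) (f : R -> C) (N : nat) : C :=
  csum (fun j => lam b d N j * f (INR j / INR N)%R)%C (S N).

(** Consistency of the Polya urn: deleting one of N + 1 draws chosen uniformly leaves the law of N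
    draws. After [bcoef_S] it amounts to b + d + N = (b + j) + (d + N - j). *)
Lemma lam_refine (b d : C) N j : ~ nonpos_int (b + d) -> (j <= N)%nat ->
  lam b d N j = (lam b d (S N) j * RtoC (INR (S N - j)) / RtoC (INR (S N))
    + lam b d (S N) (S j) * RtoC (INR (S j)) / RtoC (INR (S N)))%C.
Proof.
  intros Hc Hj. unfold lam. rewrite Nat.sub_succ, Nat.sub_succ_l by auto.
  assert (E1 := bcoef_S b j). assert (E2 := bcoef_S d (N - j)). assert (E3 := bcoef_S (b + d) N).
  assert (H0 := bcoef_neq_0 (b + d) N Hc). assert (H1 := bcoef_neq_0 (b + d) (S N) Hc).
  assert (HN : RtoC (INR (S N)) <> RtoC 0) by (apply RtoC_neq_0, not_0_INR; lia).
  transitivity (((b + RtoC (INR j)) * bcoef b j * bcoef d (N - j)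
    + bcoef b j * ((d + RtoC (INR (N - j))) * bcoef d (N - j)))
      / (RtoC (INR (S N)) * bcoef (b + d) (S N)))%C.
  - rewrite E3, minus_INR, RtoC_minus by auto.
    assert (b + d + RtoC (INR N) <> RtoC 0)%C.
    { intros E; rewrite E, Cmult_0_l in E3. apply (Cmult_neq_0 _ _ HN H1); auto. }
    field; auto.
  - rewrite <- E1, <- E2. field; auto.
Qed.

(** [lam_refine] transposed onto the test function. The default value at [pred] 0 and the value phi
    (N + 1) beyond the range both have weight 0. *)
Lemma lam_refine_sum (b d : C) N (phi : nat -> C) : ~ nonpos_int (b + d) ->
  csum (fun j => lam b d N j * phi j)%C (S N) =
  csum (fun j => lam b d (S N) j * ((RtoC (INR (S N - j)) / RtoC (INR (S N))) * phi j
     + (RtoC (INR j) / RtoC (INR (S N))) * phi (pred j)))%C (S (S N)).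
Proof.
  intros Hc.
  rewrite (csum_ext _ (fun j => (lam b d (S N) j * RtoC (INR (S N - j)) / RtoC (INR (S N))) * phi j
    + (lam b d (S N) (S j) * RtoC (INR (S j)) / RtoC (INR (S N))) * phi j)%C).
  2: { intros k Hk; rewrite lam_refine by (auto; lia); ring. }
  rewrite csum_plus.
  rewrite (csum_ext (fun j => lam b d (S N) j * _)%C
    (fun j => (lam b d (S N) j * RtoC (INR (S N - j)) / RtoC (INR (S N))) * phi j
    + (lam b d (S N) j * RtoC (INR j) / RtoC (INR (S N))) * phi (pred j))%C (S (S N))).
  2: { intros; unfold Cdiv; ring. }
  rewrite csum_plus. f_equal.
  - rewrite (csum_S _ (S N)), Nat.sub_diag. simpl INR at 4. unfold Cdiv. 
    rewrite Cmult_0_r, !Cmult_0_l, Cplus_0_r; auto.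
  - rewrite (csum_S_l _ (S N)). simpl INR at 3. unfold Cdiv.
    rewrite Cmult_0_r, !Cmult_0_l, Cplus_0_l; auto.
Qed.

Lemma weights_sum N j : (j <= S N)%nat ->
  (RtoC (INR (S N - j)) / RtoC (INR (S N)) + RtoC (INR j) / RtoC (INR (S N)) = 1)%C.
Proof.
  intros Hj; rewrite minus_INR, RtoC_minus by auto. field. apply RtoC_neq_0, not_0_INR; lia.
Qed.

Lemma lam_sum (b d : C) N : ~ nonpos_int (b + d) -> csum (lam b d N) (S N) = RtoC 1.
Proof.
  intros Hc; induction N as [|N IH].
  - unfold lam, bcoef; simpl. field.
  - rewrite <- IH. symmetry.
    rewrite (csum_ext _ (fun j => lam b d N j * 1)%C) by (intros; ring).
    rewrite (lam_refine_sum b d N (fun _ => RtoC 1) Hc).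
    apply csum_ext; intros k Hk. rewrite !Cmult_1_r, weights_sum by lia; ring.
Qed.

Lemma poch_real_pos (x : R) n : 0 < x -> poch (RtoC x) n = RtoC (Cmod (poch (RtoC x) n)).
Proof.
  intros Hx; induction n as [|n IH]; [simpl; rewrite Cmod_1; auto|].
  simpl poch; rewrite Cmod_mult, RtoC_mult, <- IH, <- RtoC_plus, Cmod_R, Rabs_pos_eq; auto.
  generalize (pos_INR n); lra.
Qed.

Lemma bcoef_real_pos (x : R) n : 0 < x -> bcoef (RtoC x) n = RtoC (Cmod (bcoef (RtoC x) n)).
Proof.
  intros Hx; unfold bcoef. rewrite Cmod_div, Cmod_R, Rabs_pos_eq, RtoC_div, <- poch_real_pos; auto.
  - apply INR_fact_neq_0.
  - left; apply INR_fact_lt_0.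
  - apply RtoC_fact_neq_0.
Qed.

Lemma poch_Re_le (c : C) n : 0 < Re c -> Cmod (poch (RtoC (Re c)) n) <= Cmod (poch c n).
Proof.
  intros Hc; induction n as [|n IH]; [simpl; lra|].
  simpl poch; rewrite !Cmod_mult. apply Rmult_le_compat; auto using Cmod_ge_0.
  rewrite <- RtoC_plus, Cmod_R. replace (Re c + INR n) with (Re (c + RtoC (INR n))%C) by (simpl; auto).
  apply re_le_Cmod.
Qed.

(** In this direction no factor-by-factor comparison is possible, but both sides have order n! (n +
    1)^(Re b - 1), which depends on Re b only. *)
Lemma poch_le_Re (b : C) : 0 < Re b ->
  exists M, 0 < M /\ forall n, Cmod (poch b n) <= M * Cmod (poch (RtoC (Re b)) n).
Proof.
  intros Hb. destruct (poch_upper b) as [M1 [HM1 H1]].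
  destruct (poch_lower (RtoC (Re b))) as [M2 [HM2 H2]]; [apply Re_pos_not_nonpos; auto|].
  exists (M1 * M2); split; [nra|]. intros n.
  assert (Hp : 0 < Cmod (poch (RtoC (Re b)) n)).
  { apply Cmod_gt_0, poch_neq_0, Re_pos_not_nonpos; auto. }
  specialize (H2 n); simpl Re in H2.
  apply Rle_trans with (M1 * M2 * (/ Cmod (poch (RtoC (Re b)) n) * Cmod (poch (RtoC (Re b)) n)) *
     Cmod (poch (RtoC (Re b)) n)); [|rewrite Rinv_l by lra; lra].
  eapply Rle_trans; [apply H1|].
  assert (Hf := INR_fact_lt_0 n).
  apply Rmult_le_compat_r with (r := Cmod (poch (RtoC (Re b)) n)) in H2; [|lra].
  rewrite Rinv_l in * by lra. rewrite !Rmult_assoc. apply Rmult_le_compat_l; [lra|].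
  rewrite Rmult_1_l.
  assert (Hr := Rpower_pos (INR n + 1) (Re b - 1)).
  replace (1 - Re b) with (- (Re b - 1)) in H2 by ring. rewrite Rpower_Ropp in H2.
  apply Rmult_le_compat_r with (r := INR (fact n) * Rpower (INR n + 1) (Re b - 1)) in H2; [|nra].
  rewrite Rmult_1_l in H2. eapply Rle_trans; [exact H2|].
  right; field; lra.
Qed.

Lemma bcoef_le_Re (b : C) : 0 < Re b ->
  exists M, 0 < M /\ forall n, Cmod (bcoef b n) <= M * Cmod (bcoef (RtoC (Re b)) n).
Proof.
  intros Hb; destruct (poch_le_Re b Hb) as [M [HM H]]; exists M; split; auto; intros n.
  unfold bcoef. rewrite !Cmod_div by apply RtoC_fact_neq_0.
  unfold Rdiv; rewrite <- Rmult_assoc. apply Rmult_le_compat_r; auto.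
  left; apply Rinv_0_lt_compat, Cmod_gt_0, RtoC_fact_neq_0.
Qed.

Lemma bcoef_Re_le (c : C) n : 0 < Re c -> Cmod (bcoef (RtoC (Re c)) n) <= Cmod (bcoef c n).
Proof.
  intros Hc. unfold bcoef. rewrite !Cmod_div by apply RtoC_fact_neq_0.
  apply Rmult_le_compat_r; [|apply poch_Re_le; auto].
  left; apply Rinv_0_lt_compat, Cmod_gt_0, RtoC_fact_neq_0.
Qed.

(** For complex b and d the weights are no probability law. Up to a constant they are dominated by
    the law with parameters Re b and Re d, non-negative of total mass 1: the numerators by
    [bcoef_le_Re], the denominator by [bcoef_Re_le]. *)
Lemma lam_abs_sum (b d : C) : 0 < Re b -> 0 < Re d ->
  exists K, 0 < K /\ forall N, rsum (fun j => Cmod (lam b d N j)) (S N) <= K.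
Proof.
  intros Hb Hd. destruct (bcoef_le_Re b Hb) as [M1 [HM1 H1]].
  destruct (bcoef_le_Re d Hd) as [M2 [HM2 H2]].
  assert (Hc : 0 < Re (b + d)) by (simpl; unfold Re in *; lra).
  exists (M1 * M2); split; [nra|]. intros N.
  set (be := RtoC (Re b)); set (de := RtoC (Re d)).
  assert (Ebd : (be + de)%C = RtoC (Re (b + d))) by (unfold be, de; rewrite <- RtoC_plus; auto).
  assert (Hr : rsum (fun j => Cmod (lam be de N j)) (S N) = 1).
  { apply RtoC_inj; rewrite <- csum_RtoC.
    rewrite <- (lam_sum be de N).
    - apply csum_ext; intros j _. unfold lam. rewrite Ebd. unfold be, de.
      rewrite Cmod_div, Cmod_mult, RtoC_div, RtoC_mult, <- !bcoef_real_pos; auto.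
      + apply Rgt_not_eq, Cmod_gt_0, bcoef_neq_0, Re_pos_not_nonpos; auto.
      + apply bcoef_neq_0, Re_pos_not_nonpos; auto.
    - rewrite Ebd; apply Re_pos_not_nonpos; auto. }
  rewrite <- (Rmult_1_r (M1 * M2)), <- Hr, <- rsum_scal.
  apply rsum_le; intros j Hj. unfold lam.
  assert (Hn1 : bcoef (b + d) N <> RtoC 0) by (apply bcoef_neq_0, Re_pos_not_nonpos; auto).
  assert (Hn2 : bcoef (be + de) N <> RtoC 0)
    by (rewrite Ebd; apply bcoef_neq_0, Re_pos_not_nonpos; auto).
  rewrite !Cmod_div, !Cmod_mult by auto.
  assert (L1 := bcoef_Re_le (b + d) N Hc). rewrite <- Ebd in L1.
  apply Cmod_gt_0 in Hn1; apply Cmod_gt_0 in Hn2.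
  replace (M1 * M2 * (Cmod (bcoef be j) * Cmod (bcoef de (N - j)) / Cmod (bcoef (be + de) N)))
    with ((M1 * Cmod (bcoef be j)) * (M2 * Cmod (bcoef de (N - j))) * / Cmod (bcoef (be + de) N))
    by (unfold Rdiv; ring).
  unfold Rdiv. assert (G := Cmod_ge_0 (bcoef b j)). assert (G' := Cmod_ge_0 (bcoef d (N - j))).
  apply Rmult_le_compat.
  - apply Rmult_le_pos; auto.
  - left; apply Rinv_0_lt_compat; auto.
  - apply Rmult_le_compat; auto.
  - apply Rinv_le_contravar; auto.
Qed.

Definition unit_le (f : R -> C) (M : R) : Prop := forall t, 0 <= t <= 1 -> Cmod (f t) <= M.

Lemma unit_ratio N j : (j <= S N)%nat -> 0 <= INR j / INR (S N) <= 1.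
Proof.
  intros Hj. assert (H := lt_0_INR (S N) ltac:(lia)). assert (H' := le_INR _ _ Hj).
  split; [apply Rdiv_le_0_compat; auto; apply pos_INR|].
  apply Rmult_le_reg_r with (INR (S N)); auto. unfold Rdiv; rewrite Rmult_assoc, Rinv_l; lra.
Qed.

Lemma lam_avg_bound (b d : C) : 0 < Re b -> 0 < Re d -> exists K, 0 < K /\
  forall N (phi : nat -> C) M, (forall j, (j <= N)%nat -> Cmod (phi j) <= M) ->
    Cmod (csum (fun j => lam b d N j * phi j)%C (S N)) <= K * M.
Proof.
  intros Hb Hd; destruct (lam_abs_sum b d Hb Hd) as [K [HK H]]; exists K; split; auto.
  intros N phi M Hphi.
  assert (HM : 0 <= M) by (eapply Rle_trans; [apply Cmod_ge_0|apply (Hphi O); lia]).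
  eapply Rle_trans; [apply csum_norm|].
  apply Rle_trans with (rsum (fun j => M * Cmod (lam b d N j)) (S N)).
  - apply rsum_le; intros j Hj; rewrite Cmod_mult, Rmult_comm.
    apply Rmult_le_compat_r; [apply Cmod_ge_0|apply Hphi; lia].
  - rewrite rsum_scal, Rmult_comm; apply Rmult_le_compat_r; auto.
Qed.

(** Class C^{1,1} on [0, 1], with g as derivative, written as inequalities with a single constant.
    It is stable under products and is all that the convergence of [LamN] uses. *)
Definition taylor2 (f : R -> C) : Prop :=
  exists (g : R -> C) (L : R), unit_le f L /\ unit_le g L /\
    forall s t, 0 <= s <= 1 -> 0 <= t <= 1 ->
      Cmod (f s - f t - g t * RtoC (s - t)) <= L * (s - t) ^ 2.

(** Starting at [S n] avoids the sample points j / 0. *)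
Definition is_Lam (b d : C) (f : R -> C) (l : C) : Prop :=
  Clim eventually (fun n => LamN b d f (S n)) l.

(* The refinement identity is a martingale property: its two neighbours average to the
   point j/(N+1), so the first-order terms cancel and the increments are O(1/N^2). *)
Lemma Lam_exists (b d : C) (f : R -> C) : 0 < Re b -> 0 < Re d ->
  taylor2 f -> exists l, is_Lam b d f l.
Proof.
  intros Hb Hd [g [L [Hf [Hg HT]]]].
  assert (Hc : ~ nonpos_int (b + d)).
  { apply Re_pos_not_nonpos; simpl; unfold Re in *; lra. }
  destruct (lam_avg_bound b d Hb Hd) as [K [HK HB]].
  assert (HL : 0 <= L) by (eapply Rle_trans; [apply Cmod_ge_0|apply (Hf 0); lra]).
  assert (Hstep : forall n, Cmod (LamN b d f (S (S n)) - LamN b d f (S n)) <= K * L * / (INR n + 1) ^ 2).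
  { intros n. unfold LamN at 2. set (N := S n).
    rewrite (lam_refine_sum b d N (fun j => f (INR j / INR N)%R) Hc).
    unfold LamN. rewrite <- csum_minus.
    rewrite (csum_ext _ (fun j => lam b d (S N) j * (f (INR j / INR (S N))%R
       - (RtoC (INR (S N - j)) / RtoC (INR (S N)) * f (INR j / INR N)%R
          + RtoC (INR j) / RtoC (INR (S N)) * f (INR (pred j) / INR N)%R)))%C)
      by (intros; ring).
    rewrite Rmult_assoc. apply HB. intros j Hj.
    set (t := INR j / INR (S N)).
    assert (Ht : 0 <= t <= 1) by (apply unit_ratio; auto).
    assert (HN : 0 < INR N) by (apply lt_0_INR; unfold N; lia).
    assert (HSN : INR (S N) = INR N + 1) by apply S_INR.
    replace (RtoC (INR j) / RtoC (INR (S N)))%C with (RtoC t)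
      by (unfold t; rewrite RtoC_div by lra; auto).
    replace (RtoC (INR (S N - j)) / RtoC (INR (S N)))%C with (RtoC (1 - t)).
    2: { unfold t; rewrite minus_INR, <- RtoC_div by (auto; lra). f_equal; field; lra. }
    assert (Et : t * (INR N + 1) = INR j) by (unfold t; rewrite HSN; field; lra).
    (* At j = N + 1 the point j / N leaves [0, 1], but then its weight 1 - t is 0; at j = 0 the
       lower neighbour has weight t = 0. *)
    assert (Hup : RtoC (1 - t) = RtoC 0 \/ 0 <= INR j / INR N <= 1 /\ INR j / INR N - t = t / INR N).
    { destruct (Nat.eq_dec j (S N)) as [->|Hne].
      - left; f_equal. unfold t, Rdiv; rewrite Rinv_r; lra.
      - right; split; [apply unit_ratio; unfold N in *; lia|]. rewrite <- Et; field; lra. }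
    assert (Hdn : RtoC t = RtoC 0 \/ 0 <= INR (pred j) / INR N <= 1 /\
       INR (pred j) / INR N - t = - (1 - t) / INR N).
    { destruct j as [|j].
      - left; f_equal; unfold t; simpl; unfold Rdiv; ring.
      - right; simpl pred; split; [apply unit_ratio; unfold N in *; lia|].
        replace (INR j) with (t * (INR N + 1) - 1) by (rewrite Et, S_INR; ring). field; lra. }
    assert (HiN : / INR N = / (INR n + 1)) by (unfold N; rewrite S_INR; auto).
    assert (Hin : 0 < / (INR n + 1)) by (apply Rinv_0_lt_compat, INR1_pos).
    assert (B : forall (w : R) (s : R), 0 <= w <= 1 -> RtoC w = RtoC 0 \/ 0 <= s <= 1 /\ Rabs (s - t) <= / (INR n + 1) ->
      Cmod (RtoC w * (f s - f t - g t * RtoC (s - t))) <= w * (L * (/ (INR n + 1)) ^ 2)).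
    { intros w s Hw [E|[Hs1 Hs2]].
      - rewrite E, Cmult_0_l, Cmod_0. apply Rmult_le_pos; [lra|]. apply Rmult_le_pos; nra.
      - rewrite Cmod_mult, Cmod_R, Rabs_pos_eq by lra. apply Rmult_le_compat_l; [lra|].
        eapply Rle_trans; [apply HT; auto|]. apply Rmult_le_compat_l; auto.
        rewrite <- (pow2_abs (s - t)). apply pow_incr; split; auto; apply Rabs_pos. }
    assert (B1 := B (1 - t) (INR j / INR N) ltac:(lra)).
    assert (B2 := B t (INR (pred j) / INR N) ltac:(lra)).
    replace (f t - (RtoC (1 - t) * f (INR j / INR N)%R + RtoC t * f (INR (pred j) / INR N)%R))%C
      with (- (RtoC (1 - t) * (f (INR j / INR N)%R - f t - g t * RtoC (INR j / INR N - t))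
             + RtoC t * (f (INR (pred j) / INR N)%R - f t - g t * RtoC (INR (pred j) / INR N - t))))%C.
    - rewrite Cmod_opp, <- pow_inv. eapply Rle_trans; [apply Cmod_triangle|].
      replace (L * (/ (INR n + 1)) ^ 2) with
        ((1 - t) * (L * (/ (INR n + 1)) ^ 2) + t * (L * (/ (INR n + 1)) ^ 2)) by ring.
      apply Rplus_le_compat; [apply B1|apply B2].
      + destruct Hup as [E|[H1 H2]]; [left; auto|right; split; auto].
        rewrite H2. unfold Rdiv; rewrite HiN, Rabs_pos_eq; nra.
      + destruct Hdn as [E|[H1 H2]]; [left; auto|right; split; auto].
        rewrite H2. unfold Rdiv; rewrite HiN. replace (- (1 - t) * / (INR n + 1)) with (- ((1 - t) * / (INR n + 1))) by ring.
        rewrite Rabs_Ropp, Rabs_pos_eq; nra.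
    - assert (Z : (RtoC (1 - t) * RtoC (INR j / INR N - t) + RtoC t * RtoC (INR (pred j) / INR N - t))%C = RtoC 0).
      { destruct Hup as [E1|[_ E1]]; destruct Hdn as [E2|[_ E2]].
        - exfalso. rewrite E1 in *. apply RtoC_inj in E1; apply RtoC_inj in E2; lra.
        - rewrite E1, E2. apply RtoC_inj in E1. rewrite E1.
          replace (- 0 / INR N) with 0 by (field; lra). ring.
        - rewrite E1, E2. apply RtoC_inj in E2. rewrite E2.
          replace (0 / INR N) with 0 by (field; lra). ring.
        - rewrite E1, E2, <- !RtoC_mult, <- RtoC_plus. f_equal; field; lra. }
      replace (RtoC (1 - t)) with (1 - RtoC t)%C in * by (rewrite RtoC_minus; auto).
      set (P := RtoC (INR j / INR N - t)) in *. set (Q := RtoC (INR (pred j) / INR N - t)) in *.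
      transitivity (f t - ((1 - RtoC t) * f (INR j / INR N)%R + RtoC t * f (INR (pred j) / INR N)%R)
        + g t * ((1 - RtoC t) * P + RtoC t * Q))%C; [ring|]. rewrite Z; ring. }
  assert (Hs : abssum (fun n => LamN b d f (S (S n)) - LamN b d f (S n))%C).
  { apply abssum_le with (1 := Hstep).
    apply ex_series_scal_R, ex_series_inv_sq. }
  exists (LamN b d f 1 + Cser (fun n => LamN b d f (S (S n)) - LamN b d f (S n)))%C.
  apply (Clim_ext eventually) with
    (fun n => LamN b d f 1 + csum (fun n => LamN b d f (S (S n)) - LamN b d f (S n)) n)%C.
  - induction r as [|n IH]; [simpl csum; ring|].
    rewrite csum_S, Cplus_assoc, IH; ring.
  - apply (Clim_plus eventually); [apply (Clim_const eventually)|apply abssum_lim; auto].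
Qed.

Lemma taylor2_ext (f g : R -> C) : (forall t, 0 <= t <= 1 -> f t = g t) -> taylor2 f -> taylor2 g.
Proof.
  intros E [f' [L [H1 [H2 H3]]]]; exists f', L; split; [|split]; auto.
  - intros t Ht; rewrite <- E; auto.
  - intros s t Hs Ht; rewrite <- !E; auto.
Qed.

Lemma taylor2_const (c : C) : taylor2 (fun _ => c).
Proof.
  exists (fun _ => RtoC 0), (Cmod c); split; [|split].
  - intros t _; lra.
  - intros t _; rewrite Cmod_0; apply Cmod_ge_0.
  - intros s t _ _; replace (c - c - 0 * RtoC (s - t))%C with (RtoC 0) by ring.
    rewrite Cmod_0; apply Rmult_le_pos; [apply Cmod_ge_0|apply pow2_ge_0].
Qed.

Lemma taylor2_id : taylor2 RtoC.
Proof.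
  exists (fun _ => RtoC 1), 1; split; [|split].
  - intros t Ht; rewrite Cmod_R, Rabs_pos_eq; lra.
  - intros t _; rewrite Cmod_1; lra.
  - intros s t _ _; replace (RtoC s - RtoC t - 1 * RtoC (s - t))%C with (RtoC 0)
      by (rewrite RtoC_minus; ring).
    rewrite Cmod_0, Rmult_1_l; apply pow2_ge_0.
Qed.

Lemma taylor2_mult (f1 f2 : R -> C) : taylor2 f1 -> taylor2 f2 -> taylor2 (fun t => f1 t * f2 t)%C.
Proof.
  intros [g1 [L1 [A1 [B1 T1]]]] [g2 [L2 [A2 [B2 T2]]]].
  assert (P1 : 0 <= L1) by (eapply Rle_trans; [apply Cmod_ge_0|apply (A1 0); lra]).
  assert (P2 : 0 <= L2) by (eapply Rle_trans; [apply Cmod_ge_0|apply (A2 0); lra]).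
  exists (fun t => g1 t * f2 t + f1 t * g2 t)%C, (2 * L1 * L2 + (L1 + L1) * L2); split; [|split].
  - intros t Ht; rewrite Cmod_mult. assert (X := A1 t Ht); assert (Y := A2 t Ht).
    assert (Cmod (f1 t) * Cmod (f2 t) <= L1 * L2) by (apply Rmult_le_compat; auto using Cmod_ge_0).
    nra.
  - intros t Ht; eapply Rle_trans; [apply Cmod_triangle|]; rewrite !Cmod_mult.
    assert (Cmod (g1 t) * Cmod (f2 t) <= L1 * L2) by (apply Rmult_le_compat; auto using Cmod_ge_0).
    assert (Cmod (f1 t) * Cmod (g2 t) <= L1 * L2) by (apply Rmult_le_compat; auto using Cmod_ge_0).
    nra.
  - intros s t Hs Ht. assert (T1' := T1 s t Hs Ht). assert (T2' := T2 s t Hs Ht).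
    set (x := RtoC (s - t)) in *. set (e := (s - t) ^ 2) in *.
    assert (He : 0 <= e) by (unfold e; apply pow2_ge_0).
    assert (Hx : Cmod x * Cmod x = e)
      by (unfold x, e; rewrite Cmod_R, <- (pow2_abs (s - t)); ring).
    assert (Hx1 : Cmod x <= 1) by (unfold x; rewrite Cmod_R; apply Rabs_le; lra).
    assert (Hx0 := Cmod_ge_0 x).
    assert (Hdiff : Cmod (f1 s - f1 t) <= (L1 + L1) * Cmod x).
    { replace (f1 s - f1 t)%C with ((f1 s - f1 t - g1 t * x) + g1 t * x)%C by ring.
      eapply Rle_trans; [apply Cmod_triangle|]. rewrite Cmod_mult.
      assert (Cmod (g1 t) * Cmod x <= L1 * Cmod x) by (apply Rmult_le_compat_r; auto).
      assert (L1 * e <= L1 * Cmod x) by (rewrite <- Hx; apply Rmult_le_compat_l; nra). lra. }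
    replace (f1 s * f2 s - f1 t * f2 t - (g1 t * f2 t + f1 t * g2 t) * x)%C
      with (f1 s * (f2 s - f2 t - g2 t * x) + f2 t * (f1 s - f1 t - g1 t * x)
            + (f1 s - f1 t) * (g2 t * x))%C by ring.
    eapply Rle_trans; [apply Cmod_triangle|]. eapply Rle_trans; [apply Rplus_le_compat_r, Cmod_triangle|].
    rewrite !Cmod_mult.
    assert (Z1 : Cmod (f1 s) * Cmod (f2 s - f2 t - g2 t * x) <= L1 * (L2 * e))
      by (apply Rmult_le_compat; auto using Cmod_ge_0).
    assert (Z2 : Cmod (f2 t) * Cmod (f1 s - f1 t - g1 t * x) <= L2 * (L1 * e))
      by (apply Rmult_le_compat; auto using Cmod_ge_0).
    assert (Z3 : Cmod (f1 s - f1 t) * (Cmod (g2 t) * Cmod x) <= ((L1 + L1) * Cmod x) * (L2 * Cmod x)).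
    { apply Rmult_le_compat; auto using Cmod_ge_0.
      - apply Rmult_le_pos; auto using Cmod_ge_0.
      - apply Rmult_le_compat_r; auto. }
    replace ((L1 + L1) * Cmod x * (L2 * Cmod x)) with ((L1 + L1) * L2 * (Cmod x * Cmod x)) in Z3 by ring.
    rewrite Hx in Z3. lra.
Qed.

Lemma taylor2_pow (f : R -> C) k : taylor2 f -> taylor2 (fun t => f t ^ k)%C.
Proof.
  intros H; induction k as [|k IH]; [exact (taylor2_const (RtoC 1))|].
  apply taylor2_ext with (fun t => f t * f t ^ k)%C; [intros; rewrite Cpow_S; auto|].
  apply taylor2_mult; auto.
Qed.

Lemma is_Lam_bound (b d : C) : 0 < Re b -> 0 < Re d -> exists K, 0 < K /\
  (forall f M N, unit_le f M -> Cmod (LamN b d f (S N)) <= K * M) /\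
  (forall f M l, unit_le f M -> is_Lam b d f l -> Cmod l <= K * M).
Proof.
  intros Hb Hd; destruct (lam_avg_bound b d Hb Hd) as [K [HK H]]; exists K; split; auto.
  assert (B : forall f M N, unit_le f M -> Cmod (LamN b d f (S N)) <= K * M).
  { intros f M N Hf. apply H; intros j Hj; apply Hf, unit_ratio; auto. }
  split; auto. intros f M l Hf Hl.
  apply Rnot_lt_le; intros Hlt.
  destruct (Hl (Cmod l - K * M) ltac:(lra)) as [n Hn]. specialize (Hn n (le_n n)).
  assert (B' := B f M n Hf). rewrite Cmod_sub_comm in Hn.
  generalize (Cmod_triangle_rev l (LamN b d f (S n))); lra.
Qed.

Lemma Cser_csum (u : nat -> nat -> C) n : (forall j, (j < n)%nat -> abssum (u j)) ->
  abssum (fun k => csum (fun j => u j k) n) /\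
  Cser (fun k => csum (fun j => u j k) n) = csum (fun j => Cser (u j)) n.
Proof.
  induction n as [|n IH]; intros H; simpl.
  - apply (Cser_finite_supp (fun _ => RtoC 0) 0); auto.
  - destruct IH as [I1 I2]; [intros; apply H; lia|]. split.
    + apply abssum_plus; auto.
    + rewrite Cser_plus, I2; auto.
Qed.

(** Lambda commutes with normally convergent series: for each N the interchange is a finite sum of
    series, and the passage to the limit in N is dominated by K |w_k| M_k, with K the uniform bound
    on the total variation of the weights. *)
Lemma is_Lam_series (b d : C) (V : nat -> R -> C) (w mu : nat -> C) (M : nat -> R) (f : R -> C) :
  0 < Re b -> 0 < Re d ->
  (forall k, is_Lam b d (V k) (mu k)) -> (forall k, unit_le (V k) (M k)) ->
  ex_series (fun k => Cmod (w k) * M k) ->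
  (forall t, 0 <= t <= 1 -> f t = Cser (fun k => w k * V k t)%C) ->
  abssum (fun k => w k * mu k)%C /\ is_Lam b d f (Cser (fun k => w k * mu k)%C).
Proof.
  intros Hb Hd Hmu HV Hs Hf.
  destruct (is_Lam_bound b d Hb Hd) as [K [HK [B1 B2]]].
  assert (HsK : ex_series (fun k => K * (Cmod (w k) * M k)))
    by (apply ex_series_scal_R; auto).
  assert (Hdom : forall k x, Cmod x <= K * M k -> Cmod (w k * x) <= K * (Cmod (w k) * M k)).
  { intros k x Hx; rewrite Cmod_mult. replace (K * (Cmod (w k) * M k)) with (Cmod (w k) * (K * M k)) by ring.
    apply Rmult_le_compat_l; auto using Cmod_ge_0. }
  assert (HwV : forall t, 0 <= t <= 1 -> abssum (fun k => w k * V k t)%C).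
  { intros t Ht; apply abssum_le with (2 := Hs). intros k; rewrite Cmod_mult.
    apply Rmult_le_compat_l; auto using Cmod_ge_0. apply HV; auto. }
  split.
  - apply abssum_le with (2 := HsK). intros k; apply Hdom. apply (B2 (V k)); auto.
  - apply (Clim_ext eventually) with (fun n => Cser (fun k => w k * LamN b d (V k) (S n))%C).
    + intros n. unfold LamN. symmetry.
      rewrite (csum_ext _ (fun j => Cser (fun k => lam b d (S n) j * (w k * V k (INR j / INR (S n))%R)))%C).
      * destruct (Cser_csum (fun j k => lam b d (S n) j * (w k * V k (INR j / INR (S n))%R))%C (S (S n)))
          as [_ E]; [intros j Hj; apply abssum_scal, HwV, unit_ratio; lia|].
        rewrite <- E. apply Cser_ext; intros k. rewrite <- csum_scal. apply csum_ext; intros; ring.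
      * intros j Hj. rewrite Hf by (apply unit_ratio; lia). rewrite Cser_scal; auto.
        apply HwV, unit_ratio; lia.
    + apply (Clim_Cser eventually) with (M := fun k => K * (Cmod (w k) * M k)); auto.
      * apply filter_forall; intros n k; apply Hdom, B1; auto.
      * intros k; apply Hdom. apply (B2 (V k)); auto.
      * intros k; apply (Clim_scal eventually), Hmu.
Qed.

Lemma pow_Lip (k : nat) (u v : R) : 0 <= u <= 1 -> 0 <= v <= 1 ->
  Rabs (u ^ k - v ^ k) <= INR k * Rabs (u - v).
Proof.
  intros Hu Hv; induction k as [|k IH]; [simpl; rewrite Rminus_diag, Rabs_R0; lra|].
  rewrite S_INR; simpl.
  replace (u * u ^ k - v * v ^ k) with (u * (u ^ k - v ^ k) + v ^ k * (u - v)) by ring.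
  eapply Rle_trans; [apply Rabs_triang|]; rewrite !Rabs_mult, (Rabs_pos_eq u) by lra.
  assert (0 <= v ^ k <= 1).
  { split; [apply pow_le; lra|]. rewrite <- (pow1 k); apply pow_incr; lra. }
  rewrite (Rabs_pos_eq (v ^ k)) by lra.
  assert (H1 := Rabs_pos (u ^ k - v ^ k)). assert (H2 := Rabs_pos (u - v)). nra.
Qed.

Lemma Clim_eventually_unshift (u : nat -> C) (l : C) :
  Clim eventually (fun n => u (S n)) l -> Clim eventually u l.
Proof.
  intros H e He; destruct (H e He) as [N HN]; exists (S N); intros [|n] Hn; [lia|].
  apply HN; lia.
Qed.

(** Size bias: (j + 1) / (N + 1) times the weight of j + 1 for (b, d, N + 1) is b / (b + d) times
    the weight of j for (b + 1, d, N). This trades one power of t for a step from b to b + 1, hence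
    the induction with b free. The arguments (j + 1) / (N + 1) and j / N differ by O(1/N). *)
Lemma is_Lam_moment (b d : C) k : 0 < Re b -> 0 < Re d ->
  is_Lam b d (fun t => RtoC (t ^ k)) (poch b k / poch (b + d) k)%C.
Proof.
  intros Hb Hd; revert b Hb; induction k as [|k IH]; intros b Hb.
  - assert (Hc : ~ nonpos_int (b + d)) by (apply Re_pos_not_nonpos; simpl; unfold Re in *; lra).
    apply (Clim_ext eventually) with (fun _ => RtoC 1).
    + intros n. rewrite <- (lam_sum b d (S n) Hc). apply csum_ext; intros; simpl; ring.
    + replace (poch b 0 / poch (b + d) 0)%C with (RtoC 1) by (simpl; field). apply (Clim_const eventually).
  - assert (Hb1 : 0 < Re (b + 1)) by (simpl; unfold Re in *; lra).
    assert (Hc : ~ nonpos_int (b + d)) by (apply Re_pos_not_nonpos; simpl; unfold Re in *; lra).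
    assert (Hc1 : ~ nonpos_int (b + d + 1)) by (apply Re_pos_not_nonpos; simpl; unfold Re in *; lra).
    assert (Hc0 : (b + d)%C <> RtoC 0).
    { intros E; apply Hc; exists O; rewrite E; simpl; f_equal; ring. }
    specialize (IH (b + 1)%C Hb1). replace (b + 1 + d)%C with (b + d + 1)%C in IH by ring.
    rewrite !poch_S_l. 
    replace (b * poch (b + 1) k / ((b + d) * poch (b + d + 1) k))%C
      with (b / (b + d) * (poch (b + 1) k / poch (b + d + 1) k))%C
      by (field; split; auto; apply poch_neq_0; auto).
    destruct (lam_avg_bound (b + 1) d Hb1 Hd) as [K [HK HB]].
    assert (E : forall N, LamN b d (fun t => RtoC (t ^ S k)) (S N) =
      (b / (b + d) * csum (fun j => lam (b + 1) d N j * RtoC ((INR (S j) / INR (S N)) ^ k)) (S N))%C).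
    { intros N. unfold LamN. rewrite csum_S_l, <- csum_scal.
      replace (INR 0 / INR (S N)) with 0 by (simpl; unfold Rdiv; ring).
      rewrite pow_i, Cmult_0_r, Cplus_0_l by lia.
      apply csum_ext; intros j Hj. rewrite <- tech_pow_Rmult.
      assert (HN : INR (S N) <> 0) by (apply not_0_INR; lia).
      rewrite RtoC_mult, RtoC_div by auto. set (X := RtoC ((INR (S j) / INR (S N)) ^ k)).
      unfold lam. rewrite Nat.sub_succ. assert (E1 := bcoef_S_l b j). assert (E2 := bcoef_S_l (b + d) N).
      replace (b + 1 + d)%C with (b + d + 1)%C by ring.
      assert (HN' := RtoC_neq_0 _ HN).
      assert (Hq := bcoef_neq_0 _ (S N) Hc). assert (Hq1 := bcoef_neq_0 _ N Hc1).
      transitivity ((RtoC (INR (S j)) * bcoef b (S j)) * bcoef d (N - j)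
        / (RtoC (INR (S N)) * bcoef (b + d) (S N)) * X)%C; [field; auto|].
      rewrite E1, E2. field; auto. }
    apply Clim_eventually_unshift.
    apply (Clim_ext eventually) with (1 := fun n => eq_sym (E (S n))).
    apply (Clim_scal eventually).
    apply (Clim_close eventually) with (2 := IH).
    apply (small_le eventually) with (fun n => K * INR k * / (INR n + 1)).
    + apply filter_forall; intros n. unfold LamN. rewrite <- csum_minus.
      set (N := S n).
      rewrite (csum_ext _ (fun j => lam (b + 1) d N j *
         RtoC ((INR (S j) / INR (S N)) ^ k - (INR j / INR N) ^ k))%C)
        by (intros; rewrite RtoC_minus; ring).
      rewrite Rmult_assoc. apply HB. intros j Hj.
      rewrite Cmod_R. eapply Rle_trans; [apply pow_Lip; apply unit_ratio; unfold N in *; lia|].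
      apply Rmult_le_compat_l; [apply pos_INR|].
      assert (Hn := INR1_pos n). assert (HjN := le_INR _ _ Hj).
      unfold N in *. rewrite !S_INR in *. assert (Hj0 := pos_INR j).
      replace ((INR j + 1) / (INR n + 1 + 1) - INR j / (INR n + 1))
        with ((1 - INR j / (INR n + 1)) * / (INR n + 1 + 1)) by (field; lra).
      assert (Hr : 0 <= INR j / (INR n + 1) <= 1).
      { rewrite <- S_INR; apply unit_ratio; lia. }
      assert (I1 := Rinv_0_lt_compat (INR n + 1 + 1) ltac:(lra)).
      assert (I2 : / (INR n + 1 + 1) <= / (INR n + 1)) by (apply Rinv_le_contravar; lra).
      rewrite Rabs_pos_eq; nra.
    + apply (small_scal eventually); [apply Rmult_le_pos; [lra|apply pos_INR]|].
      intros e He. assert (H := is_lim_seq_inv_INR1). apply is_lim_seq_spec in H.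
      destruct (H (mkposreal e He)) as [N0 HN0]; exists N0; intros n Hn.
      specialize (HN0 n Hn); simpl in HN0. apply Rabs_def2 in HN0; lra.
Qed.

(** The reflection of j to N - j exchanges b and d. *)
Lemma is_Lam_moment_r (b d : C) k : 0 < Re b -> 0 < Re d ->
  is_Lam b d (fun t => RtoC ((1 - t) ^ k)) (poch d k / poch (b + d) k)%C.
Proof.
  intros Hb Hd. assert (H := is_Lam_moment d b k Hd Hb).
  replace (d + b)%C with (b + d)%C in H by ring.
  apply (Clim_ext eventually) with (2 := H). intros n.
  unfold LamN. rewrite <- (csum_rev _ (S (S n))). apply csum_ext; intros j Hj.
  unfold lam. replace (S (S n) - S j)%nat with (S n - j)%nat by lia.
  replace (S n - (S n - j))%nat with j by lia.
  replace (d + b)%C with (b + d)%C by ring.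
  replace (1 - INR j / INR (S n)) with (INR (S n - j) / INR (S n)).
  - unfold Cdiv; ring.
  - rewrite minus_INR by lia. field. apply not_0_INR; lia.
Qed.

(** * The Gauss function on the slit plane *)

Lemma acos_decr_lt (x y : R) : -1 <= x -> x < y -> y <= 1 -> acos y < acos x.
Proof.
  intros Hx Hxy Hy. apply Rnot_le_lt; intros H.
  destruct (acos_bound x), (acos_bound y).
  apply cos_decr_1 in H; auto. rewrite !cos_acos in H; lra.
Qed.

Lemma acos_decr_le (x y : R) : -1 <= x -> x <= y -> y <= 1 -> acos y <= acos x.
Proof. intros Hx [H|H] Hy; [left; apply acos_decr_lt; auto|rewrite H; lra]. Qed.

(** The first cone is |arg v| <= PI - acos k, the second is |arg u| < acos k. *)
Lemma Carg_sum_lt (k : R) (v u : C) :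
  0 <= k <= 1 -> v <> RtoC 0 -> u <> RtoC 0 -> - k * Cmod v <= Re v -> k * Cmod u < Re u ->
  Rabs (Carg v) + Rabs (Carg u) < PI.
Proof.
  intros Hk Hv Hu H1 H2. rewrite !Carg_abs.
  assert (Pv := proj1 (Cmod_gt_0 v) Hv); assert (Pu := proj1 (Cmod_gt_0 u) Hu).
  destruct (Cmod_ratio v Hv), (Cmod_ratio u Hu).
  assert (A1 : acos (Re v / Cmod v) <= acos (- k)).
  { apply acos_decr_le; auto; [lra|]. apply Rmult_le_reg_r with (Cmod v); auto.
    unfold Rdiv; rewrite Rmult_assoc, Rinv_l; lra. }
  assert (A2 : acos (Re u / Cmod u) < acos k).
  { apply acos_decr_lt; auto; [lra|]. apply Rmult_lt_reg_r with (Cmod u); auto.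
    unfold Rdiv; rewrite Rmult_assoc, Rinv_l; lra. }
  rewrite acos_opp in A1. lra.
Qed.

(** The segment from 1 to 1 - z stays in one cone around the positive axis that misses the negative
    axis. Here k is minus the cosine of [Carg] (1 - z), or 0 if that is negative; only points with
    negative real part need an argument. *)
Lemma slit_cone (z : C) : slit_plane z ->
  exists k, 0 <= k < 1 /\ forall t, 0 <= t <= 1 ->
    - k * Cmod (1 - z * RtoC t) <= Re (1 - z * RtoC t).
Proof.
  intros [Hz1 Harg]. set (v := (1 - z)%C) in *.
  assert (Hv : v <> RtoC 0).
  { intros E; apply Hz1; replace z with (1 - v)%C by (unfold v; ring); rewrite E; ring. }
  assert (Pv := proj1 (Cmod_gt_0 v) Hv).
  set (c := Re v / Cmod v).
  assert (Hc : -1 < c <= 1).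
  { destruct (Cmod_ratio v Hv) as [[Hlt|Heq] H2]; [unfold c; lra|].
    exfalso. rewrite Carg_abs, <- Heq in Harg.
    replace (-1) with (- (1)) in Harg by ring. rewrite acos_opp, acos_1 in Harg; lra. }
  assert (Hcv : Re v = c * Cmod v) by (unfold c; field; lra).
  exists (Rmax 0 (- c)). 
  assert (Hk1 := Rmax_l 0 (- c)). assert (Hk2 := Rmax_r 0 (- c)).
  assert (Hk3 : Rmax 0 (- c) < 1) by (apply Rmax_lub_lt; lra).
  set (k := Rmax 0 (- c)) in *. split; [lra|]. intros t Ht.
  set (u := (1 - z * RtoC t)%C).
  assert (Er : Re u = (1 - t) + t * Re v) by (unfold u, v; simpl; unfold Re; ring).
  assert (Ei : Im u = t * Im v) by (unfold u, v; simpl; unfold Im; ring).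
  assert (Mu := Cmod2_alt u). assert (Mv := Cmod2_alt v). assert (Hu0 := Cmod_ge_0 u).
  destruct (Rle_lt_dec 0 (Re u)) as [Hp|Hn]; [nra|].
  apply Ropp_le_cancel. replace (- (- k * Cmod u)) with (k * Cmod u) by ring.
  assert (Hrv : Re v < 0) by nra.
  assert (Hsq : Re v ^ 2 <= k ^ 2 * Cmod v ^ 2).
  { assert (0 <= - Re v <= k * Cmod v) by nra.
    replace (Re v ^ 2) with ((- Re v) ^ 2) by ring. rewrite <- Rpow_mult_distr. apply pow_incr; auto. }
  assert (Hsq2 : (1 - k ^ 2) * Re v ^ 2 <= k ^ 2 * Im v ^ 2) by nra.
  assert (Hru : Re u ^ 2 <= t ^ 2 * Re v ^ 2).
  { replace (Re u ^ 2) with ((- Re u) ^ 2) by ring. rewrite <- Rpow_mult_distr.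
    replace ((t * Re v) ^ 2) with ((- (t * Re v)) ^ 2) by ring. apply pow_incr; lra. }
  assert (Hk4 : 0 <= 1 - k ^ 2) by nra.
  assert (Hfin : Re u ^ 2 <= (k * Cmod u) ^ 2).
  { rewrite Rpow_mult_distr, Mu.
    enough ((1 - k ^ 2) * Re u ^ 2 <= k ^ 2 * Im u ^ 2) by lra.
    rewrite Ei. apply Rle_trans with (t ^ 2 * ((1 - k ^ 2) * Re v ^ 2)).
    - replace (t ^ 2 * ((1 - k ^ 2) * Re v ^ 2)) with ((1 - k ^ 2) * (t ^ 2 * Re v ^ 2)) by ring.
      apply Rmult_le_compat_l; auto.
    - replace (k ^ 2 * (t * Im v) ^ 2) with (t ^ 2 * (k ^ 2 * Im v ^ 2)) by ring.
      apply Rmult_le_compat_l; auto. apply pow2_ge_0. }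
  apply Rsqr_incr_0_var; [unfold Rsqr; lra|]. apply Rmult_le_pos; lra.
Qed.

(** With v = 1 - z, r = |v| and Re v >= - k r, the square |1 - t + t v|^2 is at least (1 - k) ((1 -
    t)^2 + t^2 r^2), by 2 t (1 - t) r <= (1 - t)^2 + t^2 r^2. The last sum has minimum r^2 / (1 +
    r^2) over t. *)
Lemma slit_away (z : C) : slit_plane z ->
  exists m, 0 < m /\ forall t, 0 <= t <= 1 -> m <= Cmod (1 - z * RtoC t).
Proof.
  intros Hs. destruct (slit_cone z Hs) as [k [Hk H]]. destruct Hs as [Hz1 _].
  assert (H1 := H 1 ltac:(lra)). rewrite Cmult_1_r in H1.
  set (v := (1 - z)%C) in *. set (r := Cmod v) in *.
  assert (Hr : 0 < r).
  { apply Cmod_gt_0; intros E; apply Hz1; replace z with (1 - v)%C by (unfold v; ring). rewrite E; ring. }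
  set (m2 := (1 - k) * (r ^ 2 / (1 + r ^ 2))).
  assert (Hm2 : 0 < m2).
  { apply Rmult_lt_0_compat; [lra|]. apply Rdiv_lt_0_compat; nra. }
  exists (sqrt m2); split; [apply sqrt_lt_R0; auto|]. intros t Ht.
  set (u := (1 - z * RtoC t)%C).
  assert (Er : Re u = (1 - t) + t * Re v) by (unfold u, v; simpl; unfold Re; ring).
  assert (Ei : Im u = t * Im v) by (unfold u, v; simpl; unfold Im; ring).
  assert (Mu := Cmod2_alt u). assert (Mv := Cmod2_alt v). fold r in Mv.
  rewrite <- (sqrt_pow2 (Cmod u)) by apply Cmod_ge_0.
  apply sqrt_le_1_alt. rewrite Mu, Er, Ei. unfold m2.
  apply Rle_trans with ((1 - k) * ((1 - t) ^ 2 + t ^ 2 * r ^ 2)).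
  - apply Rmult_le_compat_l; [lra|].
    apply Rmult_le_reg_r with (1 + r ^ 2); [nra|]. unfold Rdiv; rewrite Rmult_assoc, Rinv_l by nra.
    replace (((1 - t) ^ 2 + t ^ 2 * r ^ 2) * (1 + r ^ 2)) with
      (r ^ 2 * 1 + ((1 - t) - t * r ^ 2) ^ 2) by ring.
    assert (Hq := pow2_ge_0 (1 - t - t * r ^ 2)). lra.
  - replace ((1 - t + t * Re v) ^ 2 + (t * Im v) ^ 2)
      with ((1 - t) ^ 2 + t ^ 2 * r ^ 2 + 2 * (t * (1 - t)) * Re v) by (rewrite Mv; ring).
    assert (Hc : 2 * (t * (1 - t)) * (- k * r) <= 2 * (t * (1 - t)) * Re v)
      by (apply Rmult_le_compat_l; nra).
    assert (Hc2 : 0 <= k * ((1 - t) - t * r) ^ 2) by (apply Rmult_le_pos; [lra|apply pow2_ge_0]).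
    nra.
Qed.

Lemma Re_one_minus_ratio (k : R) (h : C) :
  0 <= k < 1 -> Cmod h <= (1 - k) / 4 -> k * Cmod (1 - h) < Re (1 - h).
Proof.
  intros Hk Hh. assert (H1 := re_le_Cmod h). apply Rabs_le_between in H1.
  assert (H2 : Cmod (1 - h) <= 1 + Cmod h).
  { eapply Rle_trans; [apply Cmod_triangle_sub|rewrite Cmod_1; lra]. }
  replace (Re (1 - h)%C) with (1 - Re h) by (simpl; unfold Re; ring). nra.
Qed.

(** For |h| <= (1 - k) / 4 the point 1 - h lies in the cone complementary to the one of [slit_cone],
    so principal powers are multiplicative with a radius that does not depend on t. *)
Lemma slit_local (z : C) : slit_plane z ->
  exists m r, 0 < m /\ 0 < r <= / 4 /\ forall t, 0 <= t <= 1 ->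
    m <= Cmod (1 - z * RtoC t) /\
    forall h s, Cmod h <= r ->
      Cpower ((1 - z * RtoC t) * (1 - h)) s = (Cpower (1 - z * RtoC t) s * Cpower (1 - h) s)%C.
Proof.
  intros Hs. destruct (slit_cone z Hs) as [k [Hk Hc]]. destruct (slit_away z Hs) as [m [Hm Ha]].
  exists m, ((1 - k) / 4); split; auto. split; [lra|]. intros t Ht; split; auto.
  intros h s Hh.
  assert (Hv : (1 - z * RtoC t)%C <> RtoC 0).
  { apply Cmod_gt_0; apply Rlt_le_trans with m; auto. }
  assert (Hu : (1 - h)%C <> RtoC 0).
  { intros E. assert (H := Re_one_minus_ratio k h Hk Hh). rewrite E, Cmod_0 in H; simpl in H; lra. }
  apply Cpower_mult; auto. apply Carg_sum_lt with k; auto; [lra|].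
  apply Re_one_minus_ratio; auto.
Qed.

Lemma Cmod_Cpower_le (v s : C) (m M : R) :
  0 < m -> m <= Cmod v <= M ->
  Cmod (Cpower v s) <= exp (Rabs (Re s) * (Rabs (ln m) + Rabs (ln M)) + Rabs (Im s) * PI).
Proof.
  intros Hm Hv. unfold Cpower. rewrite Cmod_Cexp. apply exp_mono.
  replace (Re (s * Clog v)%C) with (Re s * ln (Cmod v) - Im s * Carg v) by (simpl; unfold Re, Im; ring).
  assert (L1 : ln m <= ln (Cmod v)) by (apply ln_le; lra).
  assert (L2 : ln (Cmod v) <= ln M) by (apply ln_le; lra).
  assert (La : Rabs (ln (Cmod v)) <= Rabs (ln m) + Rabs (ln M)).
  { apply Rabs_le. generalize (Rle_abs (ln m)) (Rle_abs (- ln m)) (Rle_abs (ln M)) (Rle_abs (- ln M))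
      (Rabs_pos (ln m)) (Rabs_pos (ln M)). rewrite !Rabs_Ropp. lra. }
  assert (Pa : Rabs (Carg v) <= PI) by (rewrite Carg_abs; apply acos_bound).
  eapply Rle_trans; [apply Rle_abs|]. eapply Rle_trans; [apply Rabs_triang|].
  rewrite Rabs_Ropp, !Rabs_mult.
  apply Rplus_le_compat; apply Rmult_le_compat_l; auto using Rabs_pos.
Qed.

Lemma Cpower_1m_bound (A : C) : exists K, 0 <= K /\ forall h, Cmod h <= / 4 ->
  Cmod (Cpower (1 - h) (- A) - 1 - A * h) <= K * Cmod h ^ 2.
Proof.
  set (q := RtoC (/ 4)).
  assert (Hq : Cmod q = / 4) by (unfold q; rewrite Cmod_R, Rabs_pos_eq; lra).
  assert (Hs : forall h, Cmod h <= / 4 -> abssum (fun n => bcoef A n * h ^ n)%C)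
    by (intros; apply abssum_binom; lra).
  assert (Hs2 : ex_series (fun k => Cmod (bcoef A (2 + k)) * (/ 4) ^ k)).
  { assert (E : forall k, 16 * Cmod (bcoef A (2 + k) * q ^ (2 + k)) = Cmod (bcoef A (2 + k)) * (/ 4) ^ k).
    { intros k; rewrite Cmod_mult, Cmod_pow, Hq, pow_add. simpl (_ ^ 2). field. }
    apply ex_series_ext with (1 := E).
    apply ex_series_scal_R. apply (abssum_shift (fun n => bcoef A n * q ^ n)%C 2), Hs. lra. }
  exists (Series (fun k => Cmod (bcoef A (2 + k)) * (/ 4) ^ k)); split.
  - apply Series_pos; auto. intros; apply Rmult_le_pos; [apply Cmod_ge_0|apply pow_le; lra].
  - intros h Hh. rewrite binomial_series by lra. rewrite (Cser_split _ 2 (Hs h Hh)). simpl csum.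
    replace (_ - 1 - A * h)%C with (Cser (fun k => bcoef A (2 + k) * h ^ (2 + k))%C)
      by (unfold bcoef; simpl; field).
    eapply Rle_trans; [apply Cser_norm, (abssum_shift (fun n => bcoef A n * h ^ n)%C 2), Hs; auto|].
    rewrite Rmult_comm, <- Series_scal_l. apply Series_le.
    + intros k; split; [apply Cmod_ge_0|]. rewrite Cmod_mult, Cmod_pow, pow_add.
      replace (Cmod (bcoef A (2 + k)) * (Cmod h ^ 2 * Cmod h ^ k))
        with (Cmod h ^ 2 * (Cmod (bcoef A (2 + k)) * Cmod h ^ k)) by ring.
      apply Rmult_le_compat_l; [apply pow2_ge_0|]. apply Rmult_le_compat_l; [apply Cmod_ge_0|].
      apply pow_incr; split; auto using Cmod_ge_0.
    + apply ex_series_scal_R; auto.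
Qed.

Lemma Cmod_1_zt (z : C) t : 0 <= t <= 1 -> Cmod (1 - z * RtoC t) <= 1 + Cmod z.
Proof.
  intros Ht; eapply Rle_trans; [apply Cmod_triangle_sub|].
  rewrite Cmod_1, Cmod_mult, Cmod_R, Rabs_pos_eq by lra. assert (H := Cmod_ge_0 z); nra.
Qed.

Lemma taylor2_inv_seg (z : C) : slit_plane z -> taylor2 (fun t => / (1 - z * RtoC t))%C.
Proof.
  intros Hs; destruct (slit_away z Hs) as [m [Hm Ha]].
  assert (Hz := Cmod_ge_0 z). assert (Him := Rinv_0_lt_compat _ Hm).
  assert (Hv : forall t, 0 <= t <= 1 -> (1 - z * RtoC t)%C <> RtoC 0).
  { intros t Ht; apply Cmod_gt_0; apply Rlt_le_trans with m; auto. }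
  assert (Hi : forall t, 0 <= t <= 1 -> Cmod (/ (1 - z * RtoC t)) <= / m).
  { intros t Ht; rewrite Cmod_inv by auto. apply Rinv_le_contravar; auto. }
  set (L := / m + Cmod z * (/ m * / m) + Cmod z ^ 2 * (/ m * / m * / m)).
  assert (H1 : 0 <= Cmod z * (/ m * / m)) by (apply Rmult_le_pos; nra).
  assert (H2 : 0 <= Cmod z ^ 2 * (/ m * / m * / m)).
  { apply Rmult_le_pos; [apply pow2_ge_0|]. apply Rmult_le_pos; nra. }
  exists (fun t => z * (/ (1 - z * RtoC t) * / (1 - z * RtoC t)))%C, L; split; [|split].
  - intros t Ht; specialize (Hi t Ht); unfold L; lra.
  - intros t Ht; rewrite !Cmod_mult. specialize (Hi t Ht).
    assert (Cmod (/ (1 - z * RtoC t)) * Cmod (/ (1 - z * RtoC t)) <= / m * / m)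
      by (apply Rmult_le_compat; auto using Cmod_ge_0).
    apply Rle_trans with (Cmod z * (/ m * / m)); [apply Rmult_le_compat_l; auto|unfold L; lra].
  - intros s t Hs' Ht.
    replace (/ (1 - z * RtoC s) - / (1 - z * RtoC t)
       - z * (/ (1 - z * RtoC t) * / (1 - z * RtoC t)) * RtoC (s - t))%C
     with (z * z * (/ (1 - z * RtoC s) * / (1 - z * RtoC t) * / (1 - z * RtoC t))
        * (RtoC (s - t) * RtoC (s - t)))%C
     by (rewrite RtoC_minus; field; auto).
    rewrite !Cmod_mult, !Cmod_R, <- Rabs_mult.
    replace ((s - t) * (s - t)) with ((s - t) ^ 2) by ring.
    rewrite (Rabs_pos_eq ((s - t) ^ 2)) by apply pow2_ge_0.
    apply Rmult_le_compat_r; [apply pow2_ge_0|].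
    apply Rle_trans with (Cmod z ^ 2 * (/ m * / m * / m)); [|unfold L; lra].
    replace (Cmod z ^ 2) with (Cmod z * Cmod z) by ring.
    apply Rmult_le_compat_l; [nra|].
    assert (G := Cmod_ge_0 (/ (1 - z * RtoC t))). assert (G' := Cmod_ge_0 (/ (1 - z * RtoC s))).
    apply Rmult_le_compat; auto; [apply Rmult_le_pos; auto|]. apply Rmult_le_compat; auto.
Qed.

(** Write 1 - z s = (1 - z t) (1 - h). If |h| <= r the power factors and [Cpower_1m_bound] gives a
    remainder of order |h|^2. If |h| > r then (s - t)^2 is bounded below, so the three bounded terms
    are trivially O((s - t)^2). *)
Lemma taylor2_Cpower_seg (z A : C) : slit_plane z -> taylor2 (fun t => Cpower (1 - z * RtoC t) (- A)).
Proof.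
  intros Hs. destruct (slit_local z Hs) as [m [r [Hm [Hr Hloc]]]].
  destruct (Cpower_1m_bound A) as [K [HK HB]].
  assert (Hz := Cmod_ge_0 z). assert (HA := Cmod_ge_0 A). assert (Him := Rinv_0_lt_compat _ Hm).
  assert (Hv : forall t, 0 <= t <= 1 -> (1 - z * RtoC t)%C <> RtoC 0).
  { intros t Ht; apply Cmod_gt_0; apply Rlt_le_trans with m; auto. apply Hloc; auto. }
  set (B := exp (Rabs (Re (- A)) * (Rabs (ln m) + Rabs (ln (1 + Cmod z))) + Rabs (Im (- A)) * PI)).
  assert (HBp : 0 < B) by apply exp_pos.
  assert (HP : forall t, 0 <= t <= 1 -> Cmod (Cpower (1 - z * RtoC t) (- A)) <= B).
  { intros t Ht; apply Cmod_Cpower_le; auto. split; [apply Hloc|apply Cmod_1_zt]; auto. }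
  set (G := Cmod A * (Cmod z * / m) * B).
  assert (HG : 0 <= G) by (unfold G; apply Rmult_le_pos; [apply Rmult_le_pos; auto; nra|lra]).
  set (Q := (Cmod z * / m) ^ 2).
  assert (HQ : 0 <= Q) by apply pow2_ge_0.
  assert (Hir : 0 < / r ^ 2) by (apply Rinv_0_lt_compat; nra).
  assert (HBKQ : 0 <= B * K * Q) by (apply Rmult_le_pos; auto; nra).
  assert (HX : 0 <= (B + B + G) * / r ^ 2 * Q).
  { apply Rmult_le_pos; auto. apply Rmult_le_pos; lra. }
  assert (Hiv : forall t, 0 <= t <= 1 -> Cmod (/ (1 - z * RtoC t)) <= / m).
  { intros t Ht; rewrite Cmod_inv by auto. apply Rinv_le_contravar; auto. apply Hloc; auto. }
  set (g := fun t => (A * (z * / (1 - z * RtoC t)) * Cpower (1 - z * RtoC t) (- A))%C).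
  assert (Hg : forall t, 0 <= t <= 1 -> Cmod (g t) <= G).
  { intros t Ht; unfold g, G; rewrite !Cmod_mult.
    apply Rmult_le_compat; auto using Cmod_ge_0.
    - apply Rmult_le_pos; auto. apply Rmult_le_pos; auto using Cmod_ge_0.
    - apply Rmult_le_compat_l; auto. apply Rmult_le_compat_l; auto. }
  exists g, (B + G + B * K * Q + (B + B + G) * / r ^ 2 * Q); split; [|split].
  - intros t Ht; specialize (HP t Ht); lra.
  - intros t Ht; specialize (Hg t Ht); lra.
  - intros s t Hs' Ht. set (h := (z * RtoC (s - t) * / (1 - z * RtoC t))%C).
    assert (Hsq : 0 <= (s - t) ^ 2) by apply pow2_ge_0.
    assert (Hh : Cmod h <= (Cmod z * / m) * Rabs (s - t)).
    { unfold h; rewrite !Cmod_mult, Cmod_R.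
      replace (Cmod z * / m * Rabs (s - t)) with (Cmod z * Rabs (s - t) * / m) by ring.
      apply Rmult_le_compat_l; auto. apply Rmult_le_pos; auto using Rabs_pos. }
    assert (Hh2 : Cmod h ^ 2 <= Q * (s - t) ^ 2).
    { unfold Q. rewrite <- (pow2_abs (s - t)), <- Rpow_mult_distr.
      apply pow_incr; split; auto using Cmod_ge_0. }
    destruct (Rle_lt_dec (Cmod h) r) as [Hle|Hlt].
    + assert (Ef : (Cpower (1 - z * RtoC s) (- A) = Cpower (1 - z * RtoC t) (- A) * Cpower (1 - h) (- A))%C).
      { rewrite <- (proj2 (Hloc t Ht)) by auto. f_equal. unfold h; rewrite RtoC_minus; field; auto. }
      rewrite Ef.
      replace (_ - _ - g t * RtoC (s - t))%C
        with (Cpower (1 - z * RtoC t) (- A) * (Cpower (1 - h) (- A) - 1 - A * h))%C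
        by (unfold g, h; ring).
      rewrite Cmod_mult. apply Rle_trans with (B * (K * Cmod h ^ 2)).
      * apply Rmult_le_compat; auto using Cmod_ge_0. apply HB; lra.
      * apply Rle_trans with (B * K * (Q * (s - t) ^ 2)).
        -- rewrite <- Rmult_assoc. apply Rmult_le_compat_l; auto. nra.
        -- nra.
    + assert (H1 : 1 <= / r ^ 2 * Q * (s - t) ^ 2).
      { apply Rmult_le_reg_l with (r ^ 2); [nra|].
        replace (r ^ 2 * (/ r ^ 2 * Q * (s - t) ^ 2)) with (Q * (s - t) ^ 2) by (field; lra).
        apply Rle_trans with (Cmod h ^ 2); auto. rewrite Rmult_1_r. apply pow_incr; lra. }
      apply Rle_trans with (B + B + G).
      * eapply Rle_trans; [apply Cmod_triangle_sub|]. apply Rplus_le_compat.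
        -- eapply Rle_trans; [apply Cmod_triangle_sub|]. apply Rplus_le_compat; auto.
        -- rewrite Cmod_mult, Cmod_R. rewrite <- (Rmult_1_r G).
           apply Rmult_le_compat; auto using Cmod_ge_0, Rabs_pos; try (apply Rabs_le; lra).
      * apply Rle_trans with ((B + B + G) * (/ r ^ 2 * Q * (s - t) ^ 2)); [nra|].
        replace ((B + B + G) * (/ r ^ 2 * Q * (s - t) ^ 2)) with ((B + B + G) * / r ^ 2 * Q * (s - t) ^ 2) by ring.
        apply Rmult_le_compat_r; auto. lra.
Qed.

Definition F21 (A b c z : C) : C :=
  CLim (fun n => LamN b (c - b) (fun t => Cpower (1 - z * RtoC t) (- A)) (S n)).

Lemma F21_unique (A b c z l : C) :
  is_Lam b (c - b) (fun t => Cpower (1 - z * RtoC t) (- A)) l -> F21 A b c z = l.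
Proof. apply CLim_Clim. Qed.

Lemma pow_n_Cpow (z : C) k : pow_n (K := C_Ring) z k = (z ^ k)%C.
Proof. induction k as [|k IH]; simpl; [|rewrite <- IH]; reflexivity. Qed.

Lemma is_pseries_Cser (u : nat -> C) (z : C) :
  abssum (fun k => u k * z ^ k)%C ->
  is_pseries (K := C_AbsRing) (V := C_NormedModule) u z (Cser (fun k => u k * z ^ k)%C).
Proof.
  intros H. unfold is_pseries. apply is_series_ext with (2 := is_series_Cser _ H).
  intros k. rewrite Cmult_comm, <- pow_n_Cpow. reflexivity.
Qed.

Lemma is_pseries_Clim (u : nat -> C) (z l : C) :
  is_pseries (K := C_AbsRing) (V := C_NormedModule) u z l ->
  Clim eventually (csum (fun k => u k * z ^ k)%C) l.
Proof.
  intros H. apply is_series_Clim. unfold is_pseries in H.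
  apply is_series_ext with (2 := H).
  intros k. rewrite Cmult_comm, <- pow_n_Cpow. reflexivity.
Qed.

Lemma F21_disc (A b c z : C) : 0 < Re b -> Re b < Re c -> Cmod z < 1 ->
  is_pseries (K := C_AbsRing) (V := C_NormedModule) (hyp2F1_coef A b c) z (F21 A b c z).
Proof.
  intros Hb Hbc Hz.
  assert (Hd : 0 < Re (c - b)) by (simpl; unfold Re in *; lra).
  assert (Hc : ~ nonpos_int c) by (apply Re_pos_not_nonpos; lra).
  destruct (is_Lam_series b (c - b) (fun k t => RtoC (t ^ k)) (fun k => bcoef A k * z ^ k)%C
    (fun k => poch b k / poch (b + (c - b)) k)%C (fun _ => 1)
    (fun t => Cpower (1 - z * RtoC t) (- A))) as [H1 H2]; auto.
  - intros k; apply is_Lam_moment; auto.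
  - intros k t Ht; rewrite Cmod_R, Rabs_pos_eq by (apply pow_le; lra).
    rewrite <- (pow1 k); apply pow_incr; lra.
  - apply ex_series_ext with (2 := abssum_binom A z Hz). intros; rewrite Rmult_1_r; auto.
  - intros t Ht. rewrite binomial_series.
    + apply Cser_ext; intros k. rewrite Cpow_mult_l, RtoC_pow; ring.
    + rewrite Cmod_mult, Cmod_R, Rabs_pos_eq by lra. assert (H := Cmod_ge_0 z); nra.
  - rewrite (F21_unique _ _ _ _ _ H2).
    assert (E : forall k, (bcoef A k * z ^ k * (poch b k / poch (b + (c - b)) k) = hyp2F1_coef A b c k * z ^ k)%C).
    { intros k. replace (b + (c - b))%C with c by ring. unfold bcoef, hyp2F1_coef.
      field; split; [apply RtoC_fact_neq_0|apply poch_neq_0; auto]. }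
    rewrite (Cser_ext _ _ E). apply is_pseries_Cser. apply abssum_ext with (1 := E); auto.
Qed.

(** Around z0, write 1 - z t = (1 - z0 t) (1 - h) with h = (z - z0) t / (1 - z0 t) and expand (1 -
    h)^(-A). The Taylor coefficients are [bcoef] A k times Lambda of (1 - z0 t)^(-A) (t / (1 - z0
    t))^k; their existence is what [taylor2] and [Lam_exists] are for. *)
Lemma F21_analytic (A b c : C) : 0 < Re b -> Re b < Re c -> analytic_on slit_plane (F21 A b c).
Proof.
  intros Hb Hbc z0 Hs.
  assert (Hd : 0 < Re (c - b)) by (simpl; unfold Re in *; lra).
  destruct (slit_local z0 Hs) as [m [r [Hm [Hr Hloc]]]].
  set (V := fun k t => (Cpower (1 - z0 * RtoC t) (- A) * (RtoC t * / (1 - z0 * RtoC t)) ^ k)%C).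
  assert (HV : forall k, taylor2 (V k)).
  { intros k; apply taylor2_mult; [apply taylor2_Cpower_seg; auto|].
    apply taylor2_pow, taylor2_mult; [apply taylor2_id|apply taylor2_inv_seg; auto]. }
  set (mu := fun k => CLim (fun n => LamN b (c - b) (V k) (S n))).
  assert (Hmu : forall k, is_Lam b (c - b) (V k) (mu k)).
  { intros k; destruct (Lam_exists b (c - b) (V k) Hb Hd (HV k)) as [l Hl].
    unfold mu; rewrite (CLim_Clim _ _ Hl); auto. }
  set (B := exp (Rabs (Re (- A)) * (Rabs (ln m) + Rabs (ln (1 + Cmod z0))) + Rabs (Im (- A)) * PI)).
  assert (HBp : 0 < B) by apply exp_pos.
  assert (Hv : forall t, 0 <= t <= 1 -> (1 - z0 * RtoC t)%C <> RtoC 0).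
  { intros t Ht; apply Cmod_gt_0; apply Rlt_le_trans with m; auto. apply Hloc; auto. }
  assert (Ht1 : forall t, 0 <= t <= 1 -> Cmod (RtoC t * / (1 - z0 * RtoC t)) <= / m).
  { intros t Ht; rewrite Cmod_mult, Cmod_R, Rabs_pos_eq, Cmod_inv by (auto; lra).
    rewrite <- (Rmult_1_l (/ m)). apply Rmult_le_compat; try lra.
    - left; apply Rinv_0_lt_compat. apply Rlt_le_trans with m; auto. apply Hloc; auto.
    - apply Rinv_le_contravar; auto. apply Hloc; auto. }
  assert (HVb : forall k, unit_le (V k) (B * (/ m) ^ k)).
  { intros k t Ht; unfold V; rewrite Cmod_mult, Cmod_pow.
    apply Rmult_le_compat; auto using Cmod_ge_0.
    - apply pow_le, Cmod_ge_0.
    - apply Cmod_Cpower_le; auto. split; [apply Hloc|apply Cmod_1_zt]; auto.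
    - apply pow_incr; split; auto using Cmod_ge_0. }
  (* As |t / (1 - z0 t)| <= 1 / m, this radius makes |h| <= r. *)
  exists (fun k => bcoef A k * mu k)%C, (r * m); split; [nra|].
  intros z Hz. set (x := (z - z0)%C) in *.
  assert (Hx : Cmod (x * RtoC (/ m)) < r).
  { rewrite Cmod_mult, Cmod_R, Rabs_pos_eq by (left; apply Rinv_0_lt_compat; auto).
    apply Rmult_lt_reg_r with m; auto. rewrite Rmult_assoc, Rinv_l; lra. }
  destruct (is_Lam_series b (c - b) V (fun k => bcoef A k * x ^ k)%C mu (fun k => B * (/ m) ^ k)
    (fun t => Cpower (1 - z * RtoC t) (- A))) as [H1 H2]; auto.
  - assert (E : forall k, B * Cmod (bcoef A k * (x * RtoC (/ m)) ^ k)
      = Cmod (bcoef A k * x ^ k) * (B * (/ m) ^ k)).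
    { intros k; rewrite !Cmod_mult, !Cmod_pow, Cmod_mult, Cmod_R, Rabs_pos_eq, Rpow_mult_distr
        by (left; apply Rinv_0_lt_compat; auto). ring. }
    apply ex_series_ext with (1 := E). apply ex_series_scal_R, abssum_binom; lra.
  - intros t Ht. set (h := (x * (RtoC t * / (1 - z0 * RtoC t)))%C).
    assert (Hh : Cmod h <= r).
    { eapply Rle_trans; [|left; exact Hx]. unfold h; rewrite (Cmod_mult x), (Cmod_mult x).
      apply Rmult_le_compat_l; [apply Cmod_ge_0|]. rewrite Cmod_R, Rabs_pos_eq; auto.
      left; apply Rinv_0_lt_compat; auto. }
    replace (1 - z * RtoC t)%C with ((1 - z0 * RtoC t) * (1 - h))%C
      by (unfold h, x; field; auto).
    rewrite (proj2 (Hloc t Ht)) by auto. rewrite (binomial_series A h) by lra.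
    rewrite <- Cser_scal by (apply abssum_binom; lra).
    apply Cser_ext; intros k. unfold V, h. rewrite Cpow_mult_l. ring.
  - rewrite (F21_unique _ _ _ _ _ H2).
    assert (E : forall k, (bcoef A k * x ^ k * mu k = bcoef A k * mu k * x ^ k)%C) by (intros; ring).
    rewrite (Cser_ext _ _ E). apply is_pseries_Cser. apply abssum_ext with (1 := E); auto.
Qed.

(** On the level of the integrand Pfaff's transformation is 1 - x t = (1 - x) (1 - w (1 - t));
    expanding in powers of 1 - t calls for the moments of [is_Lam_moment_r]. *)
Lemma F21_Pfaff (A b c : C) (x : R) : 0 < Re b -> Re b < Re c -> x < 0 ->
  let w := - x / (1 - x) in
  abssum (fun k => bcoef A k * RtoC (w ^ k) * (poch (c - b) k / poch c k))%C /\
  F21 A b c (RtoC x) = (Cpower (RtoC (1 - x)) (- A) *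
    Cser (fun k => bcoef A k * RtoC (w ^ k) * (poch (c - b) k / poch c k)))%C.
Proof.
  intros Hb Hbc Hx w.
  assert (Hd : 0 < Re (c - b)) by (simpl; unfold Re in *; lra).
  assert (Hw : 0 < w < 1).
  { unfold w; split; [apply Rdiv_lt_0_compat; lra|].
    apply Rmult_lt_reg_r with (1 - x); [lra|]. unfold Rdiv; rewrite Rmult_assoc, Rinv_l; lra. }
  assert (HwC : Cmod (RtoC w) < 1) by (rewrite Cmod_R, Rabs_pos_eq; lra).
  assert (Hsum : forall y, abssum (fun k => y * (bcoef A k * RtoC w ^ k))%C)
    by (intros; apply abssum_scal, abssum_binom; auto).
  destruct (is_Lam_series b (c - b) (fun k t => RtoC ((1 - t) ^ k))
    (fun k => Cpower (RtoC (1 - x)) (- A) * (bcoef A k * RtoC w ^ k))%C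
    (fun k => poch (c - b) k / poch (b + (c - b)) k)%C (fun _ => 1)
    (fun t => Cpower (1 - RtoC x * RtoC t) (- A))) as [H1 H2]; auto.
  - intros k; apply is_Lam_moment_r; auto.
  - intros k t Ht; rewrite Cmod_R, Rabs_pos_eq by (apply pow_le; lra).
    apply Rle_trans with (1 ^ k); [apply pow_incr; lra|rewrite pow1; lra].
  - apply ex_series_ext with (2 := Hsum (Cpower (RtoC (1 - x)) (- A))). intros; rewrite Rmult_1_r; auto.
  - intros t Ht.
    replace (1 - RtoC x * RtoC t)%C with (RtoC ((1 - x) * (1 - w * (1 - t)))).
    2: { rewrite <- RtoC_mult, <- RtoC_minus. f_equal. unfold w; field; lra. }
    assert (Hwt : 0 <= w * (1 - t) < 1).
    { split; [apply Rmult_le_pos; lra|]. apply Rle_lt_trans with (w * 1); [apply Rmult_le_compat_l|]; lra. }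
    rewrite Cpower_mult_pos by lra.
    rewrite (RtoC_minus 1 (w * (1 - t))), (binomial_series A (RtoC (w * (1 - t)))).
    2: rewrite Cmod_R, Rabs_pos_eq; lra.
    rewrite <- Cser_scal. 2: apply abssum_binom; rewrite Cmod_R, Rabs_pos_eq; lra.
    apply Cser_ext; intros k. rewrite RtoC_mult, Cpow_mult_l, (RtoC_pow (1 - t)). ring.
  - assert (E : forall k, (Cpower (RtoC (1 - x)) (- A) * (bcoef A k * RtoC w ^ k) * (poch (c - b) k / poch (b + (c - b)) k)
      = Cpower (RtoC (1 - x)) (- A) * (bcoef A k * RtoC (w ^ k) * (poch (c - b) k / poch c k)))%C).
    { intros k. replace (b + (c - b))%C with c by ring. rewrite RtoC_pow. ring. }
    assert (Hs : abssum (fun k => bcoef A k * RtoC (w ^ k) * (poch (c - b) k / poch c k))%C).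
    { assert (Hs' := abssum_ext _ _ E H1).
      apply abssum_scal with (c := (/ Cpower (RtoC (1 - x)) (- A))%C) in Hs'.
      apply abssum_ext with (2 := Hs'). intros k. field. split; [apply poch_neq_0, Re_pos_not_nonpos; lra|].
      apply Cpower_neq_0. }
    split; auto. rewrite (F21_unique _ _ _ _ _ H2), (Cser_ext _ _ E), Cser_scal; auto.
Qed.

(** * Uniqueness of the continuation *)

(* By induction on k: subtract the terms below k, divide by h^k and let h be small. *)
Lemma coef_small {T} (F : (T -> Prop) -> Prop) {FF : Filter F} (c : T -> nat -> C)
  (M : nat -> R) (rho : R) :
  0 < rho -> (forall k, 0 <= M k) -> ex_series (fun k => M k * rho ^ k) ->
  F (fun r => forall k, Cmod (c r k) <= M k) ->
  (forall h, 0 < h < rho -> small F (fun r => Cmod (Cser (fun k => c r k * RtoC (h ^ k))%C))) ->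
  forall k, small F (fun r => Cmod (c r k)).
Proof.
  intros Hrho HM HMs Hb Hlim k.
  induction k as [k IH] using (well_founded_induction Wf_nat.lt_wf). intros e He.
  assert (Hp : 0 < rho ^ S k) by (apply pow_lt; auto).
  assert (Htail : ex_series (fun j => M (S k + j)%nat * rho ^ j)).
  { assert (E : forall j, / rho ^ S k * (M (S k + j)%nat * rho ^ (S k + j)) = M (S k + j)%nat * rho ^ j).
    { intros j; rewrite pow_add. set (q := rho ^ S k) in *. field; lra. }
    apply ex_series_ext with (1 := E).
    apply ex_series_scal_R.
    apply (ex_series_incr_n (fun k => M k * rho ^ k) (S k)); auto. }
  set (B := Series (fun j => M (S k + j)%nat * rho ^ j)).
  assert (HB : 0 <= B).
  { apply Series_pos; auto; intros; apply Rmult_le_pos; auto; apply pow_le; lra. }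
  (* The terms beyond k, divided by h^k, are at most h B, which this choice makes at most e / 4. *)
  set (h := Rmin (rho / 2) (e / (4 * (B + 1)))).
  assert (Hh : 0 < h < rho).
  { unfold h; split; [apply Rmin_pos; [lra|apply Rdiv_lt_0_compat; lra]|].
    eapply Rle_lt_trans; [apply Rmin_l|lra]. }
  assert (HhB : h * B <= e / 4).
  { apply Rle_trans with (e / (4 * (B + 1)) * (B + 1)).
    - apply Rmult_le_compat; try lra. apply Rmin_r.
    - right; field; lra. }
  assert (Hhk : 0 < h ^ k) by (apply pow_lt; lra).
  assert (S1 := Hlim h Hh (e / 4 * h ^ k) ltac:(nra)).
  assert (S2 : small F (fun r => rsum (fun i => h ^ i * Cmod (c r i)) k)).
  { apply small_rsum; auto. intros i Hi; apply small_scal; auto. apply pow_le; lra. }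
  specialize (S2 (e / 4 * h ^ k) ltac:(nra)).
  generalize (filter_and _ _ Hb (filter_and _ _ S1 S2)); apply filter_imp.
  intros r [Hr [H1 H2]].
  assert (Hs : abssum (fun k => c r k * RtoC (h ^ k))%C).
  { apply abssum_le with (2 := HMs). intros n; rewrite Cmod_mult, Cmod_R, Rabs_pos_eq by (apply pow_le; lra).
    apply Rmult_le_compat; auto using Cmod_ge_0; [apply pow_le; lra|apply pow_incr; lra]. }
  rewrite (Cser_split _ (S k) Hs), csum_S in H1.
  set (P := csum (fun k => c r k * RtoC (h ^ k))%C k) in *.
  set (Q := Cser (fun j => c r (S k + j)%nat * RtoC (h ^ (S k + j)))%C) in *.
  assert (HP : Cmod P <= rsum (fun i => h ^ i * Cmod (c r i)) k).
  { eapply Rle_trans; [apply csum_norm|]. apply rsum_le; intros i _.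
    rewrite Cmod_mult, Cmod_R, Rabs_pos_eq by (apply pow_le; lra). lra. }
  assert (HQ : Cmod Q <= h ^ k * (h * B)).
  { unfold Q, B. eapply Rle_trans; [apply Cser_norm, (abssum_shift _ (S k) Hs)|].
    rewrite <- Rmult_assoc, <- Series_scal_l. apply Series_le.
    - intros j; split; [apply Cmod_ge_0|].
      rewrite Cmod_mult, Cmod_R, Rabs_pos_eq by (apply pow_le; lra).
      rewrite pow_add. simpl (h ^ S k).
      replace (h ^ k * h * (M (S k + j)%nat * rho ^ j)) with (M (S k + j)%nat * (h * h ^ k * rho ^ j)) by ring.
      apply Rmult_le_compat; auto using Cmod_ge_0.
      + apply Rmult_le_pos; [nra|apply pow_le; lra].
      + apply Rmult_le_compat_l; [nra|apply pow_incr; lra].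
    - apply ex_series_scal_R; auto. }
  assert (HQ2 : Cmod Q <= h ^ k * (e / 4)).
  { eapply Rle_trans; [exact HQ|]. apply Rmult_le_compat_l; lra. }
  assert (Hck : Cmod (c r k) * h ^ k <= Cmod (P + c r k * RtoC (h ^ k) + Q) + Cmod P + Cmod Q).
  { replace (Cmod (c r k) * h ^ k) with (Cmod (c r k * RtoC (h ^ k)))
      by (rewrite Cmod_mult, Cmod_R, Rabs_pos_eq; lra).
    replace (c r k * RtoC (h ^ k))%C with ((P + c r k * RtoC (h ^ k) + Q) - P - Q)%C at 1 by ring.
    eapply Rle_trans; [apply Cmod_triangle_sub|]. apply Rplus_le_compat_r, Cmod_triangle_sub. }
  assert (0 < e * h ^ k) by nra.
  apply Rmult_lt_reg_r with (h ^ k); auto. lra.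
Qed.

(** Abel's lemma: the terms at h0 are differences of bounded partial sums, so those at h decay
    geometrically. *)
Lemma pseries_abssum (u : nat -> C) (h0 h : R) (l : C) :
  0 <= h < h0 -> is_pseries (K := C_AbsRing) (V := C_NormedModule) u (RtoC h0) l ->
  abssum (fun k => u k * RtoC (h ^ k))%C.
Proof.
  intros Hh H. apply is_pseries_Clim in H.
  destruct (bounded_of_Clim _ _ H) as [M [HM HB]].
  assert (Ht : forall k, Cmod (u k) * h0 ^ k <= 2 * M).
  { intros k. replace (Cmod (u k) * h0 ^ k) with (Cmod (u k * RtoC h0 ^ k)).
    2: { rewrite Cmod_mult, Cmod_pow, Cmod_R, Rabs_pos_eq; lra. }
    assert (B1 := HB k). assert (B2 := HB (S k)). rewrite csum_S in B2.
    set (P := csum _ k) in *. replace (u k * RtoC h0 ^ k)%C with (P + u k * RtoC h0 ^ k - P)%C by ring.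
    eapply Rle_trans; [apply Cmod_triangle_sub|lra]. }
  apply abssum_le with (fun k => 2 * M * (h / h0) ^ k).
  - intros k. rewrite Cmod_mult, Cmod_R, Rabs_pos_eq by (apply pow_le; lra).
    replace h with (h0 * (h / h0)) at 1 by (field; lra).
    rewrite Rpow_mult_distr, <- Rmult_assoc. apply Rmult_le_compat_r; auto.
    apply pow_le, Rdiv_le_0_compat; lra.
  - apply ex_series_scal_R, ex_series_geom.
    rewrite Rabs_pos_eq by (apply Rdiv_le_0_compat; lra).
    apply Rmult_lt_reg_r with h0; [lra|]. unfold Rdiv; rewrite Rmult_assoc, Rinv_l; lra.
Qed.

(** Agreement is assumed only to the right of z0 on the real direction, which is what the
    continuation argument supplies. The coefficients coincide by [coef_small] applied to the
    constant family u - v. *)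
Lemma pseries_coef_unique (u v : nat -> C) (f g : C -> C) (z0 : C) (r : R) :
  0 < r ->
  (forall z, Cmod (z - z0) < r -> is_pseries (K := C_AbsRing) (V := C_NormedModule) u (z - z0)%C (f z)) ->
  (forall z, Cmod (z - z0) < r -> is_pseries (K := C_AbsRing) (V := C_NormedModule) v (z - z0)%C (g z)) ->
  (forall h, 0 < h < r -> f (z0 + RtoC h)%C = g (z0 + RtoC h)%C) ->
  forall z, Cmod (z - z0) < r -> f z = g z.
Proof.
  intros Hr Hu Hv Hfg.
  assert (Hz : forall h, (z0 + RtoC h - z0)%C = RtoC h) by (intros; ring).
  assert (Hm : forall h, 0 <= h < r -> Cmod (z0 + RtoC h - z0) < r).
  { intros h Hh; rewrite Hz, Cmod_R, Rabs_pos_eq; lra. }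
  assert (Hsu : forall h, 0 <= h < r -> abssum (fun k => u k * RtoC (h ^ k))%C).
  { intros h Hh. apply (pseries_abssum u ((h + r) / 2) h (f (z0 + RtoC ((h + r) / 2))%C)); [lra|].
    rewrite <- (Hz ((h + r) / 2)) at 1. apply Hu, Hm; lra. }
  assert (Hsv : forall h, 0 <= h < r -> abssum (fun k => v k * RtoC (h ^ k))%C).
  { intros h Hh. apply (pseries_abssum v ((h + r) / 2) h (g (z0 + RtoC ((h + r) / 2))%C)); [lra|].
    rewrite <- (Hz ((h + r) / 2)) at 1. apply Hv, Hm; lra. }
  assert (E : forall k, u k = v k).
  { assert (Hsm : forall k, small eventually (fun _ : nat => Cmod (u k - v k))).
    { apply (coef_small eventually (fun _ k => u k - v k)%C (fun k => Cmod (u k - v k)) (r / 2)).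
      - lra.
      - intros; apply Cmod_ge_0.
      - apply ex_series_ext with (2 := abssum_minus _ _ (Hsu (r / 2) ltac:(lra)) (Hsv (r / 2) ltac:(lra))).
        intros k. replace (u k * RtoC ((r / 2) ^ k) - v k * RtoC ((r / 2) ^ k))%C
          with ((u k - v k) * RtoC ((r / 2) ^ k))%C by ring.
        rewrite Cmod_mult, Cmod_R, Rabs_pos_eq; auto. apply pow_le; lra.
      - apply filter_forall; intros; lra.
      - intros h Hh e He. apply filter_forall; intros _.
        rewrite (Cser_ext _ (fun k => u k * RtoC (h ^ k) - v k * RtoC (h ^ k))%C) by (intros; ring).
        rewrite Cser_minus by (auto; apply Hsu || apply Hsv; lra).
        assert (E1 := Hu _ (Hm h ltac:(lra))). assert (E2 := Hv _ (Hm h ltac:(lra))).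
        rewrite Hz in E1, E2. rewrite Hfg in E1 by lra.
        apply is_pseries_Clim in E1, E2.
        assert (A1 := abssum_lim _ (Hsu h ltac:(lra))). assert (A2 := abssum_lim _ (Hsv h ltac:(lra))).
        apply (Clim_ext eventually) with (g := csum (fun k => u k * RtoC h ^ k)%C) in A1.
        2: intros; apply csum_ext; intros; rewrite RtoC_pow; auto.
        apply (Clim_ext eventually) with (g := csum (fun k => v k * RtoC h ^ k)%C) in A2.
        2: intros; apply csum_ext; intros; rewrite RtoC_pow; auto.
        rewrite (Clim_unique eventually _ _ _ A1 E1), (Clim_unique eventually _ _ _ A2 E2).
        replace (_ - _)%C with (RtoC 0) by ring. rewrite Cmod_0; auto. }
    intros k. destruct (Ceq_dec (u k) (v k)) as [|Hne]; auto. exfalso.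
    assert (Hp : 0 < Cmod (u k - v k)).
    { apply (proj1 (Cmod_gt_0 (u k - v k))). intros E; apply Hne.
      replace (u k) with (u k - v k + v k)%C by ring; rewrite E; ring. }
    destruct (Hsm k _ Hp) as [N HN]; specialize (HN N (le_n N)); lra. }
  intros z Hzr. apply (Clim_unique eventually (csum (fun k => u k * (z - z0) ^ k)%C)).
  - apply is_pseries_Clim; auto.
  - apply (Clim_ext eventually) with (csum (fun k => v k * (z - z0) ^ k)%C).
    + intros n; apply csum_ext; intros; rewrite E; auto.
    + apply is_pseries_Clim; auto.
Qed.

Lemma slit_neg (t : R) : 0 <= t -> slit_plane (RtoC (- t)).
Proof.
  intros Ht; split.
  - intros E; apply RtoC_inj in E; lra.
  - rewrite <- RtoC_minus, Carg_pos, Rabs_R0 by lra. apply PI_RGT_0.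
Qed.

(** Identity theorem along the negative axis: tau is the supremum of the t up to - x such that f and
    g agree on [-t, 0]. Both expand around - tau and agree to the right of it, hence on a whole
    disc, which pushes tau up to - x. *)
Lemma is_hyp2F1_unique_neg (A b c : C) (f g : C -> C) (x : R) :
  is_hyp2F1 A b c f -> is_hyp2F1 A b c g -> x < 0 -> f (RtoC x) = g (RtoC x).
Proof.
  intros [Hf1 Hf2] [Hg1 Hg2] Hx.
  set (P := fun t => 0 <= t <= - x /\ forall s, 0 <= s <= t -> f (RtoC (- s)) = g (RtoC (- s))).
  assert (Hdisc : forall s, 0 <= s < 1 -> f (RtoC (- s)) = g (RtoC (- s))).
  { intros s Hs. assert (Hm : Cmod (RtoC (- s)) < 1) by (rewrite Cmod_R, Rabs_Ropp, Rabs_pos_eq; lra).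
    apply (Clim_unique eventually (csum (fun k => hyp2F1_coef A b c k * RtoC (- s) ^ k)%C));
      apply is_pseries_Clim; auto. }
  set (t0 := Rmin (- x) (/ 2)).
  assert (Ht0 : 0 < t0) by (apply Rmin_pos; lra).
  assert (P0 : P t0).
  { split; [split; [lra|apply Rmin_l]|]. intros s Hs. apply Hdisc.
    generalize (Rmin_r (- x) (/ 2)); fold t0; lra. }
  destruct (completeness P) as [tau [Hub Hlub]].
  { exists (- x); intros t [Ht _]; lra. }
  { exists t0; auto. }
  assert (Htau0 : t0 <= tau) by (apply Hub; auto).
  assert (Htau1 : tau <= - x) by (apply Hlub; intros t [Ht _]; lra).
  assert (Hbelow : forall s, 0 <= s < tau -> f (RtoC (- s)) = g (RtoC (- s))).
  { intros s Hs. destruct (classic (exists t, P t /\ s <= t)) as [[t [[_ Ht] Hst]]|Hn].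
    - apply Ht; lra.
    - exfalso. assert (tau <= s); [|lra]. apply Hlub; intros t Ht.
      destruct (Rle_lt_dec t s); auto. exfalso; apply Hn; exists t; split; auto; lra. }
  assert (Hs := slit_neg tau ltac:(lra)).
  destruct (Hf2 _ Hs) as [u [r1 [Hr1 Hu]]]. destruct (Hg2 _ Hs) as [v [r2 [Hr2 Hv]]].
  (* The bound by tau keeps the points - tau + h, with h < r, inside the interval where agreement is
     known. *)
  set (r := Rmin (Rmin r1 r2) tau).
  assert (Hr : 0 < r) by (apply Rmin_pos; [apply Rmin_pos|]; lra).
  assert (Hra : r <= r1 /\ r <= r2 /\ r <= tau).
  { unfold r; generalize (Rmin_l (Rmin r1 r2) tau) (Rmin_r (Rmin r1 r2) tau) (Rmin_l r1 r2) (Rmin_r r1 r2); lra. }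
  assert (Hnear : forall z, Cmod (z - RtoC (- tau)) < r -> f z = g z).
  { apply pseries_coef_unique with u v; auto.
    - intros z Hz; apply Hu; lra.
    - intros z Hz; apply Hv; lra.
    - intros h Hh. rewrite <- RtoC_plus. replace (- tau + h) with (- (tau - h)) by ring.
      apply Hbelow; lra. }
  set (t1 := Rmin (- x) (tau + r / 2)).
  assert (P1 : P t1).
  { split; [split; [apply Rmin_glb; lra|apply Rmin_l]|]. intros s Hs1.
    destruct (Rlt_le_dec s tau) as [Hlt|Hge]; [apply Hbelow; lra|].
    apply Hnear. rewrite <- RtoC_minus, Cmod_R.
    assert (t1 <= tau + r / 2) by apply Rmin_r. apply Rabs_def1; lra. }
  assert (t1 <= tau) by (apply Hub; auto).
  assert (E : t1 = - x).
  { unfold t1 in *. destruct (Rle_lt_dec (- x) (tau + r / 2)); [apply Rmin_left; auto|].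
    rewrite Rmin_right in H by lra. lra. }
  replace x with (- (- x)) by ring. apply P1. rewrite E; lra.
Qed.

Lemma is_hyp2F1_F21 (A b c : C) : 0 < Re b -> Re b < Re c -> is_hyp2F1 A b c (F21 A b c).
Proof.
  intros Hb Hbc; split; [intros; apply F21_disc; auto|apply F21_analytic; auto].
Qed.

Lemma hyp2F1_neg (A b c : C) (x : R) : 0 < Re b -> Re b < Re c -> x < 0 ->
  hyp2F1 A b c (RtoC x) = F21 A b c (RtoC x).
Proof.
  intros Hb Hbc Hx. unfold hyp2F1. apply (iota_unique (V := C_CompleteNormedModule)).
  - intros w [f [Hf E]]. rewrite <- E. apply is_hyp2F1_unique_neg with A b c; auto.
    apply is_hyp2F1_F21; auto.
  - exists (F21 A b c); split; auto. apply is_hyp2F1_F21; auto.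
Qed.

(** * Concentration of Poisson and negative binomial laws *)

Definition Ex (p g : nat -> R) : R := Series (fun j => p j * g j).

(** Dominates every t^q with |q| <= m, near 0 as well as near infinity, so a bound on its mean
    controls positive and negative moments together. *)
Definition Wm (m : nat) (t : R) : R := t ^ m + (/ t) ^ m.

Lemma Ex_le (p g h : nat -> R) :
  (forall j, 0 <= p j) -> (forall j, 0 <= g j <= h j) -> ex_series (fun j => p j * h j) ->
  Ex p g <= Ex p h.
Proof.
  intros Hp Hg Hs; apply Series_le; auto. intros j; specialize (Hg j); specialize (Hp j).
  split; [apply Rmult_le_pos; lra|apply Rmult_le_compat_l; lra].
Qed.

Lemma Ex_summable_le (p g h : nat -> R) :
  (forall j, 0 <= p j) -> (forall j, 0 <= g j <= h j) -> ex_series (fun j => p j * h j) ->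
  ex_series (fun j => p j * g j).
Proof.
  intros Hp Hg Hs; apply ex_series_le_R with (2 := Hs). intros j; specialize (Hg j); specialize (Hp j).
  split; [apply Rmult_le_pos; lra|apply Rmult_le_compat_l; lra].
Qed.

Lemma Ex_plus (p g h : nat -> R) :
  ex_series (fun j => p j * g j) -> ex_series (fun j => p j * h j) ->
  ex_series (fun j => p j * (g j + h j)) /\ Ex p (fun j => g j + h j) = Ex p g + Ex p h.
Proof.
  intros H1 H2. assert (E : forall j, p j * g j + p j * h j = p j * (g j + h j)) by (intros; ring).
  split.
  - apply ex_series_ext with (1 := E). exact (ex_series_plus _ _ H1 H2).
  - unfold Ex; rewrite <- Series_plus by auto. apply Series_ext; intros; rewrite E; auto.
Qed.

Lemma Ex_scal (p g : nat -> R) c :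
  ex_series (fun j => p j * g j) ->
  ex_series (fun j => p j * (c * g j)) /\ Ex p (fun j => c * g j) = c * Ex p g.
Proof.
  intros H. assert (E : forall j, c * (p j * g j) = p j * (c * g j)) by (intros; ring).
  split.
  - apply ex_series_ext with (1 := E). apply ex_series_scal_R; auto.
  - unfold Ex; rewrite <- Series_scal_l. apply Series_ext; intros; rewrite E; auto.
Qed.

Lemma Ex_pos (p g : nat -> R) :
  (forall j, 0 <= p j) -> (forall j, 0 <= g j) -> ex_series (fun j => p j * g j) -> 0 <= Ex p g.
Proof. intros Hp Hg; apply Series_pos; intros; apply Rmult_le_pos; auto. Qed.

(* Families of weights linked by the size-bias identity (j+1) p_r(j+1) = mu_r p_(sig r)(j); it
   holds for the Poisson laws (sig = id) and for the negative binomial laws (sig = successor). *)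
Section Weights.

Context {T : Type} (D : T -> Prop) (p : T -> nat -> R) (mu M : T -> R) (sig : T -> T) (kap K0 K1 : R).

Hypothesis Hsig : forall r, D r -> D (sig r).
Hypothesis Hpos : forall r j, D r -> 0 <= p r j.
Hypothesis Hone : forall r, D r -> is_series (p r) 1.
Hypothesis Hsum : forall r i, D r -> ex_series (fun j => p r j * (INR j + 1) ^ i).
Hypothesis Hid : forall r j, D r -> (INR j + 1) * p r (S j) = mu r * p (sig r) j.
(** mu is the mean of the law; M is a scale, at least 1, against which moments are measured. *)
Hypothesis Hmu : forall r, D r -> 0 < mu r <= M r.
Hypothesis HM : forall r, D r -> 1 <= M r.
Hypothesis HMs : forall r, D r -> M (sig r) <= 2 * M r.
Hypothesis Hkap : 0 < kap <= 1.
Hypothesis HK0 : 1 <= K0.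
(** Negative moments are carried backwards along sig, so a parameter needs a predecessor of
    comparable mean and scale, except where M is bounded and the estimate 1 / (j + 1) <= 1 is
    enough. *)
Hypothesis Hpred : forall r, D r ->
  M r <= K0 \/ exists r', D r' /\ r = sig r' /\ kap * M r <= mu r' /\ M r <= 2 * M r'.
Hypothesis HK1 : forall r, D r -> mu (sig r) - mu r <= K1.

Lemma inv_pow_le1 (j i : nat) : 0 < (/ (INR j + 1)) ^ i <= 1.
Proof.
  assert (H := INR1_ge1 j). split; [apply pow_lt, Rinv_0_lt_compat; lra|].
  apply Rle_trans with (1 ^ i); [|rewrite pow1; lra]. apply pow_incr; split.
  - left; apply Rinv_0_lt_compat; lra.
  - rewrite <- Rinv_1; apply Rinv_le_contravar; lra.
Qed.

Lemma weights_summable_neg r i : D r -> ex_series (fun j => p r j * ((/ (INR j + 1)) ^ i)).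
Proof.
  intros Hr; apply ex_series_le_R with (fun j => p r j * (INR j + 1) ^ 0); auto.
  intros j. assert (H := Hpos r j Hr). assert (H' := inv_pow_le1 j i).
  simpl pow at 3. split; [apply Rmult_le_pos|apply Rmult_le_compat_l]; lra.
Qed.

(** [Hid] summed against g; the term j = 0 drops out because of the factor j. *)
Lemma size_bias r (g : nat -> R) : D r -> (forall j, 0 <= g j) ->
  ex_series (fun j => p r j * (INR j * g j)) -> 
  ex_series (fun j => p (sig r) j * g (S j)) /\
  Ex (p r) (fun j => INR j * g j) = mu r * Ex (p (sig r)) (fun j => g (S j)).
Proof.
  intros Hr Hg Hs. assert (Hm := Hmu r Hr).
  assert (E : forall j, p r (S j) * (INR (S j) * g (S j)) = mu r * (p (sig r) j * g (S j))).
  { intros j; rewrite S_INR.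
    replace (p r (S j) * ((INR j + 1) * g (S j))) with ((INR j + 1) * p r (S j) * g (S j)) by ring.
    rewrite Hid by auto; ring. }
  assert (Hs' := proj1 (ex_series_incr_1 _) Hs).
  split.
  - apply ex_series_ext with (fun j => / mu r * (p r (S j) * (INR (S j) * g (S j)))).
    + intros j; rewrite E. rewrite <- Rmult_assoc, Rinv_l by lra. apply Rmult_1_l.
    + apply ex_series_scal_R; auto.
  - unfold Ex. rewrite Series_incr_1 by auto. rewrite <- Series_scal_l.
    rewrite (Series_ext _ _ E). simpl INR at 1. ring.
Qed.

Lemma weights_moment_pos i : exists C, 0 < C /\
  forall r, D r -> Ex (p r) (fun j => (INR j + 1) ^ i) <= C * M r ^ i.
Proof.
  induction i as [|i [C [HC IH]]].
  - exists 1; split; [lra|]. intros r Hr. simpl.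
    unfold Ex. rewrite (Series_ext _ (p r)) by (intros; ring).
    rewrite (is_series_unique _ _ (Hone r Hr)); lra.
  (* From (j + 1)^(i+1) = j (j + 1)^i + (j + 1)^i. Size bias on the first term costs 2^i for
     replacing j + 2 by 2 (j + 1) and 2^i for replacing M (sig r) by 2 M r. *)
  - exists ((4 ^ i + 1) * C).
    assert (H4 : 0 < 4 ^ i) by (apply pow_lt; lra).
    split; [nra|]. intros r Hr. assert (Hm := Hmu r Hr). assert (HM1 := HM r Hr).
    assert (Hjs : ex_series (fun j => p r j * (INR j * (INR j + 1) ^ i))).
    { apply Ex_summable_le with (fun j => (INR j + 1) ^ S i); auto.
      intros j; assert (H := pos_INR j). assert (0 < (INR j + 1) ^ i) by (apply pow_lt; lra).
      simpl; nra. }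
    destruct (size_bias r (fun j => (INR j + 1) ^ i) Hr) as [E1 E2]; auto.
    { intros j; apply pow_le; left; apply INR1_pos. }
    destruct (Ex_plus (p r) (fun j => INR j * (INR j + 1) ^ i) (fun j => (INR j + 1) ^ i)) as [_ E3]; auto.
    replace (Ex (p r) (fun j => (INR j + 1) ^ S i)) with
      (Ex (p r) (fun j => INR j * (INR j + 1) ^ i + (INR j + 1) ^ i)).
    2: { apply Series_ext; intros j; simpl; ring. }
    rewrite E3, E2.
    assert (B1 : Ex (p (sig r)) (fun j => (INR (S j) + 1) ^ i) <= 2 ^ i * (C * (2 * M r) ^ i)).
    { apply Rle_trans with (2 ^ i * Ex (p (sig r)) (fun j => (INR j + 1) ^ i)).
      - destruct (Ex_scal (p (sig r)) (fun j => (INR j + 1) ^ i) (2 ^ i)) as [E4 E5]; auto.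
        rewrite <- E5. apply Ex_le; auto. intros j; rewrite S_INR.
        assert (H := INR1_ge1 j). split; [apply pow_le; lra|].
        rewrite <- Rpow_mult_distr. apply pow_incr; lra.
      - apply Rmult_le_compat_l; [apply pow_le; lra|].
        eapply Rle_trans; [apply IH; auto|]. apply Rmult_le_compat_l; [lra|].
        apply pow_incr; split; [|auto]. assert (H := HM (sig r) (Hsig r Hr)); lra. }
    assert (HMi : 0 < M r ^ i) by (apply pow_lt; lra).
    assert (B2 := IH r Hr).
    replace (2 ^ i * (C * (2 * M r) ^ i)) with (4 ^ i * C * M r ^ i) in B1.
    2: { rewrite Rpow_mult_distr. replace 4 with (2 * 2) by ring. rewrite Rpow_mult_distr. ring. }
    assert (B3 : mu r * Ex (p (sig r)) (fun j => (INR (S j) + 1) ^ i) <= M r * (4 ^ i * C * M r ^ i)).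
    { apply Rmult_le_compat; try lra. apply Ex_pos; auto.
      intros j; apply pow_le; left; apply INR1_pos. }
    assert (B4 : C * M r ^ i <= C * M r * M r ^ i) by (apply Rmult_le_compat_r; nra).
    rewrite <- (tech_pow_Rmult (M r) i). lra.
Qed.

(** Size bias read backwards: under sig r' the mean of (j + 1)^(-i-1) is 1 / mu r' times the sum of
    p_r'(j + 1) (j + 1)^(-i), and 1 / (j + 1) <= 2 / (j + 2) turns this into at most 2^i times the
    mean of (j + 1)^(-i) under r'. *)
Lemma weights_moment_neg i : exists C, 0 < C /\
  forall r, D r -> Ex (p r) (fun j => (/ (INR j + 1)) ^ i) <= C * (/ M r) ^ i.
Proof.
  induction i as [|i [C [HC IH]]].
  - exists 1; split; [lra|]. intros r Hr. simpl.
    unfold Ex. rewrite (Series_ext _ (p r)) by (intros; ring).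
    rewrite (is_series_unique _ _ (Hone r Hr)); lra.
  - assert (H4 : 0 < 4 ^ i) by (apply pow_lt; lra).
    assert (HKi : 0 < K0 ^ S i) by (apply pow_lt; lra).
    assert (Hik := Rinv_0_lt_compat _ (proj1 Hkap)).
    exists (K0 ^ S i + 4 ^ i * C * / kap). 
    assert (HX : 0 < 4 ^ i * C * / kap) by (apply Rmult_lt_0_compat; nra).
    split; [lra|]. intros r Hr. assert (HM1 := HM r Hr).
    assert (HiM := Rinv_0_lt_compat (M r) ltac:(lra)).
    assert (HiMi : 0 < (/ M r) ^ i) by (apply pow_lt; auto).
    assert (HiMS : 0 < (/ M r) ^ S i) by (apply pow_lt; auto).
    destruct (Hpred r Hr) as [HK|[r' [Hr' [-> [Hk2 HM2]]]]].
    + apply Rle_trans with 1.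
      * apply Rle_trans with (Series (p r)); [|rewrite (is_series_unique _ _ (Hone r Hr)); lra].
        apply Series_le; [|eexists; apply Hone; auto].
        intros j. assert (H := Hpos r j Hr). assert (H' := inv_pow_le1 j (S i)).
        split; [apply Rmult_le_pos; lra|].
        rewrite <- (Rmult_1_r (p r j)) at 2. apply Rmult_le_compat_l; lra.
      * assert (1 <= K0 ^ S i * (/ M r) ^ S i).
        { rewrite <- Rpow_mult_distr. rewrite <- (pow1 (S i)). apply pow_incr. split; [lra|].
          apply Rmult_le_reg_r with (M r); [lra|]. rewrite Rmult_assoc, Rinv_l; lra. }
        nra.
    + assert (Hm := Hmu r' Hr'). assert (HM1' := HM r' Hr').
      assert (B : Ex (p (sig r')) (fun j => (/ (INR j + 1)) ^ S i)
        <= / mu r' * (2 ^ i * Ex (p r') (fun j => (/ (INR j + 1)) ^ i))).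
      { unfold Ex. rewrite <- Series_scal_l, <- Series_scal_l.
        assert (Hs2 : ex_series (fun j => / mu r' * (2 ^ i * (p r' j * (/ (INR j + 1)) ^ i)))).
        { apply ex_series_scal_R, ex_series_scal_R.
          apply weights_summable_neg; auto. }
        assert (Hp2 : forall j, 0 <= / mu r' * (2 ^ i * (p r' j * (/ (INR j + 1)) ^ i))).
        { intros j. apply Rmult_le_pos; [left; apply Rinv_0_lt_compat; lra|].
          apply Rmult_le_pos; [apply pow_le; lra|]. apply Rmult_le_pos; auto.
          apply Rlt_le, inv_pow_le1. }
        rewrite (Series_incr_1 (fun j => / mu r' * (2 ^ i * (p r' j * (/ (INR j + 1)) ^ i)))) by auto.
        assert (Hs3 := proj1 (ex_series_incr_1 _) Hs2).
        match goal with |- ?a <= ?b + ?c => enough (a <= c) by (specialize (Hp2 O); lra) end.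
        apply Series_le; auto. intros j.
        assert (Hj := INR1_ge1 j). assert (Hpj := Hpos (sig r') j Hr).
        assert (Hq := inv_pow_le1 j (S i)).
        split; [apply Rmult_le_pos; lra|].
        replace (p (sig r') j) with (/ mu r' * ((INR j + 1) * p r' (S j)))
          by (rewrite Hid by auto; field; lra).
        rewrite Rmult_assoc. apply Rmult_le_compat_l; [left; apply Rinv_0_lt_compat; lra|].
        replace ((INR j + 1) * p r' (S j) * (/ (INR j + 1)) ^ S i)
          with (p r' (S j) * (/ (INR j + 1)) ^ i) by (simpl; field; lra).
        replace (2 ^ i * (p r' (S j) * (/ (INR (S j) + 1)) ^ i))
          with (p r' (S j) * (2 * / (INR (S j) + 1)) ^ i) by (rewrite Rpow_mult_distr; ring).
        apply Rmult_le_compat_l; auto. apply pow_incr; rewrite S_INR. split.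
        - left; apply Rinv_0_lt_compat; lra.
        - apply Rmult_le_reg_r with ((INR j + 1) * (INR j + 1 + 1)); [nra|].
          field_simplify; lra. }
      eapply Rle_trans; [exact B|].
      assert (B2 := IH r' Hr').
      assert (B3 : (/ M r') ^ i <= 2 ^ i * (/ M (sig r')) ^ i).
      { rewrite <- Rpow_mult_distr. apply pow_incr; split; [left; apply Rinv_0_lt_compat; lra|].
        apply Rmult_le_reg_r with (M r' * M (sig r')); [nra|]. field_simplify; lra. }
      assert (B4 : / mu r' <= / kap * / M (sig r')).
      { rewrite <- Rinv_mult. apply Rinv_le_contravar; auto. nra. }
      apply Rle_trans with (/ kap * / M (sig r') * (2 ^ i * (C * (2 ^ i * (/ M (sig r')) ^ i)))).
      * apply Rmult_le_compat; auto.
        -- left; apply Rinv_0_lt_compat; lra.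
        -- apply Rmult_le_pos; [apply pow_le; lra|]. apply Ex_pos; auto.
           ++ intros j; apply Rlt_le, inv_pow_le1.
           ++ apply weights_summable_neg; auto.
        -- apply Rmult_le_compat_l; [apply pow_le; lra|]. eapply Rle_trans; [exact B2|].
           apply Rmult_le_compat_l; lra.
      * replace (/ kap * / M (sig r') * (2 ^ i * (C * (2 ^ i * (/ M (sig r')) ^ i))))
          with (4 ^ i * C * / kap * (/ M (sig r')) ^ S i).
        -- nra.
        -- replace 4 with (2 * 2) by ring. rewrite Rpow_mult_distr. simpl; ring.
Qed.

Lemma weights_Wm_summable r m : D r -> ex_series (fun j => p r j * Wm m ((INR j + 1) / M r)).
Proof.
  intros Hr. assert (HM1 := HM r Hr).
  destruct (Ex_scal (p r) (fun j => (INR j + 1) ^ m) ((/ M r) ^ m)) as [S1 _]; auto.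
  destruct (Ex_scal (p r) (fun j => (/ (INR j + 1)) ^ m) (M r ^ m)) as [S2 _].
  { apply weights_summable_neg; auto. }
  destruct (Ex_plus _ _ _ S1 S2) as [S3 _].
  apply ex_series_ext with (2 := S3). intros j; f_equal; unfold Wm.
  rewrite <- !Rpow_mult_distr. f_equal; f_equal; field; try split; generalize (INR1_pos j); lra.
Qed.

Lemma weights_Wm_bound m : exists C, 0 < C /\
  forall r, D r -> Ex (p r) (fun j => Wm m ((INR j + 1) / M r)) <= C.
Proof.
  destruct (weights_moment_pos m) as [C1 [HC1 H1]].
  destruct (weights_moment_neg m) as [C2 [HC2 H2]].
  exists (C1 + C2); split; [lra|]. intros r Hr. assert (HM1 := HM r Hr).
  destruct (Ex_scal (p r) (fun j => (INR j + 1) ^ m) ((/ M r) ^ m)) as [S1 E1]; auto.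
  destruct (Ex_scal (p r) (fun j => (/ (INR j + 1)) ^ m) (M r ^ m)) as [S2 E2].
  { apply weights_summable_neg; auto. }
  destruct (Ex_plus _ _ _ S1 S2) as [S3 E3].
  replace (Ex (p r) (fun j => Wm m ((INR j + 1) / M r)))
    with (Ex (p r) (fun j => (/ M r) ^ m * (INR j + 1) ^ m + M r ^ m * (/ (INR j + 1)) ^ m)).
  2: { apply Series_ext. intros j; f_equal; unfold Wm.
       rewrite <- !Rpow_mult_distr. f_equal; f_equal; field; try split; generalize (INR1_pos j); lra. }
  rewrite E3, E1, E2. specialize (H1 r Hr); specialize (H2 r Hr).
  assert (P1 : 0 < M r ^ m) by (apply pow_lt; lra).
  assert (E : (/ M r) ^ m * M r ^ m = 1) by (rewrite <- Rpow_mult_distr, Rinv_l, pow1; lra).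
  assert (P2 : 0 < (/ M r) ^ m) by (apply pow_lt, Rinv_0_lt_compat; lra).
  assert (B1 : (/ M r) ^ m * Ex (p r) (fun j => (INR j + 1) ^ m) <= (/ M r) ^ m * (C1 * M r ^ m))
    by (apply Rmult_le_compat_l; lra).
  assert (B2 : M r ^ m * Ex (p r) (fun j => (/ (INR j + 1)) ^ m) <= M r ^ m * (C2 * (/ M r) ^ m))
    by (apply Rmult_le_compat_l; lra).
  replace ((/ M r) ^ m * (C1 * M r ^ m)) with (C1 * ((/ M r) ^ m * M r ^ m)) in B1 by ring.
  replace (M r ^ m * (C2 * (/ M r) ^ m)) with (C2 * ((/ M r) ^ m * M r ^ m)) in B2 by ring.
  rewrite E in B1, B2. lra.
Qed.

(** Two size biases give mean mu_r mu_(sig r) for j (j - 1). Since (j + 1 - mu)^2 = j (j - 1) + (3 -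
    2 mu) j + (1 - mu)^2, its mean is mu_r (mu_(sig r) - mu_r) + mu_r + 1: of order mu, not mu^2. *)
Lemma weights_variance r : D r ->
  ex_series (fun j => p r j * (INR j + 1 - mu r) ^ 2) /\
  Ex (p r) (fun j => (INR j + 1 - mu r) ^ 2) <= mu r * K1 + mu r + 1.
Proof.
  intros Hr. assert (Hm := Hmu r Hr).
  assert (Hd : forall k r, D r -> ex_series (fun j => p r j * INR j ^ k)).
  { intros k r' Hr'. apply Ex_summable_le with (fun j => (INR j + 1) ^ k); auto.
    intros j; assert (H := pos_INR j). split; [apply pow_le; lra|apply pow_incr; lra]. }
  assert (E0 : forall r, D r -> Ex (p r) (fun _ => 1) = 1 /\ ex_series (fun j => p r j * 1)).
  { intros r' Hr'; split.
    - unfold Ex; rewrite (Series_ext _ (p r')) by (intros; ring). apply is_series_unique, Hone; auto.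
    - apply ex_series_ext with (p r'); [intros; symmetry; apply Rmult_1_r|eexists; apply Hone; auto]. }
  assert (E1 : forall r, D r -> Ex (p r) (fun j => INR j * 1) = mu r).
  { intros r' Hr'. destruct (size_bias r' (fun _ => 1) Hr') as [_ E]; [intros; lra| |].
    - apply ex_series_ext with (2 := Hd 1%nat r' Hr'). intros j. f_equal; ring.
    - rewrite E, (proj1 (E0 _ (Hsig _ Hr'))); ring. }
  assert (S2 : ex_series (fun j => p r j * (INR j * INR (pred j)))).
  { apply Ex_summable_le with (fun j => INR j ^ 2); auto.
    intros j; assert (H := pos_INR j). assert (H' := pos_INR (pred j)).
    assert (INR (pred j) <= INR j) by (apply le_INR; lia). split; [nra|simpl; nra]. }
  assert (E2 : Ex (p r) (fun j => INR j * INR (pred j)) = mu r * mu (sig r)).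
  { destruct (size_bias r (fun j => INR (pred j)) Hr) as [_ E]; auto; [intros; apply pos_INR|].
    rewrite E. rewrite <- (E1 (sig r)) by auto. f_equal. apply Series_ext; intros; simpl pred; ring. }
  assert (S1 : ex_series (fun j => p r j * (INR j * 1))).
  { apply ex_series_ext with (2 := Hd 1%nat r Hr). intros j. f_equal; ring. }
  destruct (Ex_scal (p r) (fun j => INR j * 1) (3 - 2 * mu r) S1) as [S3 E3].
  destruct (Ex_scal (p r) (fun j => 1) ((1 - mu r) ^ 2) (proj2 (E0 r Hr))) as [S4 E4].
  destruct (Ex_plus _ _ _ S3 S4) as [S5 E5]. destruct (Ex_plus _ _ _ S2 S5) as [S6 E6].
  assert (Ef : forall j, p r j * (INR j * INR (pred j) + ((3 - 2 * mu r) * (INR j * 1) + (1 - mu r) ^ 2 * 1))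
     = p r j * (INR j + 1 - mu r) ^ 2).
  { intros [|j]; [simpl; ring|]. simpl pred. rewrite S_INR. ring. }
  split; [apply ex_series_ext with (1 := Ef); auto|].
  unfold Ex at 1. rewrite <- (Series_ext _ _ Ef).
  change (Ex (p r) (fun j => INR j * INR (pred j) + ((3 - 2 * mu r) * (INR j * 1) + (1 - mu r) ^ 2 * 1))
    <= mu r * K1 + mu r + 1).
  rewrite E6, E5, E4, E3, E2, (E1 r Hr), (proj1 (E0 r Hr)).
  assert (H := HK1 r Hr). nra.
Qed.

End Weights.

(** * The majorants [Wm] and sequences of power type *)

Lemma pow_ge1 (t : R) m : 1 <= t -> 1 <= t ^ m.
Proof. intros H; apply pow_R1_Rle; auto. Qed.

Lemma Wm_pos m t : 0 < t -> 0 < t ^ m /\ 0 < (/ t) ^ m.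
Proof. intros H; split; apply pow_lt; auto. apply Rinv_0_lt_compat; auto. Qed.

Lemma Wm_prod m t : 0 < t -> t ^ m * (/ t) ^ m = 1.
Proof. intros H; rewrite <- Rpow_mult_distr, Rinv_r, pow1; lra. Qed.

Lemma Wm_ge2 m t : 0 < t -> 2 <= Wm m t.
Proof.
  intros H; destruct (Wm_pos m t H); assert (E := Wm_prod m t H); unfold Wm.
  assert (0 <= (t ^ m - (/ t) ^ m) ^ 2) by apply pow2_ge_0. nra.
Qed.

Lemma Rpower_le_Wm m t q : 0 < t -> Rabs q <= INR m -> Rpower t q <= Wm m t.
Proof.
  assert (A : forall t q, 1 <= t -> q <= INR m -> Rpower t q <= t ^ m).
  { intros u v Hu Hv. rewrite <- Rpower_pow by lra. apply Rle_Rpower; auto. }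
  intros Ht Hq. destruct (Wm_pos m t Ht). unfold Wm.
  assert (Hq2 := Rabs_le_between q (INR m)). apply Hq2 in Hq.
  destruct (Rle_lt_dec 1 t) as [H1|H1].
  - assert (B := A t q H1 ltac:(lra)). lra.
  - replace (Rpower t q) with (Rpower (/ t) (- q)).
    + assert (1 <= / t) by (rewrite <- Rinv_1; apply Rinv_le_contravar; lra).
      assert (B := A (/ t) (- q) ltac:(auto) ltac:(lra)). lra.
    + unfold Rpower; rewrite ln_Rinv by auto; f_equal; ring.
Qed.

(** From u <= eta u^2 + 1 / (2 eta): a moment is traded for a small multiple of a higher one plus a
    constant. *)
Lemma Wm_double m t eta : 0 < t -> 0 < eta -> Wm m t <= eta * Wm (2 * m) t + / eta.
Proof.
  intros Ht He. destruct (Wm_pos m t Ht) as [H1 H2]. unfold Wm.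
  assert (Hi := Rinv_0_lt_compat _ He).
  assert (A : forall u, 0 < u -> u <= eta * u ^ 2 + / eta * / 2).
  { intros u Hu. assert (Hsq := pow2_ge_0 (eta * u - 1)).
    apply Rmult_le_reg_l with eta; auto.
    replace (eta * (eta * u ^ 2 + / eta * / 2)) with ((eta * u) ^ 2 + / 2) by (field; lra).
    assert (Hsq' := pow2_ge_0 (eta * u - / 2)). nra. }
  replace (2 * m)%nat with (m * 2)%nat by lia. rewrite !pow_mult.
  assert (B1 := A _ H1). assert (B2 := A _ H2). lra.
Qed.

Lemma Wm_le_double m t : 0 < t -> Wm m t <= 2 * Wm (2 * m) t.
Proof.
  intros Ht. assert (H := Wm_double m t 1 Ht ltac:(lra)). assert (H2 := Wm_ge2 (2 * m) t Ht).
  rewrite Rinv_1 in H. lra.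
Qed.

Lemma Wm_scale m k t : 0 < k -> 0 < t -> Wm m (k * t) <= Wm m k * Wm m t.
Proof.
  intros Hk Ht. destruct (Wm_pos m t Ht), (Wm_pos m k Hk). unfold Wm.
  rewrite Rinv_mult, !Rpow_mult_distr. nra.
Qed.

Lemma ln_near_1 t : Rabs (t - 1) <= / 2 -> Rabs (ln t) <= 2 * Rabs (t - 1).
Proof.
  intros H. assert (Ht := proj1 (Rabs_le_between _ _) H).
  assert (H1 : ln t <= t - 1).
  { assert (E := exp_ineq1_le (ln t)). rewrite exp_ln in E; lra. }
  assert (H2 : - ln t <= / t - 1).
  { assert (E := exp_ineq1_le (- ln t)). rewrite exp_Ropp, exp_ln in E; lra. }
  assert (H3 : / t - 1 = (1 - t) * / t) by (field; lra).
  assert (H4 : 0 < / t <= 2).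
  { split; [apply Rinv_0_lt_compat; lra|]. rewrite <- (Rinv_inv 2). apply Rinv_le_contravar; lra. }
  apply Rabs_le. split.
  - destruct (Rle_lt_dec t 1); [rewrite Rabs_left1 by lra|rewrite Rabs_pos_eq by lra]; nra.
  - destruct (Rle_lt_dec t 1); [rewrite Rabs_left1 by lra|rewrite Rabs_pos_eq by lra]; nra.
Qed.

Lemma sq_add_le (x y : R) : (x + y) ^ 2 <= 2 * x ^ 2 + 2 * y ^ 2.
Proof. assert (H := pow2_ge_0 (x - y)). nra. Qed.

Lemma Cmod_sq_add (x y : C) : Cmod (x + y) ^ 2 <= 2 * Cmod x ^ 2 + 2 * Cmod y ^ 2.
Proof.
  eapply Rle_trans; [|apply sq_add_le]. apply pow_incr; split; [apply Cmod_ge_0|apply Cmod_triangle].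
Qed.

Lemma Cmod_Cpower_sq (t : R) (s : C) : 0 < t -> Cmod (Cpower t s) ^ 2 = Rpower t (2 * Re s).
Proof.
  intros Ht; rewrite Cmod_Cpower_pos by auto. simpl pow. rewrite Rmult_1_r, <- Rpower_plus.
  f_equal; ring.
Qed.

(** For |t - 1| <= 1/2 the power is Lipschitz at 1. Farther away [Wm_double] makes the coefficient
    of the majorant small, and its constant is paid by (t - 1)^2 >= 1/4. *)
Lemma Cpower_near_1_sq (s : C) (m : nat) : 2 * Rabs (Re s) <= INR m ->
  forall eta, 0 < eta -> exists K, 0 <= K /\ forall t, 0 < t ->
    Cmod (Cpower t s - 1) ^ 2 <= eta * Wm (2 * m) t + K * (t - 1) ^ 2.
Proof.
  intros Hm eta He. assert (Hs := Cmod_ge_0 s). assert (Hie := Rinv_0_lt_compat _ He).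
  set (K1 := (2 * Cmod s * exp (Cmod s)) ^ 2). assert (HK1 : 0 <= K1) by apply pow2_ge_0.
  set (K2 := (4 * / eta + 2) * 4). assert (HK2 : 0 <= K2) by (unfold K2; lra).
  exists (K1 + K2); split; [lra|]. intros t Ht.
  assert (Hsq := pow2_ge_0 (t - 1)). assert (HW := Wm_ge2 (2 * m) t Ht).
  destruct (Rle_lt_dec (Rabs (t - 1)) (/ 2)) as [H1|H1].
  - assert (Hl := ln_near_1 t H1). assert (Ha := Rabs_pos (ln t)).
    rewrite Cpower_pos by auto.
    assert (B : Cmod (Cexp (s * RtoC (ln t)) - 1) <= (2 * Cmod s * exp (Cmod s)) * Rabs (t - 1)).
    { eapply Rle_trans; [apply Cexp_bound1|]. rewrite Cmod_mult, Cmod_R.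
      replace (2 * Cmod s * exp (Cmod s) * Rabs (t - 1)) with ((Cmod s * (2 * Rabs (t - 1))) * exp (Cmod s)) by ring.
      apply Rmult_le_compat; [nra|left; apply exp_pos| |apply exp_mono; nra].
      apply Rmult_le_compat_l; auto. }
    apply Rle_trans with (K1 * (t - 1) ^ 2); [|nra].
    unfold K1. rewrite <- (pow2_abs (t - 1)), <- Rpow_mult_distr.
    apply pow_incr; split; auto using Cmod_ge_0.
  - apply Rle_trans with (2 * Wm m t + 2).
    + replace (Cpower t s - 1)%C with (Cpower t s + - (1))%C by ring.
      eapply Rle_trans; [apply Cmod_sq_add|]. rewrite Cmod_opp, Cmod_1, Cmod_Cpower_sq by auto.
      assert (Rpower t (2 * Re s) <= Wm m t); [|lra].
      apply Rpower_le_Wm; auto. rewrite Rabs_mult, (Rabs_pos_eq 2); lra.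
    + assert (H2 := Wm_double m t (eta / 2) Ht ltac:(lra)).
      replace (/ (eta / 2)) with (2 * / eta) in H2 by (field; lra).
      assert (H3 : 1 <= 4 * (t - 1) ^ 2).
      { rewrite <- (pow2_abs (t - 1)). nra. }
      assert (H4 : 4 * / eta + 2 <= K2 * (t - 1) ^ 2) by (unfold K2; nra).
      nra.
Qed.

(** The asymptotic alpha_j ~ K j^s, with j + 1 as base so that the quotient makes sense at j = 0,
    and with K = 0 allowed. *)
Definition power_like (alpha : nat -> C) (s K : C) : Prop :=
  Clim eventually (fun j => alpha j / Cpower (RtoC (INR j + 1)) s)%C K.

(** The convergence is made uniform in j: the finitely many indices j < J where the error may be
    large satisfy J / (j + 1) >= 1 and are paid by B / (j + 1)^2, which disappears after
    averaging. *)
Lemma power_like_rel_sq (alpha : nat -> C) (s K : C) : power_like alpha s K ->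
  forall eta, 0 < eta -> exists B, 0 <= B /\ forall j,
    Cmod (alpha j / Cpower (RtoC (INR j + 1)) s - K) ^ 2 <= eta + B * (/ (INR j + 1)) ^ 2.
Proof.
  intros H eta He. set (u := fun j => (alpha j / Cpower (RtoC (INR j + 1)) s)%C).
  destruct (bounded_of_Clim u K H) as [M [HM Hb]].
  destruct (H (Rmin 1 eta) ltac:(apply Rmin_pos; lra)) as [J HJ].
  assert (HMK : 0 <= M + Cmod K) by (generalize (Cmod_ge_0 K); lra).
  exists ((M + Cmod K) ^ 2 * INR J ^ 2).
  split; [apply Rmult_le_pos; apply pow2_ge_0|].
  intros j. fold (u j). assert (Hj := INR1_pos j).
  assert (Hij := Rinv_0_lt_compat _ Hj).
  destruct (le_lt_dec J j) as [Hle|Hlt].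
  - specialize (HJ j Hle). fold (u j) in HJ.
    assert (H1 := Rmin_l 1 eta). assert (H2 := Rmin_r 1 eta). assert (H0 := Cmod_ge_0 (u j - K)).
    assert (0 <= (M + Cmod K) ^ 2 * INR J ^ 2 * (/ (INR j + 1)) ^ 2).
    { apply Rmult_le_pos; [apply Rmult_le_pos|]; apply pow2_ge_0. }
    assert (Cmod (u j - K) ^ 2 <= eta) by nra. lra.
  - assert (H1 : 1 <= INR J * / (INR j + 1)).
    { apply Rmult_le_reg_r with (INR j + 1); auto. rewrite Rmult_assoc, Rinv_l by lra.
      rewrite <- S_INR, Rmult_1_l, Rmult_1_r. apply le_INR; lia. }
    apply Rle_trans with ((M + Cmod K) ^ 2 * 1).
    + rewrite Rmult_1_r. apply pow_incr; split; [apply Cmod_ge_0|].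
      eapply Rle_trans; [apply Cmod_triangle_sub|]. specialize (Hb j); lra.
    + rewrite Rmult_assoc, <- Rpow_mult_distr.
      assert (1 <= (INR J * / (INR j + 1)) ^ 2) by (apply pow_ge1; auto).
      assert (Hp := pow2_ge_0 (M + Cmod K)). nra.
Qed.

(** With t = (j + 1) / mu and e the error at j, alpha_j / mu^s - K = e t^s + K (t^s - 1). The
    exponent depends on s alone and is fixed before eps, since eps will be chosen against the mean
    of [Wm]. The 2 added to 2 |Re s| makes room for 1 / (j + 1)^2 = mu^(-2) t^(-2). *)
Lemma power_like_sq (alpha : nat -> C) (s K : C) : power_like alpha s K ->
  exists m, forall eps, 0 < eps -> exists B, 0 <= B /\ forall mu j, 0 < mu ->
    Cmod (alpha j / Cpower mu s - K) ^ 2 <=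
      (eps + B * (/ mu) ^ 2) * Wm m ((INR j + 1) / mu) + B * ((INR j + 1) / mu - 1) ^ 2.
Proof.
  intros H. destruct (INR_unbounded (2 * Rabs (Re s) + 2)) as [m Hm].
  exists (2 * m)%nat. intros eps Heps.
  assert (HK := pow2_ge_0 (Cmod K)).
  set (eta := eps / (4 + 4 * Cmod K ^ 2)).
  assert (Heta : 0 < eta) by (apply Rdiv_lt_0_compat; lra).
  destruct (power_like_rel_sq alpha s K H eta Heta) as [B1 [HB1 H1]].
  destruct (Cpower_near_1_sq s m ltac:(lra) eta Heta) as [B2 [HB2 H2]].
  exists (4 * B1 + 2 * Cmod K ^ 2 * B2).
  assert (HKB : 0 <= Cmod K ^ 2 * B2) by nra.
  split; [lra|]. intros mu j Hmu. set (t := (INR j + 1) / mu).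
  assert (Hj := INR1_pos j).
  assert (Ht : 0 < t) by (apply Rdiv_lt_0_compat; auto).
  set (e := (alpha j / Cpower (RtoC (INR j + 1)) s - K)%C).
  assert (E : (alpha j / Cpower mu s - K)%C = (e * Cpower t s + K * (Cpower t s - 1))%C).
  { unfold e. replace (INR j + 1) with (mu * t) by (unfold t; field; lra).
    rewrite Cpower_mult_pos by auto. field. split; apply Cpower_neq_0. }
  rewrite E. eapply Rle_trans; [apply Cmod_sq_add|]. rewrite !Cmod_mult, !Rpow_mult_distr.
  assert (Hp := pow2_ge_0 (t - 1)). assert (Hmi := pow2_ge_0 (/ mu)).
  assert (HW := Wm_ge2 (2 * m) t Ht).
  assert (X1 : Cmod e ^ 2 * Cmod (Cpower t s) ^ 2 <= (2 * eta + 2 * B1 * (/ mu) ^ 2) * Wm (2 * m) t).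
  { rewrite Cmod_Cpower_sq by auto.
    apply Rle_trans with ((eta + B1 * (/ (INR j + 1)) ^ 2) * Rpower t (2 * Re s)).
    - apply Rmult_le_compat_r; [left; apply Rpower_pos|apply H1].
    - replace (/ (INR j + 1)) with (/ mu * / t) by (unfold t; field; lra).
      rewrite Rpow_mult_distr, Rmult_plus_distr_r, Rmult_plus_distr_r.
      apply Rplus_le_compat.
      + replace (2 * eta * Wm (2 * m) t) with (eta * (2 * Wm (2 * m) t)) by ring.
        apply Rmult_le_compat_l; [lra|].
        eapply Rle_trans; [apply (Rpower_le_Wm m)|apply Wm_le_double; auto]; auto.
        rewrite Rabs_mult, (Rabs_pos_eq 2); lra.
      + replace (B1 * ((/ mu) ^ 2 * (/ t) ^ 2) * Rpower t (2 * Re s))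
          with (B1 * (/ mu) ^ 2 * ((/ t) ^ 2 * Rpower t (2 * Re s))) by ring.
        replace (2 * B1 * (/ mu) ^ 2 * Wm (2 * m) t) with (B1 * (/ mu) ^ 2 * (2 * Wm (2 * m) t)) by ring.
        apply Rmult_le_compat_l; [nra|].
        replace ((/ t) ^ 2) with (Rpower t (Ropp 2)).
        * rewrite <- Rpower_plus.
          eapply Rle_trans; [apply (Rpower_le_Wm m)|apply Wm_le_double; auto]; auto.
          eapply Rle_trans; [apply Rabs_triang|]. rewrite Rabs_Ropp, Rabs_mult, !(Rabs_pos_eq 2); lra.
        * rewrite Rpower_Ropp, pow_inv. f_equal. replace 2 with (INR 2) at 1 by (simpl; ring).
          apply Rpower_pow; auto. }
  assert (X2 := H2 t Ht).
  assert (X3 : Cmod K ^ 2 * Cmod (Cpower t s - 1) ^ 2 <= Cmod K ^ 2 * (eta * Wm (2 * m) t + B2 * (t - 1) ^ 2))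
    by (apply Rmult_le_compat_l; auto).
  assert (E2 : eps = 4 * eta + 4 * Cmod K ^ 2 * eta) by (unfold eta; field; lra).
  assert (Y1 : 0 <= Cmod K ^ 2 * eta * Wm (2 * m) t) by (apply Rmult_le_pos; nra).
  assert (Y2 : 0 <= B1 * (t - 1) ^ 2) by nra.
  assert (Y3 : 0 <= Cmod K ^ 2 * B2 * (/ mu) ^ 2 * Wm (2 * m) t).
  { apply Rmult_le_pos; [apply Rmult_le_pos|]; lra. }
  rewrite E2. nra.
Qed.

(** X is the sampled index divided by the scale mu. A vanishing mean of (X - 1)^2 controls the
    vicinity of 1, the bounded means of all [Wm] control both tails, and mu tends to infinity. *)
Record concentrated {T} (F : (T -> Prop) -> Prop) (p X : T -> nat -> R) (mu : T -> R) : Prop := {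
  conc_pos : F (fun r => 0 < mu r /\ forall j, 0 <= p r j /\ 0 < X r j);
  conc_one : F (fun r => is_series (p r) 1);
  conc_W : forall m, exists B, F (fun r => ex_series (fun j => p r j * Wm m (X r j)) /\
     Ex (p r) (fun j => Wm m (X r j)) <= B);
  conc_sq : F (fun r => ex_series (fun j => p r j * (X r j - 1) ^ 2));
  conc_var : small F (fun r => Ex (p r) (fun j => (X r j - 1) ^ 2));
  conc_mu : small F (fun r => / mu r) }.

(** Convergence in mean square rather than in mean, because it passes to products of two
    sequences. *)
Definition L2_lim {T} (F : (T -> Prop) -> Prop) (p : T -> nat -> R) (phi : T -> nat -> C) (K : C) : Prop :=
  F (fun r => ex_series (fun j => p r j * Cmod (phi r j - K) ^ 2)) /\
  small F (fun r => Ex (p r) (fun j => Cmod (phi r j - K) ^ 2)).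

(** * Mean-square limits under concentrating laws *)

Section Concentration.

Context {T : Type} (F : (T -> Prop) -> Prop) {FF : Filter F}.

(** eps is chosen against the bound B0 on the mean of [Wm]; the large constant B that comes with it
    only multiplies 1 / mu^2 and the variance, both of which vanish in the limit. *)
Lemma L2_of_bound (p X : T -> nat -> R) (mu : T -> R) (phi : T -> nat -> C) (K : C) (m : nat) :
  concentrated F p X mu ->
  (forall eps, 0 < eps -> exists B, 0 <= B /\ F (fun r => forall j,
    Cmod (phi r j - K) ^ 2 <= (eps + B * (/ mu r) ^ 2) * Wm m (X r j) + B * (X r j - 1) ^ 2)) ->
  L2_lim F p phi K.
Proof.
  intros [Hpos Hone HW Hsq Hvar Hmu] H. destruct (HW m) as [B0 HB0].
  assert (Key : forall eps, 0 < eps -> exists B, 0 <= B /\ F (fun r =>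
     ex_series (fun j => p r j * Cmod (phi r j - K) ^ 2) /\
     Ex (p r) (fun j => Cmod (phi r j - K) ^ 2) <=
       (eps + B * (/ mu r) ^ 2) * Rabs B0 + B * Ex (p r) (fun j => (X r j - 1) ^ 2))).
  { intros eps He. destruct (H eps He) as [B [HB HF]]. exists B; split; auto.
    generalize (filter_and _ _ Hpos (filter_and _ _ HB0 (filter_and _ _ Hsq HF))).
    apply filter_imp. intros r [[Hm Hp] [[S1 E1] [S2 Hb]]].
    destruct (Ex_scal (p r) (fun j => Wm m (X r j)) (eps + B * (/ mu r) ^ 2) S1) as [S3 E3].
    destruct (Ex_scal (p r) (fun j => (X r j - 1) ^ 2) B S2) as [S4 E4].
    destruct (Ex_plus _ _ _ S3 S4) as [S5 E5].
    assert (Hp1 : forall j, 0 <= p r j) by (intros; apply Hp).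
    assert (Hb' : forall j, 0 <= Cmod (phi r j - K) ^ 2 <=
      (eps + B * (/ mu r) ^ 2) * Wm m (X r j) + B * (X r j - 1) ^ 2)
      by (intros; split; [apply pow2_ge_0|auto]).
    split; [apply Ex_summable_le with (3 := S5); auto|].
    eapply Rle_trans; [apply Ex_le with (3 := S5); auto|]. rewrite E5, E3, E4.
    apply Rplus_le_compat_r. assert (0 <= (/ mu r) ^ 2) by apply pow2_ge_0.
    apply Rmult_le_compat_l; [nra|]. eapply Rle_trans; [exact E1|apply Rle_abs]. }
  split.
  - destruct (Key 1 ltac:(lra)) as [B [_ HF]]. revert HF; apply filter_imp; tauto.
  - intros e He. assert (HR := Rabs_pos B0).
    set (eps := e / (4 * (Rabs B0 + 1))).
    assert (Heps : 0 < eps) by (apply Rdiv_lt_0_compat; lra).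
    destruct (Key eps Heps) as [B [HB HF]].
    assert (Hv := Hvar (e / (4 * (B + 1))) ltac:(apply Rdiv_lt_0_compat; lra)).
    set (q := e / (4 * (B + 1) * (Rabs B0 + 1))).
    assert (Hq : 0 < q) by (apply Rdiv_lt_0_compat; nra).
    assert (Hm := Hmu (Rmin 1 q) ltac:(apply Rmin_pos; lra)).
    generalize (filter_and _ _ Hpos (filter_and _ _ HF (filter_and _ _ Hv Hm))).
    apply filter_imp. intros r [[Hmr Hp] [[_ E] [Hv' Hm']]].
    eapply Rle_lt_trans; [exact E|].
    assert (Hi := Rinv_0_lt_compat _ Hmr).
    assert (H1 := Rmin_l 1 q). assert (H2 := Rmin_r 1 q).
    assert (Hsq1 : (/ mu r) ^ 2 <= q) by nra.
    assert (A1 : eps * Rabs B0 <= e / 4).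
    { replace (e / 4) with (eps * (Rabs B0 + 1)) by (unfold eps; field; lra). nra. }
    assert (A2 : B * (/ mu r) ^ 2 * Rabs B0 <= e / 4).
    { replace (e / 4) with ((B + 1) * q * (Rabs B0 + 1)) by (unfold q; field; lra).
      apply Rmult_le_compat; try lra.
      - apply Rmult_le_pos; auto; apply pow2_ge_0.
      - apply Rmult_le_compat; try lra. apply pow2_ge_0. }
    assert (A3 : B * Ex (p r) (fun j => (X r j - 1) ^ 2) <= e / 4).
    { replace (e / 4) with ((B + 1) * (e / (4 * (B + 1)))) by (field; lra).
      apply Rle_trans with (B * (e / (4 * (B + 1)))); [apply Rmult_le_compat_l; lra|].
      apply Rmult_le_compat_r; [|lra]. left; apply Rdiv_lt_0_compat; lra. }
    lra.
Qed.

Lemma L2_lim_const (p : T -> nat -> R) (K : C) : L2_lim F p (fun _ _ => K) K.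
Proof.
  assert (E : forall r j, p r j * Cmod (K - K) ^ 2 = 0 * 0).
  { intros; replace (K - K)%C with (RtoC 0) by ring. rewrite Cmod_0; ring. }
  split.
  - apply filter_forall; intros r. apply ex_series_ext with (fun j => 0 * (/ 2) ^ j).
    + intros j; rewrite E. rewrite !Rmult_0_l; auto.
    + apply ex_series_scal_R, ex_series_geom. rewrite Rabs_pos_eq; lra.
  - intros e He; apply filter_forall; intros r. unfold Ex. rewrite (Series_ext _ _ (E r)).
    rewrite Series_scal_l; lra.
Qed.

(** With x and y the deviations, the error is at most |x| |y| + |u| |y| + |v| |x|. The first term is
    below |x|^2 + |y|^2; in the linear ones c <= eta + c^2 / eta takes the place of the
    Cauchy-Schwarz inequality, the total mass 1 paying for eta. *)
Lemma L2_lim_product (p : T -> nat -> R) (phi psi : T -> nat -> C) (u v : C) :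
  F (fun r => forall j, 0 <= p r j) -> F (fun r => is_series (p r) 1) ->
  L2_lim F p phi u -> L2_lim F p psi v ->
  Clim F (fun r => Cser (fun j => RtoC (p r j) * (phi r j * psi r j))%C) (u * v)%C.
Proof.
  intros Hpos Hone [S1 L1] [S2 L2] e He.
  assert (Hu := Cmod_ge_0 u). assert (Hv := Cmod_ge_0 v).
  set (Q := Cmod u + Cmod v). assert (HQ : 0 <= Q) by (unfold Q; lra).
  set (eta := e / (2 * (Q + 1))).
  assert (Heta : 0 < eta) by (apply Rdiv_lt_0_compat; lra).
  assert (Hie := Rinv_0_lt_compat _ Heta).
  set (K := 1 + Q * / eta). assert (HK : 1 <= K) by (unfold K; nra).
  assert (L1' := L1 (e / (8 * K)) ltac:(apply Rdiv_lt_0_compat; lra)).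
  assert (L2' := L2 (e / (8 * K)) ltac:(apply Rdiv_lt_0_compat; lra)).
  generalize (filter_and _ _ (filter_and _ _ Hpos Hone)
    (filter_and _ _ (filter_and _ _ S1 S2) (filter_and _ _ L1' L2'))).
  apply filter_imp. intros r [[Hp H1] [[T1 T2] [E1 E2]]].
  set (g := fun j => Cmod (phi r j - u) ^ 2) in *. set (h := fun j => Cmod (psi r j - v) ^ 2) in *.
  assert (Hb : forall j, 0 <= Cmod (phi r j * psi r j - u * v) <= Q * eta * 1 + K * (g j + h j)).
  { intros j; split; [apply Cmod_ge_0|]. unfold g, h.
    set (x := (phi r j - u)%C). set (y := (psi r j - v)%C).
    replace (phi r j * psi r j - u * v)%C with (x * y + (u * y + v * x))%C by (unfold x, y; ring).
    eapply Rle_trans; [apply Cmod_triangle|]. eapply Rle_trans; [apply Rplus_le_compat_l, Cmod_triangle|].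
    rewrite !Cmod_mult. set (a := Cmod x). set (b := Cmod y).
    assert (Ha : 0 <= a) by apply Cmod_ge_0. assert (Hb : 0 <= b) by apply Cmod_ge_0.
    assert (AG : forall c, 0 <= c -> c <= eta + / eta * c ^ 2).
    { intros c Hc. apply Rmult_le_reg_l with eta; auto.
      replace (eta * (eta + / eta * c ^ 2)) with (eta ^ 2 + c ^ 2) by (field; lra).
      assert (Hq := pow2_ge_0 (eta - c)). nra. }
    assert (A1 := AG a Ha). assert (A2 := AG b Hb).
    assert (Hab := pow2_ge_0 (a - b)).
    assert (B1 : Cmod u * b <= Cmod u * (eta + / eta * b ^ 2)) by (apply Rmult_le_compat_l; auto).
    assert (B2 : Cmod v * a <= Cmod v * (eta + / eta * a ^ 2)) by (apply Rmult_le_compat_l; auto).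
    assert (B3 : a * b <= a ^ 2 + b ^ 2) by nra.
    assert (Z1 : 0 <= Cmod u * / eta * a ^ 2) by (apply Rmult_le_pos; [nra|apply pow2_ge_0]).
    assert (Z2 : 0 <= Cmod v * / eta * b ^ 2) by (apply Rmult_le_pos; [nra|apply pow2_ge_0]).
    unfold K, Q. nra. }
  assert (Hs1 : ex_series (fun j => p r j * 1)).
  { apply ex_series_ext with (p r); [intros; symmetry; apply Rmult_1_r|eexists; eauto]. }
  destruct (Ex_scal (p r) (fun _ => 1) (Q * eta) Hs1) as [S3 E3].
  destruct (Ex_plus (p r) g h T1 T2) as [S4 E4].
  destruct (Ex_scal (p r) _ K S4) as [S5 E5].
  destruct (Ex_plus _ _ _ S3 S5) as [S6 E6].
  assert (Hs : abssum (fun j => RtoC (p r j) * (phi r j * psi r j - u * v))%C).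
  { apply abssum_le with (2 := S6). intros j. rewrite Cmod_mult, Cmod_R, Rabs_pos_eq by auto.
    apply Rmult_le_compat_l; auto. apply Hb. }
  assert (Hs0 : abssum (fun j => RtoC (p r j) * (u * v))%C).
  { apply abssum_ext with (fun j => u * v * RtoC (p r j))%C; [intros; ring|].
    apply abssum_scal, abssum_RtoC; auto. eexists; eauto. }
  assert (Ec : (Cser (fun j => RtoC (p r j) * (phi r j * psi r j)) - u * v)%C
     = Cser (fun j => RtoC (p r j) * (phi r j * psi r j - u * v))%C).
  { rewrite (Cser_ext (fun j => RtoC (p r j) * (phi r j * psi r j))%C
      (fun j => RtoC (p r j) * (phi r j * psi r j - u * v) + RtoC (p r j) * (u * v))%C) by (intros; ring).
    rewrite Cser_plus by auto.
    rewrite (Cser_ext (fun j => RtoC (p r j) * (u * v))%C (fun j => u * v * RtoC (p r j))%C) by (intros; ring).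
    rewrite Cser_scal, Cser_RtoC, (is_series_unique _ _ H1).
    - ring.
    - apply abssum_RtoC; auto. eexists; eauto. }
  rewrite Ec. eapply Rle_lt_trans; [apply Cser_norm; auto|].
  assert (Hfin : Ex (p r) (fun j => Cmod (phi r j * psi r j - u * v)) <= Q * eta * 1 + K * (Ex (p r) g + Ex (p r) h)).
  { eapply Rle_trans; [apply Ex_le with (3 := S6); auto|]. rewrite E6, E5, E4, E3.
    right. do 2 f_equal. unfold Ex. rewrite (Series_ext _ (p r)) by (intros; ring).
    apply is_series_unique; auto. }
  replace (Series _) with (Ex (p r) (fun j => Cmod (phi r j * psi r j - u * v))).
  2: { apply Series_ext; intros j. rewrite Cmod_mult, Cmod_R, Rabs_pos_eq; auto. }
  eapply Rle_lt_trans; [exact Hfin|].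
  assert (A1 : Q * eta * 1 <= e / 2).
  { replace (e / 2) with ((Q + 1) * eta) by (unfold eta; field; lra). nra. }
  assert (A2 : K * (Ex (p r) g + Ex (p r) h) <= K * (e / (8 * K) + e / (8 * K)))
    by (apply Rmult_le_compat_l; lra).
  replace (K * (e / (8 * K) + e / (8 * K))) with (e / 4) in A2 by (field; lra). lra.
Qed.

End Concentration.

(** * The Poisson laws *)

Definition pois (y : R) (j : nat) : R := exp (- y) * (y ^ j / INR (fact j)).

Lemma pois_pos y j : 0 <= y -> 0 <= pois y j.
Proof.
  intros Hy; apply Rmult_le_pos; [left; apply exp_pos|].
  apply Rdiv_le_0_compat; [apply pow_le; auto|apply INR_fact_lt_0].
Qed.

Lemma pois_one y : is_series (pois y) 1.
Proof.
  replace 1 with (exp (- y) * exp y) by (rewrite <- exp_plus, <- exp_0; f_equal; ring).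
  apply (is_series_scal (V := R_NormedModule)), is_series_exp.
Qed.

Lemma pois_sum y i : 0 <= y -> ex_series (fun j => pois y j * (INR j + 1) ^ i).
Proof.
  intros Hy. apply ex_series_ext with (fun j => exp (- y) * ((INR j + 1) ^ i * (y ^ j / INR (fact j)))).
  - intros j; unfold pois. rewrite Rmult_assoc; f_equal; apply Rmult_comm.
  - apply ex_series_scal_R, ex_series_poly_exp; auto.
Qed.

Lemma pois_bias y j : (INR j + 1) * pois y (S j) = y * pois y j.
Proof.
  unfold pois. rewrite fact_simpl, mult_INR, S_INR, <- tech_pow_Rmult.
  field. split; [apply INR_fact_neq_0|generalize (INR1_pos j); lra].
Qed.

Lemma pois_Wm_bound m : exists B, 0 < B /\ forall y, 1 <= y ->
  ex_series (fun j => pois y j * Wm m ((INR j + 1) / y)) /\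
  Ex (pois y) (fun j => Wm m ((INR j + 1) / y)) <= B.
Proof.
  set (D := fun y => 1 <= y).
  assert (H1 : forall y j, D y -> 0 <= pois y j) by (intros; apply pois_pos; unfold D in *; lra).
  assert (H2 : forall y, D y -> is_series (pois y) 1) by (intros; apply pois_one).
  assert (H3 : forall y i, D y -> ex_series (fun j => pois y j * (INR j + 1) ^ i))
    by (intros; apply pois_sum; unfold D in *; lra).
  assert (H4 : forall y j, D y -> (INR j + 1) * pois y (S j) = y * pois y j)
    by (intros; apply pois_bias).
  destruct (weights_Wm_bound D pois (fun y => y) (fun y => y) (fun y => y) 1 1) with (m := m)
    as [B [HB H]]; unfold D in *; auto; try (intros; lra).
  { intros r Hr. right; exists r; repeat split; auto; lra. }
  exists B; split; auto. intros y Hy; split; auto.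
  apply (weights_Wm_summable D pois (fun y => y)); unfold D; auto; intros; apply pois_sum; lra.
Qed.

Lemma pois_var y : 1 <= y ->
  ex_series (fun j => pois y j * (INR j + 1 - y) ^ 2) /\
  Ex (pois y) (fun j => (INR j + 1 - y) ^ 2) <= y + 1.
Proof.
  intros Hy. set (D := fun y => 1 <= y).
  replace (y + 1) with (y * 0 + y + 1) by ring.
  apply (weights_variance D pois (fun y => y) (fun y => y) (fun y => y)); unfold D; auto;
    intros; try lra; auto using pois_one, pois_bias; [apply pois_pos; lra|apply pois_sum; lra].
Qed.

Lemma pois_concentrated :
  concentrated (Rbar_locally p_infty) pois (fun y j => (INR j + 1) / y) (fun y => y).
Proof.
  assert (HF : Rbar_locally p_infty (fun y => 1 <= y)) by (exists 1; intros; lra).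
  assert (HV : forall y, 1 <= y ->
     ex_series (fun j => pois y j * ((INR j + 1) / y - 1) ^ 2) /\
     Ex (pois y) (fun j => ((INR j + 1) / y - 1) ^ 2) <= 2 * / y).
  { intros y Hy. destruct (pois_var y Hy) as [S E].
    destruct (Ex_scal _ _ (/ y ^ 2) S) as [S1 E1].
    assert (Eq : forall j, pois y j * (/ y ^ 2 * (INR j + 1 - y) ^ 2) = pois y j * ((INR j + 1) / y - 1) ^ 2)
      by (intros; field; lra).
    split; [apply ex_series_ext with (1 := Eq); auto|].
    unfold Ex at 1; rewrite <- (Series_ext _ _ Eq).
    change (Ex (pois y) (fun j => / y ^ 2 * (INR j + 1 - y) ^ 2) <= 2 * / y). rewrite E1.
    apply Rle_trans with (/ y ^ 2 * (y + 1)).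
    - apply Rmult_le_compat_l; auto. left; apply Rinv_0_lt_compat; nra.
    - apply Rmult_le_reg_l with (y ^ 2); [nra|]. field_simplify; nra. }
  assert (Hinv : small (Rbar_locally p_infty) (fun y => / y)).
  { intros e He. exists (Rmax 1 (/ e)). intros y Hy.
    assert (H1 := Rmax_l 1 (/ e)). assert (H2 := Rmax_r 1 (/ e)).
    assert (H3 := Rinv_0_lt_compat _ He).
    rewrite <- (Rinv_inv e). apply Rinv_lt_contravar; nra. }
  split.
  - revert HF; apply filter_imp; intros y Hy; split; [lra|]. intros j; split.
    + apply pois_pos; lra.
    + apply Rdiv_lt_0_compat; [apply INR1_pos|lra].
  - apply filter_forall; intros; apply pois_one.
  - intros m. destruct (pois_Wm_bound m) as [B [_ H]]. exists B.
    revert HF; apply filter_imp; intros y Hy; auto.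
  - revert HF; apply filter_imp; intros y Hy; apply HV; auto.
  - apply (small_le (Rbar_locally p_infty)) with (fun y => 2 * / y).
    + revert HF; apply filter_imp; intros y Hy; apply HV; auto.
    + apply (small_scal (Rbar_locally p_infty)); auto; lra.
  - exact Hinv.
Qed.

(** The Abelian theorem for Borel means on the real axis: mean-square convergence under the Poisson
    laws, with the constant 1 as second factor in [L2_lim_product]. *)
Lemma borel_abelian (A : nat -> C) (s K : C) : power_like A s K ->
  Clim (Rbar_locally p_infty)
    (fun y => Cser (fun j => RtoC (pois y j) * A j) / Cpower (RtoC y) s)%C K.
Proof.
  intros H. destruct (power_like_sq A s K H) as [m Hm].
  assert (HF : Rbar_locally p_infty (fun y => 1 <= y)) by (exists 1; intros; lra).
  assert (L : L2_lim (Rbar_locally p_infty) pois (fun y j => A j / Cpower (RtoC y) s)%C K).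
  { apply (L2_of_bound (Rbar_locally p_infty)) with (1 := pois_concentrated) (m := m).
    intros eps Heps. destruct (Hm eps Heps) as [B [HB Hb]]. exists B; split; auto.
    revert HF; apply filter_imp; intros y Hy j. apply Hb; lra. }
  assert (P := L2_lim_product (Rbar_locally p_infty) pois (fun y j => A j / Cpower (RtoC y) s)%C (fun _ _ => RtoC 1) K 1).
  rewrite Cmult_1_r in P.
  assert (P' : Clim (Rbar_locally p_infty) (fun y => Cser (fun j => RtoC (pois y j) *
    (A j / Cpower (RtoC y) s * 1))%C) K).
  { apply P; auto.
    - revert HF; apply filter_imp; intros y Hy j; apply pois_pos; lra.
    - apply filter_forall; intros; apply pois_one.
    - apply (L2_lim_const (Rbar_locally p_infty)). }
  assert (HA : exists D M, forall j, Cmod (A j) <= M * (INR j + 1) ^ D).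
  { destruct (bounded_of_Clim _ _ H) as [M [HM Hb]].
    destruct (INR_unbounded (Re s)) as [D HD]. exists D, M. intros j.
    specialize (Hb j). rewrite Cmod_div, Cmod_Cpower_pos in Hb by (apply INR1_pos || apply Cpower_neq_0).
    assert (Hr := Rpower_pos (INR j + 1) (Re s)).
    apply Rmult_le_compat_r with (r := Rpower (INR j + 1) (Re s)) in Hb; [|lra].
    unfold Rdiv in Hb; rewrite Rmult_assoc, Rinv_l, Rmult_1_r in Hb by lra.
    eapply Rle_trans; [exact Hb|]. apply Rmult_le_compat_l; [lra|].
    rewrite <- Rpower_pow by apply INR1_pos. apply Rle_Rpower; [apply INR1_ge1|lra]. }
  destruct HA as [D [M HA]].
  apply (Clim_ext_loc (Rbar_locally p_infty)) with (2 := P').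
  revert HF; apply filter_imp; intros y Hy.
  unfold Cdiv. rewrite Cmult_comm, <- Cser_scal.
  - apply Cser_ext; intros j; ring.
  - apply abssum_le with (fun j => M * (pois y j * (INR j + 1) ^ D)).
    + intros j. assert (Hp := pois_pos y j ltac:(lra)).
      rewrite Cmod_mult, Cmod_R, Rabs_pos_eq by auto. specialize (HA j). nra.
    + apply ex_series_scal_R, pois_sum; lra.
Qed.

(** * The negative binomial laws *)

Definition nb (w : R) (n j : nat) : R :=
  INR (fact (n + j)) / (INR (fact n) * INR (fact j)) * w ^ j * (1 - w) ^ S n.

Lemma bcoef_INR n j : bcoef (RtoC (INR n + 1)) j = RtoC (INR (fact (n + j)) / (INR (fact n) * INR (fact j))).
Proof.
  unfold bcoef. assert (Hn := INR_fact_neq_0 n). assert (Hj := INR_fact_neq_0 j).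
  replace (poch (RtoC (INR n + 1)) j) with (RtoC (INR (fact (n + j)) / INR (fact n))).
  - rewrite <- RtoC_div by auto. f_equal; field; auto.
  - clear Hj. induction j as [|j IH].
    + rewrite Nat.add_0_r. simpl. f_equal; field; auto.
    + simpl poch. rewrite <- IH, <- RtoC_plus, <- RtoC_mult. f_equal.
      rewrite Nat.add_succ_r, fact_simpl, mult_INR, S_INR, plus_INR. field; auto.
Qed.

Section NegativeBinomial.

Variable w : R.
Hypothesis Hw : 0 < w < 1.

Lemma nb_pos n j : 0 <= nb w n j.
Proof.
  unfold nb. apply Rmult_le_pos; [apply Rmult_le_pos|]; try (apply pow_le; lra).
  apply Rdiv_le_0_compat; [left; apply INR_fact_lt_0|].
  apply Rmult_lt_0_compat; apply INR_fact_lt_0.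
Qed.

Lemma nb_bcoef n j : RtoC (nb w n j) = (RtoC ((1 - w) ^ S n) * (bcoef (RtoC (INR n + 1)) j * RtoC w ^ j))%C.
Proof. rewrite bcoef_INR, <- RtoC_pow, <- !RtoC_mult. unfold nb. f_equal; ring. Qed.

Lemma nb_sum n i : ex_series (fun j => nb w n j * (INR j + 1) ^ i).
Proof.
  destruct (bcoef_poly_bound (RtoC (INR n + 1))) as [D HD].
  apply ex_series_le_R with (fun j => (1 - w) ^ S n * ((INR j + 1) ^ (D + i) * w ^ j)).
  - intros j. assert (Hn := nb_pos n j). assert (Hj := INR1_pos j).
    split; [apply Rmult_le_pos; auto; apply pow_le; lra|].
    rewrite <- (Rabs_pos_eq (nb w n j)), <- Cmod_R, nb_bcoef by auto.
    rewrite !Cmod_mult, Cmod_R, Cmod_pow, Cmod_R, (Rabs_pos_eq w), Rabs_pos_eq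
      by (try apply pow_le; lra).
    rewrite Rmult_assoc. apply Rmult_le_compat_l; [apply pow_le; lra|].
    rewrite pow_add. replace ((INR j + 1) ^ D * (INR j + 1) ^ i * w ^ j)
      with ((INR j + 1) ^ D * w ^ j * (INR j + 1) ^ i) by ring.
    apply Rmult_le_compat_r; [apply pow_le; lra|].
    apply Rmult_le_compat_r; [apply pow_le; lra|auto].
  - apply ex_series_scal_R, ex_series_poly_geom; lra.
Qed.

Lemma nb_one n : is_series (nb w n) 1.
Proof.
  assert (Hs : ex_series (nb w n)).
  { apply ex_series_ext with (2 := nb_sum n 0). intros j; simpl; apply Rmult_1_r. }
  assert (HwC : Cmod (RtoC w) < 1) by (rewrite Cmod_R, Rabs_pos_eq; lra).
  replace 1 with (Series (nb w n)); [apply Series_correct; auto|].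
  apply RtoC_inj. rewrite <- Cser_RtoC, (Cser_ext _ _ (nb_bcoef n)), Cser_scal
    by (apply abssum_binom; auto).
  rewrite <- binomial_series, <- RtoC_minus by auto.
  rewrite <- S_INR, Cpower_opp, Cpower_INR by lra. rewrite Cinv_r; auto.
  apply RtoC_neq_0, pow_nonzero; lra.
Qed.

Lemma nb_bias n j : (INR j + 1) * nb w n (S j) = (INR n + 1) * (w / (1 - w)) * nb w (S n) j.
Proof.
  unfold nb. rewrite Nat.add_succ_r, Nat.add_succ_l, (fact_simpl j), (fact_simpl n), !mult_INR, !S_INR.
  rewrite <- (tech_pow_Rmult w), <- (tech_pow_Rmult (1 - w) (S n)).
  field. repeat split; try apply INR_fact_neq_0; try lra; generalize (INR1_pos j) (INR1_pos n); lra.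
Qed.

Definition nb_mean (n : nat) : R := (INR n + 1) * (w / (1 - w)).
(** The mean of n + j + 1; it also serves as the scale M, being at least 1 and comparable with
    [nb_mean]. *)
Definition nb_size (n : nat) : R := (INR n + 1) / (1 - w).

Lemma nb_ratio_pos : 0 < / (1 - w).
Proof. apply Rinv_0_lt_compat; lra. Qed.

Lemma nb_mean_size n : nb_mean n = w * nb_size n.
Proof. unfold nb_mean, nb_size; field; lra. Qed.

Lemma nb_size_ge1 n : 1 <= nb_size n.
Proof.
  unfold nb_size. assert (H := INR1_ge1 n). apply Rmult_le_reg_r with (1 - w); [lra|].
  unfold Rdiv; rewrite Rmult_assoc, Rinv_l; lra.
Qed.

Lemma nb_size_S n : nb_size (S n) = nb_size n + / (1 - w).
Proof. unfold nb_size; rewrite S_INR; field; lra. Qed.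

Lemma nb_size_ge n : / (1 - w) <= nb_size n.
Proof.
  unfold nb_size, Rdiv. assert (H := INR1_ge1 n). assert (H2 := nb_ratio_pos). nra.
Qed.

Lemma nb_Wm_bound m : exists B, 0 < B /\ forall n,
  ex_series (fun j => nb w n j * Wm m ((INR j + 1) / nb_size n)) /\
  Ex (nb w n) (fun j => Wm m ((INR j + 1) / nb_size n)) <= B.
Proof.
  assert (Hr := nb_ratio_pos).
  assert (Hms : forall n, True -> 0 < nb_mean n <= nb_size n).
  { intros n _; rewrite nb_mean_size. assert (H := nb_size_ge1 n). nra. }
  (* w / 2 combines mean = w size with size (n + 1) <= 2 size n; 1 / (1 - w) is the size at 0, the
     one index without predecessor. *)
  destruct (weights_Wm_bound (fun _ => True) (nb w) nb_mean nb_size S (w / 2) (/ (1 - w))) with (m := m)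
    as [B [HB H]]; auto using nb_pos, nb_one, nb_sum, nb_size_ge1; try lra.
  - intros n j _; apply nb_bias.
  - intros n _; rewrite nb_size_S. assert (H := nb_size_ge n). lra.
  - rewrite <- Rinv_1. apply Rinv_le_contravar; lra.
  - intros [|n] _.
    + left; unfold nb_size; simpl; right; field; lra.
    + right; exists n; repeat split; auto.
      * rewrite nb_size_S, nb_mean_size. assert (H := nb_size_ge n). nra.
      * rewrite nb_size_S. assert (H := nb_size_ge n). lra.
  - exists B; split; auto. intros n; split; auto.
    apply (weights_Wm_summable (fun _ => True) (nb w) nb_size); auto using nb_pos, nb_one, nb_sum, nb_size_ge1.
Qed.

Lemma nb_var n :
  ex_series (fun j => nb w n j * (INR j + 1 - nb_mean n) ^ 2) /\
  Ex (nb w n) (fun j => (INR j + 1 - nb_mean n) ^ 2) <= (2 + / (1 - w)) * nb_size n.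
Proof.
  assert (Hr := nb_ratio_pos).
  assert (Hms : forall n, True -> 0 < nb_mean n <= nb_size n).
  { intros k _; rewrite nb_mean_size. assert (H := nb_size_ge1 k). nra. }
  destruct (weights_variance (fun _ => True) (nb w) nb_mean nb_size S (/ (1 - w))) with (r := n) as [S1 E1];
    auto using nb_pos, nb_one, nb_sum.
  - intros k j _; apply nb_bias.
  - intros k _; rewrite !nb_mean_size, nb_size_S. nra.
  - split; auto. assert (H := Hms n I). assert (H1 := nb_size_ge1 n). nra.
Qed.

Lemma nb_size_inv_small : small eventually (fun n => / nb_size n).
Proof.
  intros e He. assert (H := is_lim_seq_inv_INR1). apply is_lim_seq_spec in H.
  destruct (H (mkposreal e He)) as [N HN]. exists N; intros n Hn; specialize (HN n Hn); simpl in HN.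
  apply Rabs_def2 in HN. unfold nb_size. rewrite Rinv_div.
  assert (Hn1 := Rinv_0_lt_compat _ (INR1_pos n)). unfold Rdiv; nra.
Qed.

Lemma nb_concentrated_l :
  concentrated eventually (nb w) (fun n j => (INR j + 1) / nb_mean n) nb_mean.
Proof.
  assert (Hr := nb_ratio_pos).
  assert (Hmp : forall n, 0 < nb_mean n).
  { intros n; rewrite nb_mean_size. assert (H := nb_size_ge1 n). nra. }
  assert (HV : forall n,
     ex_series (fun j => nb w n j * ((INR j + 1) / nb_mean n - 1) ^ 2) /\
     Ex (nb w n) (fun j => ((INR j + 1) / nb_mean n - 1) ^ 2) <= (2 + / (1 - w)) * / w ^ 2 * / nb_size n).
  { intros n. destruct (nb_var n) as [S E]. assert (Hm := Hmp n). assert (H1 := nb_size_ge1 n).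
    destruct (Ex_scal _ _ (/ nb_mean n ^ 2) S) as [S1 E1].
    assert (Eq : forall j, nb w n j * (/ nb_mean n ^ 2 * (INR j + 1 - nb_mean n) ^ 2)
       = nb w n j * ((INR j + 1) / nb_mean n - 1) ^ 2) by (intros; field; lra).
    split; [apply ex_series_ext with (1 := Eq); auto|].
    unfold Ex at 1; rewrite <- (Series_ext _ _ Eq).
    change (Ex (nb w n) (fun j => / nb_mean n ^ 2 * (INR j + 1 - nb_mean n) ^ 2)
      <= (2 + / (1 - w)) * / w ^ 2 * / nb_size n). rewrite E1.
    apply Rle_trans with (/ nb_mean n ^ 2 * ((2 + / (1 - w)) * nb_size n)).
    - apply Rmult_le_compat_l; auto. left; apply Rinv_0_lt_compat; nra.
    - rewrite nb_mean_size. right; field; lra. }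
  split.
  - apply filter_forall; intros n; split; auto. intros j; split; [apply nb_pos|].
    apply Rdiv_lt_0_compat; auto. apply INR1_pos.
  - apply filter_forall; intros; apply nb_one.
  - intros m. destruct (nb_Wm_bound m) as [B [HB H]]. exists (Wm m (/ w) * B).
    assert (Hiw : 0 < / w) by (apply Rinv_0_lt_compat; lra).
    apply filter_forall; intros n. destruct (H n) as [S E].
    destruct (Ex_scal _ _ (Wm m (/ w)) S) as [S1 E1].
    assert (Hle : forall j, 0 <= Wm m ((INR j + 1) / nb_mean n) <= Wm m (/ w) * Wm m ((INR j + 1) / nb_size n)).
    { intros j. assert (H1 := nb_size_ge1 n). assert (Hj := INR1_pos j).
      assert (Hq : 0 < (INR j + 1) / nb_size n) by (apply Rdiv_lt_0_compat; lra).
      replace ((INR j + 1) / nb_mean n) with (/ w * ((INR j + 1) / nb_size n))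
        by (rewrite nb_mean_size; field; lra).
      split; [|apply Wm_scale; auto].
      assert (W := Wm_ge2 m (/ w * ((INR j + 1) / nb_size n)) ltac:(nra)). lra. }
    split; [apply Ex_summable_le with (3 := S1); auto using nb_pos|].
    eapply Rle_trans; [apply Ex_le with (3 := S1); auto using nb_pos|]. rewrite E1.
    apply Rmult_le_compat_l; auto. assert (W := Wm_ge2 m (/ w) Hiw). lra.
  - apply filter_forall; intros n; apply HV.
  - apply (small_le eventually) with (fun n => (2 + / (1 - w)) * / w ^ 2 * / nb_size n).
    + apply filter_forall; intros n; apply HV.
    + apply (small_scal eventually); [|apply nb_size_inv_small].
      apply Rmult_le_pos; [lra|]. left; apply Rinv_0_lt_compat; nra.
  - apply (small_le eventually) with (fun n => / w * / nb_size n).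
    + apply filter_forall; intros n. assert (H1 := nb_size_ge1 n).
      rewrite nb_mean_size, Rinv_mult; lra.
    + apply (small_scal eventually); [|apply nb_size_inv_small]. left; apply Rinv_0_lt_compat; lra.
Qed.

(** The ratio equals (1 - w) + j / size. It is bounded below by 1 - w, so its negative powers are
    harmless, and its deviation from 1 is that of j up to a shift by 1 / size. *)
Lemma nb_concentrated_r :
  concentrated eventually (nb w) (fun n j => (INR (n + j) + 1) / nb_size n) nb_size.
Proof.
  assert (Hr := nb_ratio_pos).
  assert (Hx : forall n j, (INR (n + j) + 1) / nb_size n = (1 - w) + INR j / nb_size n).
  { intros n j. rewrite plus_INR. unfold nb_size. assert (Hn := INR1_pos n). field; lra. }
  assert (HV : forall n,
     ex_series (fun j => nb w n j * ((INR (n + j) + 1) / nb_size n - 1) ^ 2) /\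
     Ex (nb w n) (fun j => ((INR (n + j) + 1) / nb_size n - 1) ^ 2) <= (2 * (2 + / (1 - w)) + 2) * / nb_size n).
  { intros n. destruct (nb_var n) as [S E]. assert (H1 := nb_size_ge1 n).
    assert (Hi : 0 < / nb_size n <= 1).
    { split; [apply Rinv_0_lt_compat; lra|]. rewrite <- Rinv_1; apply Rinv_le_contravar; lra. }
    destruct (Ex_scal _ _ (2 * / nb_size n ^ 2) S) as [S1 E1].
    assert (S2 : ex_series (fun j => nb w n j * (2 * / nb_size n ^ 2))).
    { apply ex_series_ext with (fun j => (2 * / nb_size n ^ 2) * nb w n j); [intros; apply Rmult_comm|].
      apply ex_series_scal_R. eexists; apply nb_one. }
    destruct (Ex_plus _ _ _ S1 S2) as [S3 E3].
    assert (Hle : forall j, 0 <= ((INR (n + j) + 1) / nb_size n - 1) ^ 2 <=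
       2 * / nb_size n ^ 2 * (INR j + 1 - nb_mean n) ^ 2 + 2 * / nb_size n ^ 2).
    { intros j; split; [apply pow2_ge_0|].
      rewrite Hx, nb_mean_size.
      replace (1 - w + INR j / nb_size n - 1)
        with (/ nb_size n * ((INR j + 1 - w * nb_size n) + (-1))) by (field; lra).
      rewrite Rpow_mult_distr, pow_inv.
      assert (Q := sq_add_le (INR j + 1 - w * nb_size n) (-1)).
      replace (2 * / nb_size n ^ 2 * (INR j + 1 - w * nb_size n) ^ 2 + 2 * / nb_size n ^ 2)
        with (/ nb_size n ^ 2 * (2 * (INR j + 1 - w * nb_size n) ^ 2 + 2 * (-1) ^ 2)) by ring.
      apply Rmult_le_compat_l; auto. left; apply Rinv_0_lt_compat; nra. }
    split; [apply Ex_summable_le with (3 := S3); auto using nb_pos|].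
    eapply Rle_trans; [apply Ex_le with (3 := S3); auto using nb_pos|]. rewrite E3, E1.
    replace (Ex (nb w n) (fun _ => 2 * / nb_size n ^ 2)) with (2 * / nb_size n ^ 2).
    2: { unfold Ex. rewrite (Series_ext _ (fun j => (2 * / nb_size n ^ 2) * nb w n j)) by (intros; ring).
         rewrite Series_scal_l, (is_series_unique _ _ (nb_one n)); ring. }
    assert (Hi2 : 0 < / nb_size n ^ 2) by (apply Rinv_0_lt_compat; nra).
    assert (Hi3 : / nb_size n ^ 2 * nb_size n = / nb_size n) by (field; lra).
    assert (Hi4 : / nb_size n ^ 2 <= / nb_size n) by (rewrite <- Hi3; nra).
    assert (B : 2 * / nb_size n ^ 2 * Ex (nb w n) (fun j => (INR j + 1 - nb_mean n) ^ 2) <=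
       2 * / nb_size n ^ 2 * ((2 + / (1 - w)) * nb_size n)) by (apply Rmult_le_compat_l; lra).
    replace (2 * / nb_size n ^ 2 * ((2 + / (1 - w)) * nb_size n))
      with (2 * (2 + / (1 - w)) * (/ nb_size n ^ 2 * nb_size n)) in B by ring.
    rewrite Hi3 in B. lra. }
  split.
  - apply filter_forall; intros n; assert (H1 := nb_size_ge1 n); split; [lra|].
    intros j; split; [apply nb_pos|]. apply Rdiv_lt_0_compat; [apply INR1_pos|lra].
  - apply filter_forall; intros; apply nb_one.
  - intros m. destruct (nb_Wm_bound m) as [B [HB H]].
    set (c := 2 ^ m + (/ (1 - w)) ^ m).
    assert (Hc1 : 0 < 2 ^ m) by (apply pow_lt; lra).
    assert (Hc2 : 0 < (/ (1 - w)) ^ m) by (apply pow_lt; auto).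
    exists (c * B).
    apply filter_forall; intros n. destruct (H n) as [S E].
    destruct (Ex_scal _ _ c S) as [S1 E1].
    assert (Hle : forall j, 0 <= Wm m ((INR (n + j) + 1) / nb_size n) <= c * Wm m ((INR j + 1) / nb_size n)).
    { intros j. assert (H1 := nb_size_ge1 n). assert (Hj := INR1_pos j). assert (Hj0 := pos_INR j).
      set (q := (INR j + 1) / nb_size n).
      assert (Hq : 0 < q) by (apply Rdiv_lt_0_compat; lra).
      assert (Hjq : 0 <= INR j / nb_size n <= q).
      { split; [apply Rdiv_le_0_compat; lra|]. unfold q, Rdiv. apply Rmult_le_compat_r; [|lra].
        left; apply Rinv_0_lt_compat; lra. }
      rewrite Hx. set (x := 1 - w + INR j / nb_size n).
      assert (Hx1 : 1 - w <= x <= 1 + q) by (unfold x; lra).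
      assert (W := Wm_ge2 m x ltac:(lra)). assert (Wq := Wm_ge2 m q Hq). split; [lra|].
      unfold Wm at 1. unfold c. rewrite Rmult_plus_distr_r. apply Rplus_le_compat.
      - apply Rle_trans with ((1 + q) ^ m); [apply pow_incr; lra|].
        destruct (Rle_lt_dec q 1).
        + apply Rle_trans with (2 ^ m); [apply pow_incr; lra|nra].
        + apply Rle_trans with (2 ^ m * q ^ m).
          * rewrite <- Rpow_mult_distr. apply pow_incr; lra.
          * apply Rmult_le_compat_l; [lra|]. unfold Wm. assert (0 < (/ q) ^ m); [|lra].
            apply pow_lt, Rinv_0_lt_compat; auto.
      - apply Rle_trans with ((/ (1 - w)) ^ m); [|nra]. apply pow_incr; split.
        + left; apply Rinv_0_lt_compat; lra.
        + apply Rinv_le_contravar; lra. }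
    split; [apply Ex_summable_le with (3 := S1); auto using nb_pos|].
    eapply Rle_trans; [apply Ex_le with (3 := S1); auto using nb_pos|]. rewrite E1.
    apply Rmult_le_compat_l; auto. unfold c; lra.
  - apply filter_forall; intros n; apply HV.
  - apply (small_le eventually) with (fun n => (2 * (2 + / (1 - w)) + 2) * / nb_size n).
    + apply filter_forall; intros n; apply HV.
    + apply (small_scal eventually); [lra|apply nb_size_inv_small].
  - apply nb_size_inv_small.
Qed.

(** alpha is read at n + j, of size [nb_size], and beta at j, of size [nb_mean]; each is normalised
    by its own scale. *)
Lemma nb_abelian (alpha beta : nat -> C) (s t u v : C) :
  power_like alpha s u -> power_like beta t v ->
  Clim eventually (fun n => Cser (fun j => RtoC (nb w n j) *
     (alpha (n + j)%nat / Cpower (RtoC (nb_size n)) s * (beta j / Cpower (RtoC (nb_mean n)) t)))%C) (u * v)%C.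
Proof.
  intros Ha Hb. apply (L2_lim_product eventually).
  - apply filter_forall; intros; apply nb_pos.
  - apply filter_forall; intros; apply nb_one.
  - destruct (power_like_sq alpha s u Ha) as [m Hm].
    apply (L2_of_bound eventually) with (1 := nb_concentrated_r) (m := m).
    intros eps Heps; destruct (Hm eps Heps) as [B [HB H]]; exists B; split; auto.
    apply filter_forall; intros n j. apply H. assert (H1 := nb_size_ge1 n); lra.
  - destruct (power_like_sq beta t v Hb) as [m Hm].
    apply (L2_of_bound eventually) with (1 := nb_concentrated_l) (m := m).
    intros eps Heps; destruct (Hm eps Heps) as [B [HB H]]; exists B; split; auto.
    apply filter_forall; intros n j. apply H. rewrite nb_mean_size. assert (H1 := nb_size_ge1 n); nra.
Qed.

End NegativeBinomial.

(** * The coefficients of Psi_1 and their differences *)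

Lemma power_like_bcoef (z : C) : ~ nonpos_int z -> power_like (bcoef z) (z - 1) (/ CGamma z)%C.
Proof.
  intros Hz. apply (Clim_ext eventually) with (2 := proj2 (gamma_lim z Hz)).
  intros n; unfold rho, bcoef. field.
  split; [apply RtoC_fact_neq_0|apply Cpower_neq_0].
Qed.

Lemma power_like_mult (f g : nat -> C) (s t u v : C) :
  power_like f s u -> power_like g t v -> power_like (fun n => f n * g n)%C (s + t) (u * v)%C.
Proof.
  intros Hf Hg. apply (Clim_ext eventually) with (2 := Clim_mult eventually _ _ _ _ Hf Hg).
  intros n. rewrite Cpower_add. field. split; apply Cpower_neq_0.
Qed.

Lemma power_like_inv (f : nat -> C) (s u : C) : (forall n, f n <> RtoC 0) -> u <> RtoC 0 ->
  power_like f s u -> power_like (fun n => / f n)%C (- s) (/ u)%C.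
Proof.
  intros Hf0 Hu Hf. apply (Clim_ext eventually) with (2 := Clim_inv eventually _ _ Hu Hf).
  intros n. rewrite Cpower_opp. field. split; auto. apply Cpower_neq_0.
Qed.

Lemma power_like_ext (f g : nat -> C) (s t u v : C) :
  (forall n, f n = g n) -> s = t -> u = v -> power_like f s u -> power_like g t v.
Proof.
  intros E -> -> H. apply (Clim_ext eventually) with (2 := H). intros n; rewrite E; auto.
Qed.

Lemma Pfaff_ratio (x : R) : x < 0 -> let w := - x / (1 - x) in
  0 < w < 1 /\ 1 - w = / (1 - x) /\ w / (1 - w) = - x.
Proof.
  intros Hx w. assert (E : 1 - w = / (1 - x)) by (unfold w; field; lra).
  assert (0 < / (1 - x)) by (apply Rinv_0_lt_compat; lra).
  split; [|split; auto].
  - split; [|lra]. unfold w; apply Rdiv_lt_0_compat; lra.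
  - rewrite E; unfold w; field; lra.
Qed.

Lemma hyp2F1_Pfaff (A b c : C) (x : R) : 0 < Re b -> Re b < Re c -> x < 0 ->
  let w := - x / (1 - x) in
  abssum (fun k => bcoef A k * RtoC (w ^ k) * (poch (c - b) k / poch c k))%C /\
  hyp2F1 A b c (RtoC x) = (Cpower (RtoC (1 - w)) A *
    Cser (fun k => bcoef A k * RtoC (w ^ k) * (poch (c - b) k / poch c k)))%C.
Proof.
  intros Hb Hbc Hx w. destruct (Pfaff_ratio x Hx) as [_ [E _]]. fold w in E.
  destruct (F21_Pfaff A b c x Hb Hbc Hx) as [H1 H2]. fold w in H1, H2.
  split; auto. rewrite hyp2F1_neg, H2, E, Cpower_inv_pos, Cpower_opp by (auto; lra). auto.
Qed.

(** The source of the negative binomial weights: multiplied by (a)_n / n!, the Pfaff series with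
    first parameter a + n becomes an average of [bcoef a] at n + m. *)
Lemma bcoef_split (a : C) n m :
  (bcoef a n * bcoef (a + RtoC (INR n)) m)%C =
  (bcoef a (n + m) * RtoC (INR (fact (n + m)) / (INR (fact n) * INR (fact m))))%C.
Proof.
  unfold bcoef. rewrite poch_add.
  rewrite RtoC_div, RtoC_mult by (apply Rmult_integral_contrapositive; split; apply INR_fact_neq_0).
  field. repeat split; apply RtoC_fact_neq_0.
Qed.

(** [nb_abelian] is applied to [bcoef a], of order a - 1, and to (c - b)_j / (c)_j, of order - b.
    The powers of 1 - w from Pfaff's prefactor, the weights and [nb_size] cancel, and w / (1 - w) =
    - x leaves (- x)^(-b). Division by [bcoef c'] then lowers the exponent by c' - 1. *)
Lemma power_like_coef (a b c c' : C) (x : R) :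
  0 < Re b -> Re b < Re c -> ~ nonpos_int a -> ~ nonpos_int c' -> x < 0 ->
  power_like (fun n => poch a n / poch c' n * hyp2F1 (a + RtoC (INR n)) b c (RtoC x))%C (a - b - c')
    (CGamma c * CGamma c' / (CGamma a * CGamma (c - b)) * Cpower (- RtoC x) (- b))%C.
Proof.
  intros Hb Hbc Ha Hc' Hx.
  assert (Hc : ~ nonpos_int c) by (apply Re_pos_not_nonpos; lra).
  assert (Hd : ~ nonpos_int (c - b)) by (apply Re_pos_not_nonpos; simpl; unfold Re in *; lra).
  set (w := - x / (1 - x)). destruct (Pfaff_ratio x Hx) as [Hw [_ Hwx]]. fold w in Hw, Hwx.
  assert (Ga := proj1 (gamma_lim a Ha)). assert (Gc := proj1 (gamma_lim c Hc)).
  assert (Gc' := proj1 (gamma_lim c' Hc')). assert (Gd := proj1 (gamma_lim (c - b) Hd)).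
  set (be := fun j => (poch (c - b) j / poch c j)%C).
  assert (Hbe : power_like be (- b) (CGamma c / CGamma (c - b))%C).
  { assert (H := power_like_mult _ _ _ _ _ _ (power_like_bcoef (c - b) Hd)
      (power_like_inv _ _ _ (fun n => bcoef_neq_0 c n Hc) (Cinv_neq_0 _ Gc) (power_like_bcoef c Hc))).
    apply power_like_ext with (4 := H).
    - intros n; unfold be, bcoef. field. split; [apply poch_neq_0; auto|apply RtoC_fact_neq_0].
    - ring.
    - field; auto. }
  assert (Habel := nb_abelian w Hw (bcoef a) be (a - 1) (- b) _ _ (power_like_bcoef a Ha) Hbe).
  assert (HG : power_like (fun n => bcoef a n * hyp2F1 (a + RtoC (INR n)) b c (RtoC x))%C (a - 1 + - b)
    (/ CGamma a * (CGamma c / CGamma (c - b)) * Cpower (- RtoC x) (- b))%C).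
  { assert (Hlim := Clim_scal eventually (Cpower (- RtoC x) (- b)) _ _ Habel).
    replace (/ CGamma a * (CGamma c / CGamma (c - b)) * Cpower (- RtoC x) (- b))%C
      with (Cpower (- RtoC x) (- b) * (/ CGamma a * (CGamma c / CGamma (c - b))))%C by ring.
    apply (Clim_ext eventually) with (2 := Hlim). intros n.
    assert (H1w : 0 < 1 - w) by lra. assert (Hn := INR1_pos n).
    destruct (hyp2F1_Pfaff (a + RtoC (INR n)) b c x Hb Hbc Hx) as [Hs E]. fold w in Hs, E.
    rewrite E.
    assert (Eb : forall k, (RtoC (nb w n k) * (bcoef a (n + k) / Cpower (RtoC (nb_size w n)) (a - 1)
       * (be k / Cpower (RtoC (nb_mean w n)) (- b))))%C =
       (RtoC ((1 - w) ^ S n) / (Cpower (RtoC (nb_size w n)) (a - 1) * Cpower (RtoC (nb_mean w n)) (- b))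
         * bcoef a n * (bcoef (a + RtoC (INR n)) k * RtoC (w ^ k) * (poch (c - b) k / poch c k)))%C).
    { intros k.
      transitivity (RtoC ((1 - w) ^ S n) / (Cpower (RtoC (nb_size w n)) (a - 1) * Cpower (RtoC (nb_mean w n)) (- b))
         * (bcoef a n * bcoef (a + RtoC (INR n)) k) * RtoC (w ^ k) * be k)%C; [|unfold be; ring].
      rewrite bcoef_split. unfold nb. rewrite !RtoC_mult.
      field. split; apply Cpower_neq_0. }
    rewrite (Cser_ext _ _ Eb), Cser_scal by auto.
    set (S0 := Cser _). unfold nb_size, nb_mean. rewrite Hwx.
    unfold Rdiv. rewrite !Cpower_mult_pos by (auto; try lra; apply Rinv_0_lt_compat; lra).
    rewrite (Cpower_inv_pos (1 - w)) by auto.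
    replace (a + RtoC (INR n))%C with ((a - 1) + RtoC (INR (S n)))%C
      by (rewrite S_INR, RtoC_plus; ring).
    rewrite Cpower_add, Cpower_INR by auto.
    rewrite !Cpower_add. rewrite (RtoC_opp x).
    field. repeat split; apply Cpower_neq_0. }
  assert (H := power_like_mult _ _ _ _ _ _ (power_like_inv _ _ _ (fun n => bcoef_neq_0 c' n Hc')
    (Cinv_neq_0 _ Gc') (power_like_bcoef c' Hc')) HG).
  apply power_like_ext with (4 := H).
  - intros n; unfold bcoef. field. split; [apply poch_neq_0; auto|apply RtoC_fact_neq_0].
  - ring.
  - field; auto.
Qed.

(* [A k n] plays the role of the k-th forward difference of [A 0] at n, divided by k!. *)
Definition diff_family (A : nat -> nat -> C) : Prop :=
  forall k n, (RtoC (INR (S k)) * A (S k) n = A k (S n) - A k n)%C.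

(** The factor n! / (n + k)! replaces (n + 1)^(-k) because it is absorbed exactly by Poisson and
    negative binomial weights and telescopes in products. No k! appears, the differences being
    already divided by it. *)
Definition diff_bound (A : nat -> nat -> C) (q : R) : Prop :=
  exists M D, 0 <= M /\ forall k n,
    Cmod (A k n) <= M * (INR k + 1) ^ D * Rpower (INR n + 1) q * (INR (fact n) / INR (fact (n + k))).

(** Leibniz rule for differences divided by k!: the second factor is evaluated at the shifted index
    n + j. *)
Definition diff_product (p g : nat -> nat -> C) (k n : nat) : C :=
  csum (fun j => p j n * g (k - j)%nat (n + j)%nat)%C (S k).

(** k + 1 is split as j + (k + 1 - j) inside the sum; each part lowers one order, and the result
    telescopes between the arguments n and n + 1. *)
Lemma diff_product_family (p g : nat -> nat -> C) :
  diff_family p -> diff_family g -> diff_family (diff_product p g).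
Proof.
  intros Hp Hg k n. unfold diff_product. rewrite <- csum_scal.
  rewrite (csum_ext _ (fun j => (RtoC (INR j) * p j n) * g (S k - j)%nat (n + j)%nat
    + p j n * (RtoC (INR (S k - j)) * g (S k - j)%nat (n + j)%nat))%C).
  2: { intros j Hj. rewrite minus_INR, RtoC_minus by lia. ring. }
  rewrite csum_plus, (csum_S_l (fun j => (RtoC (INR j) * p j n) * _)%C (S k)),
    (csum_S (fun j => p j n * _)%C (S k)), Nat.sub_diag.
  replace (INR 0) with 0 by auto.
  rewrite !Cmult_0_l, Cmult_0_r, Cplus_0_l, Cplus_0_r, <- csum_plus, <- csum_minus.
  apply csum_ext; intros j Hj. rewrite Hp.
  replace (S k - S j)%nat with (k - j)%nat by lia.
  replace (S k - j)%nat with (S (k - j)) by lia. rewrite Hg.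
  replace (n + S j)%nat with (S n + j)%nat by lia. replace (S (n + j)) with (S n + j)%nat by lia.
  ring.
Qed.

(** The sign of q is unknown, so both ratios x / y and y / x have to be at most L. *)
Lemma Rpower_compare (x y L q : R) (D : nat) :
  0 < x -> 0 < y -> 1 <= L -> x <= L * y -> y <= L * x -> Rabs q <= INR D ->
  Rpower x q <= L ^ D * Rpower y q.
Proof.
  intros Hx Hy HL H1 H2 Hq.
  assert (Hq' := proj1 (Rabs_le_between _ _) Hq).
  assert (HR := Rpower_pos y q).
  replace (Rpower x q) with (Rpower (x / y) q * Rpower y q).
  2: { rewrite Rpower_mult_distr by (auto; apply Rdiv_lt_0_compat; auto). f_equal; field; lra. }
  apply Rmult_le_compat_r; [lra|]. rewrite <- Rpower_pow by lra.
  assert (Hxy : 0 < x / y) by (apply Rdiv_lt_0_compat; auto).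
  destruct (Rle_lt_dec 1 (x / y)) as [H|H].
  - apply Rle_trans with (Rpower (x / y) (INR D)); [apply Rle_Rpower; lra|].
    apply Rle_Rpower_l; [apply pos_INR|]. split; auto.
    apply Rmult_le_reg_r with y; auto. unfold Rdiv; rewrite Rmult_assoc, Rinv_l; lra.
  - replace (Rpower (x / y) q) with (Rpower (y / x) (- q)).
    2: { unfold Rpower. replace (y / x) with (/ (x / y)) by (field; lra). rewrite ln_Rinv by auto. f_equal; ring. }
    assert (H3 : 1 <= y / x).
    { apply Rmult_le_reg_r with (x / y); auto. replace (y / x * (x / y)) with 1 by (field; lra). lra. }
    apply Rle_trans with (Rpower (y / x) (INR D)); [apply Rle_Rpower; lra|].
    apply Rle_Rpower_l; [apply pos_INR|]. split; [lra|].
    apply Rmult_le_reg_r with x; auto. unfold Rdiv; rewrite Rmult_assoc, Rinv_l; lra.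
Qed.

Lemma Rpower_shift_le n k q (D : nat) : Rabs q <= INR D ->
  Rpower (INR (n + k) + 1) q <= (INR k + 1) ^ D * Rpower (INR n + 1) q.
Proof.
  intros Hq. assert (Hn := pos_INR n). assert (Hk := pos_INR k). rewrite plus_INR.
  apply Rpower_compare; auto; nra.
Qed.

Lemma Rpower_unshift_le n k q (D : nat) : Rabs q <= INR D ->
  Rpower (INR n + 1) q <= (INR k + 1) ^ D * Rpower (INR (n + k) + 1) q.
Proof.
  intros Hq. assert (Hn := pos_INR n). assert (Hk := pos_INR k). rewrite plus_INR.
  apply Rpower_compare; auto; nra.
Qed.

Lemma rsum_le_const (u : nat -> R) n B : (forall k, (k < n)%nat -> u k <= B) -> rsum u n <= INR n * B.
Proof. intros H; rewrite <- rsum_const; apply rsum_le; auto. Qed.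

(** n! / (n + j)! times (n + j)! / (n + k)! telescopes. The shift of the base from n + 1 to n + j +
    1 costs (k + 1)^D3, and the number of terms one more factor k + 1. *)
Lemma diff_product_bound (p g : nat -> nat -> C) q1 q2 :
  diff_bound p q1 -> diff_bound g q2 -> diff_bound (diff_product p g) (q1 + q2).
Proof.
  intros [M1 [D1 [HM1 H1]]] [M2 [D2 [HM2 H2]]].
  destruct (INR_unbounded (Rabs q2)) as [D3 HD3].
  exists (M1 * M2), (S (D1 + D2 + D3)). split; [nra|]. intros k n. unfold diff_product.
  eapply Rle_trans; [apply csum_norm|].
  set (K := INR k + 1). assert (HK : 1 <= K) by apply INR1_ge1.
  set (f := INR (fact n) / INR (fact (n + k))).
  assert (Hf : 0 < f) by (apply Rdiv_lt_0_compat; apply INR_fact_lt_0).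
  assert (HP := Rpower_pos (INR n + 1) q1). assert (HP2 := Rpower_pos (INR n + 1) q2).
  eapply Rle_trans; [apply rsum_le_const with
    (B := M1 * M2 * K ^ (D1 + D2 + D3) * Rpower (INR n + 1) (q1 + q2) * f)|].
  - intros j Hj. rewrite Cmod_mult.
    assert (B1 : Cmod (p j n) <= M1 * K ^ D1 * Rpower (INR n + 1) q1 * (INR (fact n) / INR (fact (n + j)))).
    { eapply Rle_trans; [apply H1|].
      assert (0 < INR (fact n) / INR (fact (n + j))) by (apply Rdiv_lt_0_compat; apply INR_fact_lt_0).
      apply Rmult_le_compat_r; [lra|]. apply Rmult_le_compat_r; [lra|].
      apply Rmult_le_compat_l; auto. apply pow_incr. split; [left; apply INR1_pos|].
      unfold K. assert (INR j <= INR k) by (apply le_INR; lia). lra. }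
    assert (B2 : Cmod (g (k - j)%nat (n + j)%nat) <= M2 * K ^ D2 * (K ^ D3 * Rpower (INR n + 1) q2)
      * (INR (fact (n + j)) / INR (fact (n + k)))).
    { eapply Rle_trans; [apply H2|]. replace (n + j + (k - j))%nat with (n + k)%nat by lia.
      assert (0 < INR (fact (n + j)) / INR (fact (n + k))) by (apply Rdiv_lt_0_compat; apply INR_fact_lt_0).
      apply Rmult_le_compat_r; [lra|].
      assert (Hkj := INR1_pos (k - j)).
      apply Rmult_le_compat.
      - apply Rmult_le_pos; auto. apply pow_le; lra.
      - left; apply Rpower_pos.
      - apply Rmult_le_compat_l; auto. apply pow_incr; split; [lra|].
        unfold K. assert (INR (k - j) <= INR k) by (apply le_INR; lia). lra.
      - eapply Rle_trans; [apply (Rpower_shift_le n j q2 D3); lra|].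
        apply Rmult_le_compat_r; [lra|]. apply pow_incr; split; [left; apply INR1_pos|].
        unfold K. assert (INR j <= INR k) by (apply le_INR; lia). lra. }
    eapply Rle_trans; [apply Rmult_le_compat; [apply Cmod_ge_0|apply Cmod_ge_0|exact B1|exact B2]|].
    right. unfold f. rewrite Rpower_plus, !pow_add. field. split; apply INR_fact_neq_0.
  - rewrite S_INR. fold K. right. simpl pow. ring.
Qed.

(** Differences of (a)_n / (c')_n; the recurrence behind them is (a + n) - (c' + n + k) = - (c' - a
    + k). *)
Definition ratio_family (a c' : C) (k n : nat) : C :=
  (RtoC ((-1) ^ k) * bcoef (c' - a) k * poch a n / poch c' (n + k))%C.

Lemma ratio_family_diff (a c' : C) : ~ nonpos_int c' -> diff_family (ratio_family a c').
Proof.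
  intros Hc k n. unfold ratio_family. rewrite Nat.add_succ_r, Nat.add_succ_l.
  rewrite <- tech_pow_Rmult, RtoC_mult.
  transitivity (- RtoC ((-1) ^ k) * (RtoC (INR (S k)) * bcoef (c' - a) (S k)) * poch a n / poch c' (S (n + k)))%C.
  - unfold Cdiv; ring.
  - rewrite bcoef_S. simpl poch. rewrite plus_INR, RtoC_plus.
    assert (H1 := poch_neq_0 c' (n + k) Hc). assert (H2 := poch_neq_0 c' (S (n + k)) Hc).
    simpl poch in H2. rewrite plus_INR, RtoC_plus in H2.
    assert (H3 : (c' + (RtoC (INR n) + RtoC (INR k)))%C <> RtoC 0).
    { intros E; apply H2; rewrite E; ring. }
    field. auto.
Qed.

Lemma ratio_family_bound (a c' : C) : ~ nonpos_int c' -> diff_bound (ratio_family a c') (Re a - Re c').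
Proof.
  intros Hc. destruct (bcoef_poly_bound (c' - a)) as [D1 H1].
  destruct (poch_upper a) as [M2 [HM2 H2]]. destruct (poch_lower c' Hc) as [M3 [HM3 H3]].
  destruct (INR_unbounded (Rabs (1 - Re c'))) as [D2 HD2].
  exists (M2 * M3), (D1 + D2)%nat; split; [nra|]. intros k n. unfold ratio_family.
  unfold Cdiv. rewrite !Cmod_mult, Cmod_R, pow_1_abs, Rmult_1_l.
  rewrite Cmod_inv by (apply poch_neq_0; auto).
  specialize (H1 k). specialize (H2 n). specialize (H3 (n + k)%nat).
  assert (Hf1 := INR_fact_lt_0 n). assert (Hf2 := INR_fact_lt_0 (n + k)). assert (Hk := INR1_pos k).
  assert (B3 : / Cmod (poch c' (n + k)) <= M3 * ((INR k + 1) ^ D2 * Rpower (INR n + 1) (1 - Re c')) / INR (fact (n + k))).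
  { eapply Rle_trans; [exact H3|]. apply Rmult_le_compat_r; [left; apply Rinv_0_lt_compat; auto|].
    apply Rmult_le_compat_l; [lra|]. apply Rpower_shift_le; lra. }
  eapply Rle_trans.
  - apply Rmult_le_compat; [apply Rmult_le_pos; apply Cmod_ge_0| | |exact B3].
    + left; apply Rinv_0_lt_compat, Cmod_gt_0, poch_neq_0; auto.
    + apply Rmult_le_compat; [apply Cmod_ge_0|apply Cmod_ge_0|exact H1|exact H2].
  - right. replace (Re a - Re c') with ((Re a - 1) + (1 - Re c')) by ring.
    rewrite Rpower_plus, pow_add. field. lra.
Qed.

(** * Differences of the Gauss factor in its first parameter *)

Section HypFamily.

Variables (a b c : C) (w : R).
Hypothesis Hb : 0 < Re b.
Hypothesis Hbc : Re b < Re c.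
Hypothesis Ha : ~ nonpos_int a.
Hypothesis Hw : 0 < w < 1.

Let d := (c - b)%C.

Let Hc : ~ nonpos_int c.
Proof. apply Re_pos_not_nonpos; lra. Qed.

Definition hyp_term (k n m : nat) : C :=
  (poch (a + RtoC (INR (n + k))) m * bcoef (c - b) m / poch c (k + m) * RtoC (w ^ m))%C.

(** This is (b)_k / ((c)_k k!) x^k 2F1 (a + n + k, b + k; c + k; x) in Pfaff's form, with x = - w /
    (1 - w): the powers combine by x^k (1 - w)^k = (- w)^k, the denominators by (c)_k (c + k)_m =
    (c)_(k+m). *)
Definition hyp_family (k n : nat) : C :=
  (bcoef b k * RtoC ((- w) ^ k) * Cpower (RtoC (1 - w)) (a + RtoC (INR n)) * Cser (hyp_term k n))%C.

Lemma Wm_square m t : 0 < t -> Wm m t * Wm m t <= 2 * Wm (2 * m) t.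
Proof.
  intros Ht. assert (E := Wm_prod m t Ht). assert (W := Wm_ge2 (2 * m) t Ht).
  replace (Wm m t * Wm m t) with (Wm (2 * m) t + 2 * (t ^ m * (/ t) ^ m)).
  - rewrite E; lra.
  - unfold Wm. replace (2 * m)%nat with (m + m)%nat by lia. rewrite !pow_add. ring.
Qed.

(** Everything is measured at the total index J = k + m: (a + n + k)_m = (a)_(n+J) / (a)_(n+k), and
    (n + J)! / J! times w^J is the negative binomial weight at J up to n! and powers of 1 - w. The
    missing w^k appears as a divisor. The remaining powers are powers of n + 1 times powers of X =
    (J + 1) / [nb_size], which go into [Wm]; two such factors are merged by [Wm_square]. *)
Lemma hyp_term_bound : exists M D E, 0 <= M /\ forall k n m,
  Cmod (hyp_term k n m) <= M * (INR k + 1) ^ D * Rpower (INR n + 1) (- Re b)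
     * (INR (fact n) / INR (fact (n + k))) / (w ^ k * (1 - w) ^ n)
     * (nb w n (k + m) * Wm E ((INR (k + m) + 1) / nb_size w n)).
Proof.
  destruct (poch_upper a) as [M1 [HM1 H1]]. destruct (poch_lower a Ha) as [M2 [HM2 H2]].
  destruct (poch_upper d) as [M3 [HM3 H3]]. destruct (poch_lower c Hc) as [M4 [HM4 H4]].
  destruct (INR_unbounded (Rabs (Re d - 1))) as [D HD].
  destruct (INR_unbounded (Rabs (Re a - 1) + Rabs (- Re b))) as [E0 HE0].
  assert (R1 := Rabs_pos (Re a - 1)). assert (R2 := Rabs_pos (- Re b)).
  set (L := 2 / (1 - w)). assert (HL : 2 <= L).
  { unfold L. apply Rmult_le_reg_r with (1 - w); [lra|]. unfold Rdiv; rewrite Rmult_assoc, Rinv_l; lra. }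
  set (cst := Rpower (/ (1 - w)) (- Re b)). assert (Hcst : 0 < cst) by apply Rpower_pos.
  assert (HLE : 0 < L ^ E0) by (apply pow_lt; lra).
  assert (HMM : 0 < M1 * M2 * M3 * M4) by (repeat apply Rmult_lt_0_compat; auto).
  exists (M1 * M2 * M3 * M4 * (2 * L ^ E0 * cst) / (1 - w)), D, (2 * E0)%nat. split.
  { apply Rdiv_le_0_compat; [|lra]. apply Rmult_le_pos; [lra|]. apply Rmult_le_pos; lra. }
  intros k n m. set (J := (k + m)%nat).
  assert (Hk := INR1_pos k). assert (Hn := INR1_ge1 n). assert (HJ := INR1_pos J). assert (HJ0 := pos_INR J).
  assert (Hs1 := nb_size_ge1 w Hw n).
  set (X := (INR J + 1) / nb_size w n). assert (HX : 0 < X) by (apply Rdiv_lt_0_compat; lra).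
  assert (F1 := INR_fact_lt_0 n). assert (F2 := INR_fact_lt_0 (n + k)). assert (F3 := INR_fact_lt_0 (n + J)).
  assert (F4 := INR_fact_lt_0 J). assert (F5 := INR_fact_lt_0 m).
  assert (B1 : Cmod (poch (a + RtoC (INR (n + k))) m) <=
    M1 * M2 * (INR (fact (n + J)) / INR (fact (n + k))) * (L ^ E0 * Wm E0 X)).
  { assert (Ep : poch (a + RtoC (INR (n + k))) m = (poch a (n + J) * / poch a (n + k))%C).
    { unfold J. rewrite Nat.add_assoc, poch_add. field. apply poch_neq_0; auto. }
    rewrite Ep, Cmod_mult, Cmod_inv by (apply poch_neq_0; auto).
    eapply Rle_trans; [apply Rmult_le_compat; [apply Cmod_ge_0| |apply H1|apply H2]|].
    { left; apply Rinv_0_lt_compat, Cmod_gt_0, poch_neq_0; auto. }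
    set (al := Re a - 1) in *. replace (1 - Re a) with (- al) by (unfold al; ring).
    rewrite Rpower_Ropp.
    assert (Hpn := Rpower_pos (INR (n + k) + 1) al).
    assert (Bq : Rpower (INR (n + J) + 1) al <= (L ^ E0 * Wm E0 X) * Rpower (INR (n + k) + 1) al).
    (* Since J + 1 = X (n + 1) / (1 - w) and k <= J, the numbers n + J + 1 and n + k + 1 differ at
       most by the factor (1 + X) / (1 - w), in either direction. *)
    { apply Rle_trans with ((/ (1 - w) * (1 + X)) ^ E0 * Rpower (INR (n + k) + 1) al).
      - assert (Hi : 1 <= / (1 - w)) by (rewrite <- Rinv_1; apply Rinv_le_contravar; lra).
        assert (HXn : (1 - w) * (INR J + 1) = X * (1 - w) * nb_size w n) by (unfold X; field; lra).
        assert (Hsz : (1 - w) * nb_size w n = INR n + 1) by (unfold nb_size; field; lra).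
        assert (HJX : INR J + 1 = / (1 - w) * X * (INR n + 1)) by (rewrite <- Hsz; unfold X; field; lra).
        assert (Hkk := pos_INR k).
        assert (HkJ : INR k <= INR J) by (apply le_INR; unfold J; lia).
        assert (H0X : 0 <= / (1 - w) * X) by nra.
        rewrite !plus_INR. apply Rpower_compare; try nra; try lra.
      - apply Rmult_le_compat_r; [lra|].
        replace (/ (1 - w) * (1 + X)) with (L * ((1 + X) / 2)) by (unfold L; field; lra).
        rewrite Rpow_mult_distr. apply Rmult_le_compat_l; [lra|].
        destruct (Rle_lt_dec X 1).
        + apply Rle_trans with (1 ^ E0); [apply pow_incr; lra|].
          rewrite pow1. assert (W := Wm_ge2 E0 X HX); lra.
        + apply Rle_trans with (X ^ E0); [apply pow_incr; lra|].
          unfold Wm. assert (0 < (/ X) ^ E0); [|lra]. apply pow_lt, Rinv_0_lt_compat; auto. }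
    apply Rle_trans with (M1 * INR (fact (n + J)) * ((L ^ E0 * Wm E0 X) * Rpower (INR (n + k) + 1) al)
       * (M2 * / Rpower (INR (n + k) + 1) al / INR (fact (n + k)))).
    - apply Rmult_le_compat_r.
      + apply Rdiv_le_0_compat; auto. apply Rmult_le_pos; [lra|]. left; apply Rinv_0_lt_compat; auto.
      + apply Rmult_le_compat_l; [nra|auto].
    - right; field. lra. }
  assert (B2 : Cmod (bcoef (c - b) m) <= M3 * ((INR k + 1) ^ D * Rpower (INR J + 1) (Re d - 1))).
  { unfold bcoef. rewrite Cmod_div, Cmod_R, Rabs_pos_eq by (lra || apply RtoC_fact_neq_0).
    apply Rle_trans with (M3 * Rpower (INR m + 1) (Re d - 1)).
    - apply Rmult_le_reg_r with (INR (fact m)); auto.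
      unfold Rdiv; rewrite Rmult_assoc, Rinv_l by lra. rewrite Rmult_1_r.
      eapply Rle_trans; [apply H3|]. right; ring.
    - apply Rmult_le_compat_l; [lra|]. unfold J. rewrite Nat.add_comm. apply Rpower_unshift_le; lra. }
  assert (B4 : / Cmod (poch c J) <= M4 * Rpower (INR J + 1) (1 - Re c) / INR (fact J)) by apply H4.
  assert (Bpow : Rpower (INR J + 1) (Re d - 1) * Rpower (INR J + 1) (1 - Re c)
     <= cst * Rpower (INR n + 1) (- Re b) * Wm E0 X).
  { rewrite <- Rpower_plus. replace (Re d - 1 + (1 - Re c)) with (- Re b) by (unfold d; simpl; unfold Re; ring).
    replace (INR J + 1) with ((/ (1 - w) * (INR n + 1)) * X) by (unfold X, nb_size; field; lra).
    assert (Hi : 0 < / (1 - w)) by (apply Rinv_0_lt_compat; lra).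
    rewrite <- !Rpower_mult_distr by (auto; try lra; apply Rmult_lt_0_compat; lra).
    fold cst. assert (HR := Rpower_pos (INR n + 1) (- Re b)).
    apply Rmult_le_compat_l; [nra|]. apply Rpower_le_Wm; auto. lra. }
  unfold hyp_term. fold J. unfold Cdiv. rewrite !Cmod_mult, Cmod_inv, Cmod_R, Rabs_pos_eq
    by (try apply poch_neq_0; auto; apply pow_le; lra).
  assert (Hwm : 0 < w ^ m) by (apply pow_lt; lra).
  assert (Hwk : 0 < w ^ k) by (apply pow_lt; lra).
  assert (H1w : 0 < (1 - w) ^ n) by (apply pow_lt; lra).
  assert (HKD : 0 < (INR k + 1) ^ D) by (apply pow_lt; auto).
  assert (HRn := Rpower_pos (INR n + 1) (- Re b)).
  assert (HWp := Wm_ge2 E0 X HX).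
  set (P1 := Rpower (INR J + 1) (Re d - 1)) in *. set (P2 := Rpower (INR J + 1) (1 - Re c)) in *.
  assert (HP1 : 0 < P1) by apply Rpower_pos. assert (HP2 : 0 < P2) by apply Rpower_pos.
  apply Rle_trans with ((M1 * M2 * (INR (fact (n + J)) / INR (fact (n + k))) * (L ^ E0 * Wm E0 X))
     * (M3 * ((INR k + 1) ^ D * P1)) * (M4 * P2 / INR (fact J)) * w ^ m).
  { apply Rmult_le_compat_r; [lra|].
    apply Rmult_le_compat; auto using Cmod_ge_0.
    - apply Rmult_le_pos; apply Cmod_ge_0.
    - left; apply Rinv_0_lt_compat, Cmod_gt_0, poch_neq_0; auto.
    - apply Rmult_le_compat; auto using Cmod_ge_0. }
  set (f := INR (fact (n + J)) / (INR (fact (n + k)) * INR (fact J)) * w ^ m).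
  assert (Hf : 0 < f).
  { unfold f; apply Rmult_lt_0_compat; auto. apply Rdiv_lt_0_compat; auto. apply Rmult_lt_0_compat; auto. }
  replace (M1 * M2 * (INR (fact (n + J)) / INR (fact (n + k))) * (L ^ E0 * Wm E0 X)
     * (M3 * ((INR k + 1) ^ D * P1)) * (M4 * P2 / INR (fact J)) * w ^ m)
    with (M1 * M2 * M3 * M4 * (L ^ E0) * (INR k + 1) ^ D * f * ((P1 * P2) * Wm E0 X))
    by (unfold f; field; lra).
  set (Y := M1 * M2 * M3 * M4 * L ^ E0 * (INR k + 1) ^ D * f).
  assert (HY : 0 < Y) by (unfold Y; do 3 (apply Rmult_lt_0_compat; auto)).
  apply Rle_trans with (Y * (cst * Rpower (INR n + 1) (- Re b) * (2 * Wm (2 * E0) X))).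
  { apply Rmult_le_compat_l; [lra|].
    apply Rle_trans with (cst * Rpower (INR n + 1) (- Re b) * Wm E0 X * Wm E0 X).
    - apply Rmult_le_compat_r; lra.
    - rewrite Rmult_assoc. apply Rmult_le_compat_l; [nra|]. apply Wm_square; auto. }
  right. unfold Y, f, nb. replace (w ^ J) with (w ^ k * w ^ m) by (unfold J; rewrite pow_add; auto).
  simpl (_ ^ S n). field. repeat split; lra.
Qed.

Lemma hyp_term_abssum k n : abssum (hyp_term k n).
Proof.
  destruct hyp_term_bound as [M [D [E [HM H]]]].
  destruct (nb_Wm_bound w Hw E) as [B [HB HBn]]. destruct (HBn n) as [S _].
  eapply abssum_le; [intros m; apply H|].
  apply ex_series_scal_R.
  apply (ex_series_incr_n (fun J => nb w n J * Wm E ((INR J + 1) / nb_size w n)) k); auto.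
Qed.

(** The prefactors w^k and (1 - w)^n of [hyp_family] cancel the divisor of [hyp_term_bound], and the
    sum over m is a tail, from k on, of the bounded mean of [Wm]. *)
Lemma hyp_family_bound : diff_bound hyp_family (- Re b).
Proof.
  destruct hyp_term_bound as [M [D [E [HM H]]]].
  destruct (nb_Wm_bound w Hw E) as [B [HB HBn]].
  destruct (bcoef_poly_bound b) as [D1 H1].
  assert (HR := Rpower_pos (1 - w) (Re a)).
  exists (Rpower (1 - w) (Re a) * M * B), (D1 + D)%nat.
  split; [apply Rmult_le_pos; nra|]. intros k n.
  destruct (HBn n) as [S HS]. specialize (H1 k).
  assert (Hwk : 0 < w ^ k) by (apply pow_lt; lra).
  assert (H1w : 0 < (1 - w) ^ n) by (apply pow_lt; lra).
  assert (Hk := INR1_pos k). assert (HKD : 0 < (INR k + 1) ^ D) by (apply pow_lt; auto).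
  assert (HKD1 : 0 < (INR k + 1) ^ D1) by (apply pow_lt; auto).
  assert (HRn := Rpower_pos (INR n + 1) (- Re b)).
  assert (Hf : 0 < INR (fact n) / INR (fact (n + k))) by (apply Rdiv_lt_0_compat; apply INR_fact_lt_0).
  set (g := fun J => nb w n J * Wm E ((INR J + 1) / nb_size w n)) in *.
  assert (Hg : forall J, 0 <= g J).
  { intros J; apply Rmult_le_pos; [apply nb_pos; auto|].
    assert (W := Wm_ge2 E ((INR J + 1) / nb_size w n)
      ltac:(apply Rdiv_lt_0_compat; [apply INR1_pos|generalize (nb_size_ge1 w Hw n); lra])). lra. }
  set (Q := M * (INR k + 1) ^ D * Rpower (INR n + 1) (- Re b)
     * (INR (fact n) / INR (fact (n + k))) / (w ^ k * (1 - w) ^ n)) in *.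
  assert (HQ : 0 <= Q).
  { unfold Q. apply Rdiv_le_0_compat; [|nra]. apply Rmult_le_pos; [|lra].
    apply Rmult_le_pos; [|lra]. apply Rmult_le_pos; lra. }
  assert (Hser : Cmod (Cser (hyp_term k n)) <= Q * B).
  { eapply Rle_trans; [apply Cser_norm, hyp_term_abssum|].
    apply Rle_trans with (Series (fun m => Q * g (k + m)%nat)).
    - apply Series_le; [intros m; split; [apply Cmod_ge_0|apply H]|].
      apply ex_series_scal_R, (ex_series_incr_n g k); auto.
    - rewrite Series_scal_l. apply Rmult_le_compat_l; auto.
      apply Rle_trans with (Series g); [|exact HS].
      rewrite (Series_split g k S). enough (0 <= rsum g k) by lra.
      clear - Hg. induction k as [|k IH]; simpl; [lra|]. specialize (Hg k); lra. }
  unfold hyp_family. rewrite !Cmod_mult, Cmod_Cpower_pos, Cmod_R, <- RPow_abs, Rabs_Ropp, Rabs_pos_eq by lra.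
  replace (Re (a + RtoC (INR n))) with (Re a + INR n) by (simpl; unfold Re; ring).
  rewrite Rpower_plus, Rpower_pow by lra.
  apply Rle_trans with ((INR k + 1) ^ D1 * w ^ k * (Rpower (1 - w) (Re a) * (1 - w) ^ n) * (Q * B)).
  - apply Rmult_le_compat; auto using Cmod_ge_0.
    + apply Rmult_le_pos; [|nra]. apply Rmult_le_pos; [apply Cmod_ge_0|lra].
    + apply Rmult_le_compat_r; [nra|]. apply Rmult_le_compat_r; lra.
  - right. unfold Q. rewrite pow_add. field. repeat split; try lra; apply INR_fact_neq_0.
Qed.

(** With A = a + n + k, (A + 1)_(m+1) - (A)_(m+1) = (m + 1) (A + 1)_m: the difference of the two
    series starts at m = 1, and after reindexing its terms are those of order (k, n + 1) times w (c
    - b + m) / (c + k + m). That ratio is 1 - (b + k) / (c + k + m), which yields the series of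
    order k + 1. *)
Lemma hyp_term_contiguous k n :
  (RtoC (1 - w) * Cser (hyp_term k (S n)) - Cser (hyp_term k n) =
   - (b + RtoC (INR k)) * RtoC w * Cser (hyp_term (S k) n))%C.
Proof.
  set (A := (a + RtoC (INR (n + k)))%C).
  assert (EA : (a + RtoC (INR (S n + k)))%C = (A + 1)%C).
  { unfold A. rewrite Nat.add_succ_l, S_INR, RtoC_plus. ring. }
  assert (EA' : (a + RtoC (INR (n + S k)))%C = (A + 1)%C).
  { unfold A. rewrite Nat.add_succ_r, S_INR, RtoC_plus. ring. }
  assert (S1 := hyp_term_abssum k (S n)). assert (S2 := hyp_term_abssum k n).
  assert (S3 := hyp_term_abssum (S k) n).
  assert (E : (Cser (hyp_term k (S n)) - Cser (hyp_term k n))%C =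
    (RtoC w * Cser (hyp_term k (S n)) - (b + RtoC (INR k)) * RtoC w * Cser (hyp_term (S k) n))%C).
  { rewrite <- !Cser_scal, <- !Cser_minus by (auto; apply abssum_scal; auto).
    rewrite Cser_S by (apply abssum_minus; auto).
    replace (hyp_term k (S n) 0 - hyp_term k n 0)%C with (RtoC 0) by (unfold hyp_term; simpl; ring).
    rewrite Cplus_0_l. apply Cser_ext; intros m. unfold hyp_term. rewrite EA, EA'. fold A.
    rewrite Nat.add_succ_r, Nat.add_succ_l.
    rewrite (poch_S_l A m). change (poch (A + 1) (S m)) with (poch (A + 1) m * (A + 1 + RtoC (INR m)))%C.
    assert (Hp1 := poch_neq_0 c (k + m) Hc). assert (Hp2 := poch_neq_0 c (S (k + m)) Hc).
    assert (Hp3 : (c + RtoC (INR (k + m)))%C <> RtoC 0).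
    { intros E0; apply Hp2; simpl; rewrite E0; ring. }
    rewrite <- tech_pow_Rmult, RtoC_mult.
    transitivity (poch (A + 1) m * (RtoC (INR (S m)) * bcoef (c - b) (S m)) / poch c (S (k + m)) * (RtoC w * RtoC (w ^ m)))%C.
    - rewrite S_INR, RtoC_plus. unfold Cdiv. ring.
    - rewrite bcoef_S. change (poch c (S (k + m))) with (poch c (k + m) * (c + RtoC (INR (k + m))))%C.
      rewrite plus_INR, RtoC_plus in *. field. auto. }
  rewrite RtoC_minus. 
  transitivity ((Cser (hyp_term k (S n)) - Cser (hyp_term k n)) - RtoC w * Cser (hyp_term k (S n)))%C; [ring|].
  rewrite E; ring.
Qed.

Lemma hyp_family_diff : diff_family hyp_family.
Proof.
  intros k n. unfold hyp_family.
  replace (a + RtoC (INR (S n)))%C with (a + RtoC (INR n) + 1)%C by (rewrite S_INR, RtoC_plus; ring).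
  rewrite (Cpower_add _ (a + RtoC (INR n)) 1), (Cpower_1_pos (1 - w)) by lra.
  transitivity (bcoef b k * RtoC ((- w) ^ k) * Cpower (RtoC (1 - w)) (a + RtoC (INR n)) *
    (RtoC (1 - w) * Cser (hyp_term k (S n)) - Cser (hyp_term k n)))%C; [|ring].
  rewrite hyp_term_contiguous. rewrite <- tech_pow_Rmult, RtoC_mult, RtoC_opp.
  transitivity ((RtoC (INR (S k)) * bcoef b (S k)) * (- RtoC w * RtoC ((- w) ^ k)) *
    Cpower (RtoC (1 - w)) (a + RtoC (INR n)) * Cser (hyp_term (S k) n))%C; [ring|].
  rewrite bcoef_S; ring.
Qed.

End HypFamily.

(** * From the real axis to a sector *)

Definition epow (z : C) (n : nat) : C := (z ^ n / RtoC (INR (fact n)))%C.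

Lemma epow_S (z : C) n : (RtoC (INR (S n)) * epow z (S n) = z * epow z n)%C.
Proof.
  unfold epow. rewrite fact_simpl, mult_INR, RtoC_mult, Cpow_S.
  field. split; [apply RtoC_fact_neq_0|apply RtoC_neq_0, not_0_INR; lia].
Qed.

Lemma epow_binomial (y h : C) n :
  csum (fun i => epow y i * epow h (n - i)%nat)%C (S n) = epow (y + h) n.
Proof.
  induction n as [|n IH]; [unfold epow; simpl; field|].
  apply Cmult_reg_l with (RtoC (INR (S n))); [apply RtoC_neq_0, not_0_INR; lia|].
  rewrite epow_S, <- IH, <- csum_scal.
  rewrite (csum_ext _ (fun i => (RtoC (INR i) * epow y i) * epow h (S n - i)%nat
    + epow y i * (RtoC (INR (S n - i)) * epow h (S n - i)%nat))%C).
  2: { intros i Hi. rewrite minus_INR, RtoC_minus by lia. ring. }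
  rewrite csum_plus, (csum_S_l (fun j => (RtoC (INR j) * epow y j) * _)%C (S n)),
    (csum_S (fun j => epow y j * _)%C (S n)), Nat.sub_diag.
  replace (INR 0) with 0 by auto.
  rewrite !Cmult_0_l, Cmult_0_r, Cplus_0_l, Cplus_0_r, <- csum_plus, <- csum_scal.
  apply csum_ext; intros i Hi. rewrite epow_S.
  replace (S n - S i)%nat with (n - i)%nat by lia.
  replace (S n - i)%nat with (S (n - i)) by lia. rewrite epow_S. ring.
Qed.

(** Newton's forward formula divided by i!, [epow 1 j] being 1 / j!. *)
Lemma newton_forward (A : nat -> nat -> C) : diff_family A -> forall i n,
  csum (fun k => A k n * epow 1 (i - k)%nat)%C (S i) = (A O (n + i)%nat * epow 1 i)%C.
Proof.
  intros HA; induction i as [|i IH]; intros n; [rewrite Nat.add_0_r; simpl; ring|].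
  apply Cmult_reg_l with (RtoC (INR (S i))); [apply RtoC_neq_0, not_0_INR; lia|].
  replace (RtoC (INR (S i)) * (A O (n + S i)%nat * epow 1 (S i)))%C
    with (A O (S n + i)%nat * (RtoC (INR (S i)) * epow 1 (S i)))%C
    by (rewrite Nat.add_succ_r, Nat.add_succ_l; ring).
  rewrite epow_S, Cmult_1_l, <- IH, <- csum_scal.
  rewrite (csum_ext _ (fun k => (RtoC (INR k) * A k n) * epow 1 (S i - k)%nat
    + A k n * (RtoC (INR (S i - k)) * epow 1 (S i - k)%nat))%C).
  2: { intros k Hk. rewrite minus_INR, RtoC_minus by lia. ring. }
  rewrite csum_plus, (csum_S_l (fun k => (RtoC (INR k) * A k n) * _)%C (S i)),
    (csum_S (fun k => A k n * _)%C (S i)), Nat.sub_diag.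
  replace (INR 0) with 0 by auto.
  rewrite !Cmult_0_l, Cmult_0_r, Cplus_0_l, Cplus_0_r, <- csum_plus.
  apply csum_ext; intros k Hk. rewrite HA.
  replace (S i - S k)%nat with (i - k)%nat by lia.
  replace (S i - k)%nat with (S (i - k)) by lia. rewrite epow_S. ring.
Qed.

Lemma Cmod_epow (z : C) n : Cmod (epow z n) = Cmod z ^ n / INR (fact n).
Proof.
  unfold epow. rewrite Cmod_div, Cmod_pow, Cmod_R, Rabs_pos_eq; auto.
  - left; apply INR_fact_lt_0.
  - apply RtoC_fact_neq_0.
Qed.

Lemma fact_ratio_le n k : INR (fact n) / INR (fact (n + k)) <= / INR (fact k).
Proof.
  assert (H : INR (fact n) * INR (fact k) <= INR (fact (n + k))).
  { rewrite <- mult_INR. apply le_INR. induction k as [|k IH]; [rewrite Nat.add_0_r; simpl; lia|].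
    rewrite Nat.add_succ_r, !fact_simpl. nia. }
  assert (F1 := INR_fact_lt_0 k). assert (F2 := INR_fact_lt_0 (n + k)).
  apply Rmult_le_reg_r with (INR (fact (n + k)) * INR (fact k)); [nra|].
  field_simplify; lra.
Qed.

(** * Taylor expansion of Poisson averages at a real point *)

Section Taylor.

Variables (A : nat -> nat -> C) (q : R).
Hypothesis Hdiff : diff_family A.
Hypothesis Hbound : diff_bound A q.

Definition pois_avg (k : nat) (y : R) : C := Cser (fun n => RtoC (pois y n) * A k n)%C.

(** The factor n! / (n + k)! moves the Poisson weight from n to n + k and yields y^(-k) exactly.
    Replacing (n + 1)^q by (n + k + 1)^q costs a power of k + 1, and the latter is at most y^q times
    [Wm] at (n + k + 1) / y; so a tail of a bounded mean remains. *)
Lemma pois_avg_bound : exists M D, 0 <= M /\ forall k y, 1 <= y ->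
  abssum (fun n => RtoC (pois y n) * A k n)%C /\
  Series (fun n => Cmod (RtoC (pois y n) * A k n)) <= M * (INR k + 1) ^ D * Rpower y q / y ^ k.
Proof.
  destruct Hbound as [M [D [HM H]]].
  destruct (INR_unbounded (Rabs q)) as [m Hm].
  destruct (pois_Wm_bound m) as [B [HB HW]].
  exists (M * B), (D + m)%nat. split; [nra|]. intros k y Hy.
  destruct (HW y Hy) as [S E].
  assert (Hyq := Rpower_pos y q). assert (Hk := INR1_pos k).
  assert (Hyk : 0 < y ^ k) by (apply pow_lt; lra).
  assert (HkD : 0 < (INR k + 1) ^ D) by (apply pow_lt; auto).
  assert (Hkm : 0 < (INR k + 1) ^ m) by (apply pow_lt; auto).
  set (g := fun N => pois y N * Wm m ((INR N + 1) / y)).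
  assert (Hg : forall N, 0 <= g N).
  { intros N; apply Rmult_le_pos; [apply pois_pos; lra|].
    assert (W := Wm_ge2 m ((INR N + 1) / y) ltac:(apply Rdiv_lt_0_compat; [apply INR1_pos|lra])). lra. }
  set (Q := M * (INR k + 1) ^ D * (INR k + 1) ^ m * Rpower y q / y ^ k).
  assert (HQ : 0 <= Q).
  { unfold Q. apply Rdiv_le_0_compat; auto. apply Rmult_le_pos; [|lra].
    apply Rmult_le_pos; [|lra]. apply Rmult_le_pos; lra. }
  assert (Hterm : forall n, Cmod (RtoC (pois y n) * A k n) <= Q * g (k + n)%nat).
  { intros n. assert (Hp := pois_pos y n ltac:(lra)).
    rewrite Cmod_mult, Cmod_R, Rabs_pos_eq by auto.
    assert (Hn := INR1_pos n). assert (HN := INR1_pos (n + k)).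
    assert (F0 := INR_fact_lt_0 n). assert (F1 := INR_fact_lt_0 (n + k)).
    assert (HNy : 0 < (INR (n + k) + 1) / y) by (apply Rdiv_lt_0_compat; lra).
    assert (B1 : Rpower (INR n + 1) q <= (INR k + 1) ^ m * (Rpower y q * Wm m ((INR (n + k) + 1) / y))).
    { eapply Rle_trans; [apply (Rpower_unshift_le n k q m); lra|].
      apply Rmult_le_compat_l; [lra|].
      replace (INR (n + k) + 1) with (y * ((INR (n + k) + 1) / y)) at 1 by (field; lra).
      rewrite <- Rpower_mult_distr by lra. apply Rmult_le_compat_l; [lra|].
      apply Rpower_le_Wm; auto; lra. }
    apply Rle_trans with (pois y n * (M * (INR k + 1) ^ D *
      ((INR k + 1) ^ m * (Rpower y q * Wm m ((INR (n + k) + 1) / y))) * (INR (fact n) / INR (fact (n + k))))).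
    - apply Rmult_le_compat_l; auto. eapply Rle_trans; [apply H|].
      apply Rmult_le_compat_r; [apply Rdiv_le_0_compat; lra|].
      apply Rmult_le_compat_l; auto. apply Rmult_le_pos; lra.
    - right. unfold Q, g. rewrite (Nat.add_comm k n). unfold pois. rewrite pow_add.
      field. repeat split; lra. }
  assert (Sg : ex_series (fun n => Q * g (k + n)%nat)).
  { apply ex_series_scal_R, (ex_series_incr_n g k); auto. }
  split; [apply abssum_le with (1 := Hterm); auto|].
  apply Rle_trans with (Q * B).
  - eapply Rle_trans; [apply Series_le with (2 := Sg); intros; split; [apply Cmod_ge_0|auto]|].
    rewrite Series_scal_l. apply Rmult_le_compat_l; auto.
    apply Rle_trans with (Series g); [|exact E].
    rewrite (Series_split g k S). enough (0 <= rsum g k) by lra.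
    clear - Hg. induction k as [|k IH]; simpl; [lra|]. specialize (Hg k); lra.
  - right. unfold Q. rewrite pow_add. field. lra.
Qed.

Lemma diff_row_abssum (h : C) n : abssum (fun k => A k n * h ^ k)%C.
Proof.
  destruct Hbound as [M [D [HM H]]]. assert (HR := Rpower_pos (INR n + 1) q).
  apply abssum_le with (fun k => M * Rpower (INR n + 1) q * ((INR k + 1) ^ D * (Cmod h ^ k / INR (fact k)))).
  - intros k. rewrite Cmod_mult, Cmod_pow.
    assert (Hk : 0 < (INR k + 1) ^ D) by (apply pow_lt, INR1_pos).
    assert (Hh : 0 <= Cmod h ^ k) by (apply pow_le, Cmod_ge_0).
    replace (M * Rpower (INR n + 1) q * ((INR k + 1) ^ D * (Cmod h ^ k / INR (fact k))))
      with (M * (INR k + 1) ^ D * Rpower (INR n + 1) q * / INR (fact k) * Cmod h ^ k)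
      by (unfold Rdiv; ring).
    apply Rmult_le_compat_r; auto. eapply Rle_trans; [apply H|].
    apply Rmult_le_compat_l; [|apply fact_ratio_le].
    apply Rmult_le_pos; [|lra]. apply Rmult_le_pos; lra.
  - apply ex_series_scal_R, ex_series_poly_exp, Cmod_ge_0.
Qed.

Lemma diff_exp_bound : exists M, 0 <= M /\ forall n, Cmod (A O n) <= M * 2 ^ n.
Proof.
  destruct Hbound as [M [D [HM H]]]. destruct (INR_unbounded (Rabs q)) as [m Hm].
  destruct (poly_le_pow2 m) as [M2 [HM2 H2]].
  exists (M * M2); split; [nra|]. intros n.
  eapply Rle_trans; [apply H|]. rewrite Nat.add_0_r.
  replace (M * (INR 0 + 1) ^ D * Rpower (INR n + 1) q * (INR (fact n) / INR (fact n)))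
    with (M * Rpower (INR n + 1) q).
  2: { simpl INR at 1. rewrite Rplus_0_l, pow1. field. apply INR_fact_neq_0. }
  rewrite Rmult_assoc. apply Rmult_le_compat_l; auto.
  eapply Rle_trans; [|apply H2]. rewrite <- Rpower_pow by apply INR1_pos.
  apply Rle_Rpower; [apply INR1_ge1|]. generalize (Rle_abs q); lra.
Qed.

Lemma borel_abssum (z : C) : abssum (fun n => A O n * epow z n)%C.
Proof.
  destruct diff_exp_bound as [M [HM H]].
  apply abssum_le with (fun n => M * ((2 * Cmod z) ^ n / INR (fact n))).
  - intros n. rewrite Cmod_mult, Cmod_epow, Rpow_mult_distr.
    assert (0 <= Cmod z ^ n / INR (fact n)).
    { apply Rdiv_le_0_compat; [apply pow_le, Cmod_ge_0|apply INR_fact_lt_0]. }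
    replace (M * (2 ^ n * Cmod z ^ n / INR (fact n))) with (M * 2 ^ n * (Cmod z ^ n / INR (fact n)))
      by (unfold Rdiv; ring).
    apply Rmult_le_compat_r; auto.
  - apply ex_series_scal_R. eexists; apply is_series_exp.
Qed.

(** [newton_forward] in generating functions: the Cauchy product of the row of differences with the
    exponential series has the shifted sequence as coefficients. *)
Lemma row_identity (h : C) n :
  abssum (fun i => A O (n + i)%nat * epow h i)%C /\
  Cser (fun i => A O (n + i)%nat * epow h i)%C = (Cexp h * Cser (fun k => A k n * h ^ k))%C.
Proof.
  destruct (cauchy_product _ _ (diff_row_abssum h n) (abssum_exp h)) as [H1 H2].
  assert (E : forall i, csum (fun k => A k n * h ^ k * (h ^ (i - k) / RtoC (INR (fact (i - k)))))%C (S i)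
    = (A O (n + i)%nat * epow h i)%C).
  { intros i. assert (N := newton_forward A Hdiff i n).
    rewrite (csum_ext _ (fun k => h ^ i * (A k n * epow 1 (i - k)%nat))%C).
    - rewrite csum_scal, N. unfold epow. rewrite Cpow_1_l. unfold Cdiv; ring.
    - intros k Hk. unfold epow. rewrite Cpow_1_l. replace i with (k + (i - k))%nat at 3 by lia.
      rewrite Cpow_add_r. unfold Cdiv; ring. }
  split; [apply abssum_ext with (1 := E); auto|].
  rewrite <- (Cser_ext _ _ E), <- H2, Cexp_series. ring.
Qed.

(** (y + h)^N / N! is opened by the binomial formula and summed along rows; each row is rewritten by
    [row_identity], and the sums over n and k are exchanged. That last exchange needs |h| < y: by
    [pois_avg_bound] the order k contributes a polynomial in k times (|h| / y)^k. *)
Lemma borel_taylor (y : R) (h : C) : 1 <= y -> Cmod h < y ->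
  abssum (fun k => h ^ k * pois_avg k y)%C /\
  Cser (fun n => A O n * epow (RtoC y + h) n)%C =
    (Cexp (RtoC y + h) * Cser (fun k => h ^ k * pois_avg k y))%C.
Proof.
  intros Hy Hh. assert (Hh0 := Cmod_ge_0 h).
  destruct pois_avg_bound as [M [D [HM HB]]].
  destruct diff_exp_bound as [M1 [HM1 H1]].
  destruct (antidiag (fun n i => A O (n + i)%nat * (epow (RtoC y) n * epow h i))%C) as [_ E1].
  - intros n. apply abssum_ext with (fun i => epow (RtoC y) n * (A O (n + i)%nat * epow h i))%C; [intros; ring|].
    apply abssum_scal, row_identity.
  - apply ex_series_le_R with (fun n => (M1 * exp (2 * Cmod h)) * ((2 * y) ^ n / INR (fact n))).
    + intros n. split.
      * apply Series_pos; [intros; apply Cmod_ge_0|].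
        apply (abssum_ext (fun i => epow (RtoC y) n * (A O (n + i)%nat * epow h i))%C); [intros; ring|].
        apply abssum_scal, row_identity.
      * assert (Hf := INR_fact_lt_0 n). assert (Hyn : 0 <= y ^ n / INR (fact n)).
        { apply Rdiv_le_0_compat; auto. apply pow_le; lra. }
        rewrite <- (is_series_unique _ _ (is_series_exp (2 * Cmod h))).
        replace (M1 * Series (fun k => (2 * Cmod h) ^ k / INR (fact k)) * ((2 * y) ^ n / INR (fact n)))
          with (M1 * ((2 * y) ^ n / INR (fact n)) * Series (fun k => (2 * Cmod h) ^ k / INR (fact k))) by ring.
        rewrite <- Series_scal_l. apply Series_le.
        2: { apply ex_series_scal_R. eexists; apply is_series_exp. }
        intros i; split; [apply Cmod_ge_0|].
        rewrite !Cmod_mult, !Cmod_epow, Cmod_R, Rabs_pos_eq by lra.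
        assert (Hhi : 0 <= Cmod h ^ i / INR (fact i)).
        { apply Rdiv_le_0_compat; [apply pow_le; auto|apply INR_fact_lt_0]. }
        replace (M1 * ((2 * y) ^ n / INR (fact n)) * ((2 * Cmod h) ^ i / INR (fact i)))
          with (M1 * 2 ^ (n + i) * (y ^ n / INR (fact n) * (Cmod h ^ i / INR (fact i)))).
        2: { rewrite pow_add, !Rpow_mult_distr. unfold Rdiv; ring. }
        apply Rmult_le_compat_r; [apply Rmult_le_pos; auto|auto].
    + apply ex_series_scal_R. eexists; apply is_series_exp.
  - assert (Hhy : 0 <= Cmod h / y < 1).
    { split; [apply Rdiv_le_0_compat; lra|]. apply Rmult_lt_reg_r with y; [lra|].
      unfold Rdiv; rewrite Rmult_assoc, Rinv_l; lra. }
    set (W := fun k n => (h ^ k * (RtoC (pois y n) * A k n))%C).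
    assert (W1 : forall k, abssum (W k)) by (intros; apply abssum_scal, HB; auto).
    assert (WE : forall k, Series (fun n => Cmod (W k n)) = Cmod h ^ k * Series (fun n => Cmod (RtoC (pois y n) * A k n))).
    { intros k. rewrite <- Series_scal_l. apply Series_ext; intros n. unfold W.
      rewrite Cmod_mult, Cmod_pow; auto. }
    assert (W2 : ex_series (fun k => Series (fun n => Cmod (W k n)))).
    { apply ex_series_le_R with (fun k => (M * Rpower y q) * ((INR k + 1) ^ D * (Cmod h / y) ^ k)).
      - intros k. assert (Hyk : 0 < y ^ k) by (apply pow_lt; lra).
        assert (Hhk : 0 <= Cmod h ^ k) by (apply pow_le; auto).
        split; [apply Series_pos; [intros; apply Cmod_ge_0|apply W1]|]. rewrite WE.
        replace (M * Rpower y q * ((INR k + 1) ^ D * (Cmod h / y) ^ k))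
          with (Cmod h ^ k * (M * (INR k + 1) ^ D * Rpower y q / y ^ k)).
        + apply Rmult_le_compat_l; auto. apply HB; auto.
        + unfold Rdiv. rewrite Rpow_mult_distr, pow_inv. ring.
      - apply ex_series_scal_R, ex_series_poly_geom; auto. }
    assert (EW : forall k, Cser (W k) = (h ^ k * pois_avg k y)%C).
    { intros k. unfold W, pois_avg. apply Cser_scal, HB; auto. }
    assert (Hs : abssum (fun k => h ^ k * pois_avg k y)%C).
    { apply abssum_ext with (1 := EW). apply abssum_le with (2 := W2). intros; apply Cser_norm; auto. }
    split; auto.
    rewrite <- (Cser_ext _ _ EW), (fubini W W1 W2).
    assert (Hlhs : forall N, csum (fun n => A O (n + (N - n))%nat * (epow (RtoC y) n * epow h (N - n)%nat))%C (S N)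
      = (A O N * epow (RtoC y + h) N)%C).
    { intros N. rewrite <- epow_binomial, <- csum_scal. apply csum_ext; intros n Hn.
      replace (n + (N - n))%nat with N by lia. auto. }
    rewrite <- (Cser_ext _ _ Hlhs), <- E1.
    assert (Ecol : forall n, Cser (fun i => A O (n + i)%nat * (epow (RtoC y) n * epow h i))%C
       = (Cexp (RtoC y + h) * Cser (fun k => W k n))%C).
    { intros n. destruct (row_identity h n) as [R1 R2].
      rewrite (Cser_ext _ (fun i => epow (RtoC y) n * (A O (n + i)%nat * epow h i))%C) by (intros; ring).
      rewrite Cser_scal, R2 by auto.
      rewrite (Cser_ext (fun k => W k n) (fun k => RtoC (pois y n) * (A k n * h ^ k))%C)
        by (intros; unfold W; ring).
      rewrite Cser_scal by apply diff_row_abssum.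
      rewrite Cexp_add, Cexp_RtoC.
      replace (epow (RtoC y) n) with (RtoC (exp y) * RtoC (pois y n))%C; [ring|].
      rewrite <- RtoC_mult. unfold pois. rewrite <- Rmult_assoc, <- exp_plus, Rplus_opp_r, exp_0, Rmult_1_l.
      unfold epow. rewrite RtoC_div, RtoC_pow by apply INR_fact_neq_0. auto. }
    rewrite (Cser_ext _ _ Ecol). apply Cser_scal.
    apply (abssum_le _ _ (fun n => Cser_norm _ (fubini_col W W1 W2 n))), (fubini_abs W W1 W2).
Qed.

Lemma borel_real (y : R) : 0 <= y ->
  Cser (fun n => A O n * epow (RtoC y) n)%C = (Cexp (RtoC y) * Cser (fun n => RtoC (pois y n) * A O n))%C.
Proof.
  intros Hy.
  assert (E : forall n, (A O n * epow (RtoC y) n = Cexp (RtoC y) * (RtoC (pois y n) * A O n))%C).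
  { intros n. rewrite Cexp_RtoC. 
    replace (epow (RtoC y) n) with (RtoC (exp y) * RtoC (pois y n))%C; [ring|].
    rewrite <- RtoC_mult. unfold pois. rewrite <- Rmult_assoc, <- exp_plus, Rplus_opp_r, exp_0, Rmult_1_l.
    unfold epow. rewrite RtoC_div, RtoC_pow by apply INR_fact_neq_0. auto. }
  assert (Hs : abssum (fun n => RtoC (pois y n) * A O n)%C).
  { apply abssum_ext with (fun n => / Cexp (RtoC y) * (A O n * epow (RtoC y) n))%C.
    - intros n; rewrite E. field. apply Cexp_neq_0.
    - apply abssum_scal, borel_abssum. }
  rewrite (Cser_ext _ _ E). apply Cser_scal; auto.
Qed.

End Taylor.

Lemma Rbar_locally_p_infty_scale (P : R -> Prop) (k : R) : 1 <= k ->
  Rbar_locally p_infty P -> Rbar_locally p_infty (fun r => P (r * k)).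
Proof.
  intros Hk [M HM]. exists (Rmax M 0). intros r Hr. apply HM.
  assert (H1 := Rmax_l M 0). assert (H2 := Rmax_r M 0). nra.
Qed.

Section Sector.

Variables (A : nat -> nat -> C) (s K : C).
Hypothesis Hdiff : diff_family A.
Hypothesis Hbound : diff_bound A (Re s).
Hypothesis Hlim : power_like (A O) s K.

(* Taylor coefficients at 1 of the rescaled Poisson average z -> E(r z) / r^s, ... *)
Definition scaled_coef (r : R) (k : nat) : C :=
  (pois_avg A k r * RtoC (r ^ k) / Cpower (RtoC r) s)%C.

(* ... and of their limit z -> z^s. *)
Definition power_coef (k : nat) : C := (bcoef (- s) k * RtoC ((-1) ^ k))%C.

Lemma power_coef_series (h : C) : Cmod h < 1 ->
  abssum (fun k => power_coef k * h ^ k)%C /\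
  Cser (fun k => power_coef k * h ^ k)%C = Cpower (1 + h) s.
Proof.
  intros Hh. assert (Hh' : Cmod (- h) < 1) by (rewrite Cmod_opp; auto).
  assert (E : forall k, (bcoef (- s) k * (- h) ^ k = power_coef k * h ^ k)%C).
  { intros k; unfold power_coef. replace (- h)%C with (RtoC (-1) * h)%C by (apply C_eq; simpl; unfold Re, Im; ring).
    rewrite Cpow_mult_l, RtoC_pow; ring. }
  split; [apply abssum_ext with (1 := E), abssum_binom; auto|].
  rewrite <- (Cser_ext _ _ E), <- binomial_series by auto.
  f_equal; ring.
Qed.

(** r^k cancels the y^(-k) of [pois_avg_bound] and r^s the power of y: the bound is polynomial in k
    and uniform in r. *)
Lemma scaled_coef_bound : exists M D, 0 <= M /\ forall r k, 1 <= r ->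
  Cmod (scaled_coef r k) <= M * (INR k + 1) ^ D.
Proof.
  destruct (pois_avg_bound A (Re s) Hbound) as [M [D [HM H]]].
  exists M, D; split; auto. intros r k Hr. destruct (H k r Hr) as [H1 H2].
  unfold scaled_coef, pois_avg. rewrite Cmod_div, Cmod_mult, Cmod_R, Rabs_pos_eq, Cmod_Cpower_pos
    by (try apply Cpower_neq_0; try apply pow_le; lra).
  assert (Hk : 0 < r ^ k) by (apply pow_lt; lra). assert (HR := Rpower_pos r (Re s)).
  replace (M * (INR k + 1) ^ D) with (M * (INR k + 1) ^ D * Rpower r (Re s) / r ^ k * r ^ k / Rpower r (Re s))
    by (field; lra).
  unfold Rdiv at 1 2. apply Rmult_le_compat_r; [left; apply Rinv_0_lt_compat; auto|].
  apply Rmult_le_compat_r; [lra|]. eapply Rle_trans; [apply Cser_norm; auto|exact H2].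
Qed.

Lemma scaled_coef_series (r : R) (h : C) : 1 <= r -> Cmod h < 1 ->
  abssum (fun k => scaled_coef r k * h ^ k)%C /\
  Cser (fun n => A O n * epow (RtoC r * (1 + h)) n)%C =
    (Cexp (RtoC r * (1 + h)) * Cpower (RtoC r) s * Cser (fun k => scaled_coef r k * h ^ k))%C.
Proof.
  intros Hr Hh.
  destruct (borel_taylor A (Re s) Hdiff Hbound r (RtoC r * h)) as [H1 H2]; auto.
  { rewrite Cmod_mult, Cmod_R, Rabs_pos_eq by lra. assert (H := Cmod_ge_0 h); nra. }
  assert (E : forall k, ((RtoC r * h) ^ k * pois_avg A k r = Cpower (RtoC r) s * (scaled_coef r k * h ^ k))%C).
  { intros k. unfold scaled_coef. rewrite Cpow_mult_l, RtoC_pow. field. apply Cpower_neq_0. }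
  assert (Hs : abssum (fun k => scaled_coef r k * h ^ k)%C).
  { apply abssum_ext with (fun k => / Cpower (RtoC r) s * ((RtoC r * h) ^ k * pois_avg A k r))%C.
    - intros k; rewrite E. field. apply Cpower_neq_0.
    - apply abssum_scal; auto. }
  split; auto.
  replace (RtoC r * (1 + h))%C with (RtoC r + RtoC r * h)%C by ring.
  rewrite H2, (Cser_ext _ _ E), Cser_scal by auto. ring.
Qed.

Lemma scaled_coef_dominated : exists M D, 0 <= M /\
  Rbar_locally p_infty (fun r => forall k,
    Cmod (scaled_coef r k - K * power_coef k) <= M * (INR k + 1) ^ D).
Proof.
  destruct scaled_coef_bound as [M1 [D1 [HM1 H1]]].
  destruct (bcoef_poly_bound (- s)) as [D2 H2].
  assert (HK := Cmod_ge_0 K).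
  exists (M1 + Cmod K), (D1 + D2)%nat; split; [lra|].
  exists 1; intros r Hr k. specialize (H1 r k ltac:(lra)). specialize (H2 k).
  assert (Hk := INR1_ge1 k).
  assert (P1 := pow_ge1 _ D1 Hk). assert (P2 := pow_ge1 _ D2 Hk).
  eapply Rle_trans; [apply Cmod_triangle_sub|]. rewrite Cmod_mult. unfold power_coef.
  rewrite Cmod_mult, Cmod_R, pow_1_abs, Rmult_1_r, pow_add.
  set (X := (INR k + 1) ^ D1) in *. set (Y := (INR k + 1) ^ D2) in *.
  assert (A1 : M1 * X <= M1 * (X * Y)) by (apply Rmult_le_compat_l; nra).
  assert (A2 : Cmod K * Cmod (bcoef (- s) k) <= Cmod K * (X * Y)) by (apply Rmult_le_compat_l; nra).
  lra.
Qed.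

(** For real h in (0, 1/2) the difference of the two series is (1 + h)^s times the error of
    [borel_abelian] at r (1 + h), which tends to 0; [coef_small] passes from these values to the
    coefficients. *)
Lemma scaled_coef_lim k :
  small (Rbar_locally p_infty) (fun r => Cmod (scaled_coef r k - K * power_coef k)).
Proof.
  destruct scaled_coef_dominated as [M [D [HM HB]]].
  apply (coef_small (Rbar_locally p_infty) (fun r k => scaled_coef r k - K * power_coef k)%C
    (fun k => M * (INR k + 1) ^ D) (/ 2)); auto.
  - lra.
  - intros j; apply Rmult_le_pos; auto. apply pow_le; left; apply INR1_pos.
  - apply ex_series_ext with (fun j => M * ((INR j + 1) ^ D * (/ 2) ^ j)).
    + intros j; symmetry; apply Rmult_assoc.
    + apply ex_series_scal_R, ex_series_poly_geom; lra.
  - intros h Hh. assert (Hh1 : Cmod (RtoC h) < 1) by (rewrite Cmod_R, Rabs_pos_eq; lra).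
    destruct (power_coef_series (RtoC h) Hh1) as [P1 P2].
    assert (Hab := borel_abelian (A O) s K Hlim).
    assert (Hab2 : Clim (Rbar_locally p_infty) (fun r =>
      Cser (fun n => RtoC (pois (r * (1 + h)) n) * A O n) / Cpower (RtoC (r * (1 + h))) s)%C K).
    { intros e He. apply (Rbar_locally_p_infty_scale (fun y => Cmod
        (Cser (fun n => RtoC (pois y n) * A O n) / Cpower (RtoC y) s - K)%C < e)); [lra|].
      apply Hab; auto. }
    assert (Hab3 := Clim_scal (Rbar_locally p_infty) (Cpower (RtoC (1 + h)) s) _ _ Hab2).
    apply (small_le (Rbar_locally p_infty)) with (2 := Hab3).
    exists 1; intros r Hr.
    destruct (scaled_coef_series r (RtoC h) ltac:(lra) Hh1) as [S1 S2].
    right. f_equal.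
    rewrite (Cser_ext _ (fun k => scaled_coef r k * RtoC h ^ k - K * (power_coef k * RtoC h ^ k))%C)
      by (intros; rewrite RtoC_pow; ring).
    rewrite Cser_minus, Cser_scal, P2 by (auto; apply abssum_scal; auto).
    assert (E : (RtoC r * (1 + RtoC h))%C = RtoC (r * (1 + h))) by (rewrite RtoC_mult, RtoC_plus; auto).
    rewrite E, (borel_real A (Re s) Hbound) in S2 by nra.
    rewrite <- Cmult_assoc in S2. apply Cmult_reg_l in S2; [|apply Cexp_neq_0].
    rewrite S2, Cpower_mult_pos by lra.
    replace (1 + RtoC h)%C with (RtoC (1 + h)) by (rewrite RtoC_plus; auto).
    field. split; apply Cpower_neq_0.
Qed.

Lemma scaled_series_lim (t : R) : 0 <= t < 1 ->
  small (Rbar_locally p_infty) (fun r =>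
    Series (fun k => Cmod (scaled_coef r k - K * power_coef k) * t ^ k)).
Proof.
  intros Ht. destruct scaled_coef_dominated as [M [D [HM HB]]].
  apply (tannery (Rbar_locally p_infty)) with (M := fun k => M * ((INR k + 1) ^ D * t ^ k)).
  - intros k. apply Rmult_le_pos; auto. apply Rmult_le_pos; apply pow_le; [left; apply INR1_pos|lra].
  - apply ex_series_scal_R, ex_series_poly_geom; auto.
  - revert HB; apply filter_imp; intros r Hr k. assert (Hk : 0 <= t ^ k) by (apply pow_le; lra).
    split; [apply Rmult_le_pos; auto; apply Cmod_ge_0|].
    rewrite <- Rmult_assoc. apply Rmult_le_compat_r; auto.
  - intros k. apply (small_le (Rbar_locally p_infty)) with (fun r => t ^ k * Cmod (scaled_coef r k - K * power_coef k)).
    + apply filter_forall; intros r; right; ring.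
    + apply (small_scal (Rbar_locally p_infty)); [apply pow_le; lra|apply scaled_coef_lim].
Qed.

(** The right-hand side does not depend on h, so the convergence is uniform on the disc and h may
    vary with y. *)
Lemma scaled_disc_bound (r t : R) (h : C) : 1 <= r -> 0 <= t < 1 -> Cmod h <= t ->
  Cmod (Cser (fun n => A O n * epow (RtoC r * (1 + h)) n) /
      (Cpower (RtoC r) s * Cexp (RtoC r * (1 + h))) - K * Cpower (1 + h) s)%C <=
  Series (fun k => Cmod (scaled_coef r k - K * power_coef k) * t ^ k).
Proof.
  intros Hr Ht Hh.
  destruct (scaled_coef_series r h Hr ltac:(lra)) as [S1 S2].
  destruct (power_coef_series h ltac:(lra)) as [P1 P2].
  destruct scaled_coef_bound as [M1 [D1 [HM1 H1]]].
  replace (_ / _ - _)%C with (Cser (fun k => (scaled_coef r k - K * power_coef k) * h ^ k)%C).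
  2: { rewrite (Cser_ext _ (fun k => scaled_coef r k * h ^ k - K * (power_coef k * h ^ k))%C) by (intros; ring).
       rewrite Cser_minus, Cser_scal, P2, S2 by (auto; apply abssum_scal; auto).
       field. split; [apply Cexp_neq_0|apply Cpower_neq_0]. }
  assert (Htc : Cmod (RtoC t) < 1) by (rewrite Cmod_R, Rabs_pos_eq; lra).
  destruct (scaled_coef_series r (RtoC t) Hr Htc) as [S3 _].
  destruct (power_coef_series (RtoC t) Htc) as [P3 _].
  assert (Hst : ex_series (fun k => Cmod (scaled_coef r k - K * power_coef k) * t ^ k)).
  { apply ex_series_ext with (2 := abssum_minus _ _ S3 (abssum_scal K _ P3)). intros k.
    replace (scaled_coef r k * RtoC t ^ k - K * (power_coef k * RtoC t ^ k))%C
      with ((scaled_coef r k - K * power_coef k) * RtoC t ^ k)%C by ring.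
    rewrite Cmod_mult, Cmod_pow, Cmod_R, Rabs_pos_eq; lra || auto. }
  assert (Hle : forall k, Cmod ((scaled_coef r k - K * power_coef k) * h ^ k) <=
     Cmod (scaled_coef r k - K * power_coef k) * t ^ k).
  { intros k; rewrite Cmod_mult, Cmod_pow. apply Rmult_le_compat_l; [apply Cmod_ge_0|].
    apply pow_incr; split; auto; apply Cmod_ge_0. }
  eapply Rle_trans; [apply Cser_norm, abssum_le with (1 := Hle); auto|].
  apply Series_le; auto. intros k; split; [apply Cmod_ge_0|auto].
Qed.

(** Seen from the origin, the circle of centre r and radius r cos delta has its tangents at angle
    PI/2 - delta, with points of contact at distance r sin delta: this is the origin of r = |y| /
    sin delta. In formulas, Re y >= |y| sin delta gives |y - r|^2 <= r^2 (1 - sin^2 delta). *)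
Lemma sector_disc (delta : R) (y : C) : 0 < delta < PI / 2 -> y <> RtoC 0 -> Csector delta y ->
  Cmod (y - RtoC (Cmod y / sin delta)) <= cos delta * (Cmod y / sin delta).
Proof.
  intros Hd Hy Hs. unfold Csector in Hs.
  assert (Hsin : 0 < sin delta) by (apply sin_gt_0; lra).
  assert (Hcos : 0 < cos delta) by (apply cos_gt_0; lra).
  set (r := Cmod y / sin delta).
  assert (Hyp := proj1 (Cmod_gt_0 y) Hy).
  assert (Hr : 0 < r) by (apply Rdiv_lt_0_compat; auto).
  assert (Ey : Cmod y = r * sin delta) by (unfold r; field; lra).
  assert (Hre : Cmod y * sin delta <= Re y).
  { rewrite (polar y Hy) at 2. simpl Re. apply Rmult_le_compat_l; [lra|].
    rewrite <- cos_shift.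
    assert (Hca : cos (Carg y) = cos (Rabs (Carg y))).
    { unfold Rabs; destruct Rcase_abs; auto. rewrite cos_neg; auto. }
    rewrite Hca. assert (H0 := Rabs_pos (Carg y)). apply cos_decr_1; lra. }
  apply Rsqr_incr_0_var; [|apply Rmult_le_pos; lra].
  replace (Rsqr (Cmod (y - RtoC r))) with (Cmod y ^ 2 - 2 * r * Re y + r ^ 2).
  - rewrite Ey in *. assert (E := sin2_cos2 delta). unfold Rsqr in *.
    assert (2 * r * (r * sin delta * sin delta) <= 2 * r * Re y) by (apply Rmult_le_compat_l; lra).
    replace (cos delta * r * (cos delta * r)) with (r ^ 2 * (cos delta * cos delta)) by ring.
    replace (cos delta * cos delta) with (1 - sin delta * sin delta) by lra. nra.
  - replace (Rsqr (Cmod (y - RtoC r))) with (Cmod (y - RtoC r) ^ 2) by (unfold Rsqr; ring).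
    rewrite !Cmod2_alt. simpl. unfold Re, Im. ring.
Qed.

(** Writing y = r (1 + h) with r = |y| / sin delta gives |h| <= cos delta < 1 for every y of the
    sector, so a single disc serves the whole sector. Dividing by K (1 + h)^s costs only a
    constant. *)
Lemma borel_sector (delta : R) : 0 < delta < PI / 2 -> K <> RtoC 0 ->
  Clim (within (Csector delta) C_infty)
    (fun y => Cser (fun n => A O n * epow y n) / (K * Cpower y s * Cexp y))%C 1.
Proof.
  intros Hd HK.
  assert (Hsin : 0 < sin delta) by (apply sin_gt_0; lra).
  assert (Hcos : 0 < cos delta) by (apply cos_gt_0; lra).
  assert (E := sin2_cos2 delta). unfold Rsqr in E.
  assert (Hcos1 : cos delta < 1) by nra. assert (Hsin1 : sin delta < 1) by nra.
  assert (HKp := proj1 (Cmod_gt_0 K) HK).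
  (* Bounds |(1 + h)^(-s)|; the modulus of 1 + h is exactly sin delta, which is therefore both the
     lower and the upper bound. *)
  set (B := exp (Rabs (Re (- s)) * (Rabs (ln (sin delta)) + Rabs (ln (sin delta))) + Rabs (Im (- s)) * PI)).
  assert (HBp : 0 < B) by apply exp_pos.
  assert (HL := scaled_series_lim (cos delta) ltac:(lra)).
  intros e He.
  destruct (HL (e * Cmod K / B) ltac:(apply Rdiv_lt_0_compat; nra)) as [M HM].
  exists (Rmax M 1). intros y Hy Hsec.
  assert (HM1 := Rmax_l M 1). assert (HM2 := Rmax_r M 1).
  assert (Hy0 : y <> RtoC 0) by (apply Cmod_gt_0; lra).
  set (r := Cmod y / sin delta).
  assert (Er : r * sin delta = Cmod y) by (unfold r; field; lra).
  assert (Hr : Cmod y < r) by nra.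
  set (h := ((y - RtoC r) / RtoC r)%C).
  assert (Hr0 : RtoC r <> RtoC 0) by (apply RtoC_neq_0; lra).
  assert (Hyh : y = (RtoC r * (1 + h))%C) by (unfold h; field; auto).
  assert (Hh : Cmod h <= cos delta).
  { unfold h. rewrite Cmod_div, Cmod_R, Rabs_pos_eq by (auto; lra).
    apply Rmult_le_reg_r with r; [lra|]. unfold Rdiv; rewrite Rmult_assoc, Rinv_l, Rmult_1_r by lra.
    apply sector_disc; auto. }
  assert (Hz : Cmod (1 + h) = sin delta).
  { apply Rmult_eq_reg_l with r; [|lra]. rewrite Er, Hyh at 1.
    rewrite Cmod_mult, Cmod_R, Rabs_pos_eq by lra. auto. }
  assert (Hz0 : (1 + h)%C <> RtoC 0) by (apply Cmod_gt_0; lra).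
  assert (Hp : Cpower y s = (Cpower (RtoC r) s * Cpower (1 + h) s)%C).
  { rewrite Hyh at 1. apply Cpower_mult; auto.
    rewrite Carg_pos, Rabs_R0, Rplus_0_l by lra.
    assert (Hre : 0 < Re (1 + h)).
    { replace (1 + h)%C with (1 - (- h))%C by ring. apply Re_one_minus_pos. rewrite Cmod_opp; lra. }
    rewrite Carg_atan by auto. assert (Hat := atan_bound (Im (1 + h) / Re (1 + h))).
    apply Rabs_def1; lra. }
  assert (HD := scaled_disc_bound r (cos delta) h ltac:(lra) ltac:(lra) Hh).
  rewrite <- Hyh in HD. set (F := Cser _) in *.
  specialize (HM r ltac:(lra)).
  assert (HPb : Cmod (Cpower (1 + h) (- s)) <= B) by (apply Cmod_Cpower_le; auto; lra).
  replace (F / (K * Cpower y s * Cexp y) - 1)%C with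
    (/ K * Cpower (1 + h) (- s) * (F / (Cpower (RtoC r) s * Cexp y) - K * Cpower (1 + h) s))%C.
  2: { rewrite Hp, Cpower_opp. field. repeat split; auto; try apply Cpower_neq_0; apply Cexp_neq_0. }
  rewrite !Cmod_mult, Cmod_inv by auto.
  apply Rle_lt_trans with (/ Cmod K * B * Series (fun k => Cmod (scaled_coef r k - K * power_coef k) * cos delta ^ k)).
  - apply Rmult_le_compat; auto using Cmod_ge_0.
    + apply Rmult_le_pos; [left; apply Rinv_0_lt_compat; auto|apply Cmod_ge_0].
    + apply Rmult_le_compat_l; auto. left; apply Rinv_0_lt_compat; auto.
  - replace e with (/ Cmod K * B * (e * Cmod K / B)) by (field; lra).
    apply Rmult_lt_compat_l; auto. apply Rmult_lt_0_compat; auto. apply Rinv_0_lt_compat; auto.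
Qed.

End Sector.

Local Open Scope C_scope.

Theorem theorem3p4 (a b c c' : C) (delta x : R)
  (hb : (0 < Re b)%R) (hbc : (Re b < Re c)%R)
  (ha : ~ nonpos_int a) (hc' : ~ nonpos_int c')
  (hdelta0 : (0 < delta)%R) (hdelta1 : (delta < PI / 2)%R)
  (hx : (x < 0)%R) :
  asymp_equiv (within (Csector delta) C_infty)
    (fun y : C => Psi1 a b c c' (RtoC x) y)
    (fun y : C =>
       CGamma c * CGamma c' / (CGamma a * CGamma (c - b))
         * Cpower (- RtoC x) (- b) * Cpower y (a - b - c') * Cexp y).
Proof.
  destruct (Pfaff_ratio x hx) as [Hw _]. set (w := (- x / (1 - x))%R) in *.
  (* The row k = 0 is the coefficient sequence of Psi_1, with the Gauss factor in Pfaff's form; the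
     other rows are its differences by the Leibniz rule. *)
  set (A := diff_product (ratio_family a c') (hyp_family a b c w)).
  assert (HA0 : forall n, A O n = poch a n / poch c' n * hyp2F1 (a + RtoC (INR n)) b c (RtoC x)).
  { intros n. unfold A, diff_product. simpl csum.
    unfold ratio_family, hyp_family. rewrite Nat.add_0_r.
    destruct (hyp2F1_Pfaff (a + RtoC (INR n)) b c x hb hbc hx) as [_ E]. fold w in E. rewrite E.
    rewrite (Cser_ext (hyp_term a b c w 0 n)
      (fun k => bcoef (a + RtoC (INR n)) k * RtoC (w ^ k) * (poch (c - b) k / poch c k))).
    - unfold bcoef. simpl. field. apply poch_neq_0; auto.
    - intros k. unfold hyp_term, bcoef. rewrite Nat.add_0_r. change (0 + k)%nat with k.
      field. split; [apply poch_neq_0, Re_pos_not_nonpos; lra|apply RtoC_fact_neq_0]. }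
  assert (Hdiff : diff_family A).
  { apply diff_product_family; [apply ratio_family_diff|apply hyp_family_diff]; auto. }
  assert (Hbound : diff_bound A (Re (a - b - c'))).
  { replace (Re (a - b - c')) with (Re a - Re c' + - Re b)%R by (simpl; unfold Re; ring).
    apply diff_product_bound; [apply ratio_family_bound|apply hyp_family_bound]; auto. }
  set (K := CGamma c * CGamma c' / (CGamma a * CGamma (c - b)) * Cpower (- RtoC x) (- b)).
  assert (Hlim : power_like (A O) (a - b - c') K).
  { apply (power_like_ext _ _ _ _ _ _ (fun n => eq_sym (HA0 n)) eq_refl eq_refl).
    apply power_like_coef; auto. }
  (* The limit of a quotient by K is taken, so K must not vanish; this rests on [CGamma] being
     non-zero at the four arguments. *)
  assert (HK : K <> RtoC 0).
  { unfold K. apply Cmult_neq_0; [|apply Cpower_neq_0].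
    apply Cmult_neq_0; [apply Cmult_neq_0|apply Cinv_neq_0, Cmult_neq_0];
      apply gamma_lim; auto; apply Re_pos_not_nonpos; simpl; unfold Re in *; lra. }
  unfold asymp_equiv. apply (Clim_locally (within (Csector delta) C_infty)).
  apply (Clim_ext (within (Csector delta) C_infty)) with
    (2 := borel_sector A (a - b - c') K Hdiff Hbound Hlim delta (conj hdelta0 hdelta1) HK).
  intros y. fold K. f_equal. unfold Psi1.
  rewrite CSeries_Cser.
  - apply Cser_ext; intros n. rewrite HA0; auto.
  - apply abssum_ext with (2 := borel_abssum A _ Hbound y). intros n; rewrite HA0; auto.
Qed.
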